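(* Let $1<p<\infty$, $\alpha\in SOS(\mathbb{R}_+)$, $a_k\in SO(\mathbb{R}_+)$ for all $k\in\mathbb{Z}$, and $$A=\sum_{k\in\mathbb{Z}}a_kU_\alpha^k\in W_{\alpha,p}^{SO}.$$ Let $A^\diamond:=\sum_{k\in\mathbb{Z}}(\overline{a_k}\circ\alpha_{-k})U_\alpha^{-k}\in W_{\alpha,p}^{SO}$. (a) If $A$ is left invertible on $L^p(\mathbb{R}_+)$, then the operator $A^\diamond A$ is invertible on $L^p(\mathbb{R}_+)$, the operator $A^L:=(A^\diamond A)^{-1}A^\diamond$ is a left inverse of $A$, and $A^L\in W_{\alpha,p}^{SO}$. (b) If $A$ is right invertible on $L^p(\mathbb{R}_+)$, then the operator $AA^\diamond$ is invertible on $L^p(\mathbb{R}_+)$, the operator $A^R:=A^\diamond(AA^\diamond)^{-1}$ is a right inverse of $A$, and $A^R\in W_{\alpha,p}^{SO}$.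
   Context: Notation: $\mathbb{R}_+=(0,+\infty)$, and $C_b(\mathbb{R}_+)$ is the $C^*$-algebra of bounded continuous complex functions on $\mathbb{R}_+$ with the sup norm. An operator $A$ bounded on $L^p(\mathbb{R}_+)$ is left (right) invertible if there is a bounded operator $B$ on $L^p(\mathbb{R}_+)$ with $BA=I$ ($AB=I$); such $B$ is called a left (right) inverse. $SO(\mathbb{R}_+)$ is the $C^*$-algebra of all $f\in C_b(\mathbb{R}_+)$ that are slowly oscillating at $0$ and $\infty$: $\lim_{r\to s}\sup_{t,\tau\in[r,2r]}|f(t)-f(\tau)|=0$ for $s\in\{0,\infty\}$. $SOS(\mathbb{R}_+)$ is the set of slowly oscillating shifts: orientation-preserving homeomorphisms $\alpha$ of $[0,+\infty]$ onto itself whose only fixed points are $0$ and $\infty$, whose restriction to $\mathbb{R}_+$ is a diffeomorphism, and such that $\log\alpha'$ is bounded and $\alpha'\in SO(\mathbb{R}_+)$. The iterates are $\alpha_0(t):=t$, $\alpha_k(t):=\alpha[\alpha_{k-1}(t)]$ and $\alpha_{-k}(t):=\alpha_{-1}[\alpha_{-k+1}(t)]$ for $k\in\mathbb{N}$, where $\alpha_{-1}$ is the inverse function of $\alpha$. The shift operator $U_\alpha f:=(\alpha')^{1/p}(f\circ\alpha)$ is an isometric isomorphism of $L^p(\mathbb{R}_+)$ onto itself, and $U_\alpha^{-k}:=(U_\alpha^{-1})^k$ for $k\in\mathbb{N}$. $W_{\alpha,p}^{SO}$ is the set of operators $A=\sum_{k\in\mathbb{Z}}a_kU_\alpha^k$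 on $L^p(\mathbb{R}_+)$ with $a_k\in SO(\mathbb{R}_+)$ and $\|A\|_{W_{\alpha,p}^{SO}}:=\sum_{k\in\mathbb{Z}}\|a_k\|_{C_b(\mathbb{R}_+)}<\infty$; it is a Banach algebra under the usual operations and this norm. *)

(* Defs.v *)
From HB Require Import structures.
From mathcomp Require Import all_boot all_order all_algebra.
From mathcomp Require Import complex finmap.
From mathcomp Require Import all_classical all_reals all_analysis.
From mathcomp Require Import measurable_realfun.
From mathcomp Require ring_quotient summability.
Set Implicit Arguments.
Unset Strict Implicit.
Unset Printing Implicit Defensive.
Import Order.TTheory GRing.Theory Num.Theory.
Import numFieldNormedType.Exports.
Import Normc.
Local Open Scope classical_set_scope.
Local Open Scope ring_scope.
Local Open Scope complex_scope.

Definition Rpos {R : realType} : set R := `]0, +oo[.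

Lemma measurable_Rpos {R : realType} : measurable (@Rpos R).
Proof. exact: measurable_itv. Qed.

Section LpFunctions.
Context {R : realType}.
Implicit Types (f g : R -> R[i]) (p : R).
Local Notation mu := (@lebesgue_measure R).

Definition cmeasurable f :=
  measurable_fun Rpos (fun x => complex.Re (f x)) /\
  measurable_fun Rpos (fun x => complex.Im (f x)).

Definition cabs f : R -> R := fun x => normc (f x).

(* The values of f outside of Rpos are never used. *)
Definition LpN p f : \bar R := 'N[mu]_p%:E [EFin \o (cabs f \_ Rpos)].

Lemma cmeasurableD f g : cmeasurable f -> cmeasurable g -> cmeasurable (f + g).
Proof.
move=> [fr fi] [gr gi]; split.
- rewrite (_ : (fun _ => _) = (fun x => complex.Re (f x) + complex.Re (g x))).
    exact: measurable_funD.
  by apply/funext => x; rewrite !fctE; case: (f x) (g x) => [? ?] [].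
- rewrite (_ : (fun _ => _) = (fun x => complex.Im (f x) + complex.Im (g x))).
    exact: measurable_funD.
  by apply/funext => x; rewrite !fctE; case: (f x) (g x) => [? ?] [].
Qed.

Lemma cmeasurableM f g : cmeasurable f -> cmeasurable g ->
  cmeasurable (fun x => f x * g x).
Proof.
move=> [fr fi] [gr gi]; split.
- rewrite (_ : (fun _ => _) = (fun x => complex.Re (f x) * complex.Re (g x)
                                 - complex.Im (f x) * complex.Im (g x))).
    by apply: measurable_funB; exact: measurable_funM.
  by apply/funext => x; case: (f x) (g x) => [? ?] [].
- rewrite (_ : (fun _ => _) = (fun x => complex.Re (f x) * complex.Im (g x)
                                 + complex.Im (f x) * complex.Re (g x))).
    by apply: measurable_funD; exact: measurable_funM.
  by apply/funext => x; case: (f x) (g x) => [? ?] [].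
Qed.

Lemma cmeasurable_cst c : cmeasurable (fun=> c).
Proof. by split; exact: measurable_cst. Qed.

Lemma cmeasurableZ c f : cmeasurable f -> cmeasurable (c *: f).
Proof. exact/cmeasurableM/cmeasurable_cst. Qed.

Lemma measurable_cabs f : cmeasurable f -> measurable_fun Rpos (cabs f).
Proof.
move=> [fr fi].
rewrite (_ : cabs f = Num.sqrt \o
  (fun x => complex.Re (f x) ^+ 2 + complex.Im (f x) ^+ 2)); last first.
  by apply/funext => x; rewrite /cabs /=; case: (f x).
apply: measurableT_comp.
  by apply: continuous_measurable_fun; exact: sqrt_continuous.
by apply: measurable_funD; exact: measurable_funX.
Qed.

Lemma measurable_cabs_patch f : cmeasurable f ->
  measurable_fun [set: R] (cabs f \_ Rpos).
Proof.
move=> mf; apply/(measurable_restrictT _ measurable_Rpos).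
exact: measurable_cabs.
Qed.

Lemma cabs_ge0 f x : 0 <= cabs f x.
Proof. by rewrite /cabs; case: (f x) => a b; exact: sqrtr_ge0. Qed.

Lemma patch_cabs_ge0 f x : 0 <= (cabs f \_ Rpos) x.
Proof. by rewrite patchE; case: ifP => // _; exact: cabs_ge0. Qed.

Lemma LpNE p f : 0 < p -> LpN p f =
  ((\int[mu]_(x in Rpos) (cabs f x `^ p)%:E) `^ p^-1)%E.
Proof.
move=> p0; rewrite /LpN unlock [in RHS]integral_mkcond.
congr (_ `^ _)%E; apply: eq_integral => x _ /=.
rewrite ger0_norm ?patch_cabs_ge0// !patchE; case: ifP => // _.
by rewrite powR0// gt_eqF.
Qed.

Lemma LpN_ge0 p f : (0 <= LpN p f)%E.
Proof. exact: Lnorm_ge0. Qed.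

Lemma measurable_cabs_powR p f : cmeasurable f ->
  measurable_fun Rpos (fun x => (cabs f x `^ p)%:E).
Proof.
move=> mf; apply/measurable_EFinP.
apply: (@measurableT_comp _ _ _ _ _ _ (@powR R ^~ p)) => //.
exact: measurable_cabs.
Qed.

Lemma le_LpN p (f g : R -> R[i]) : 0 < p -> cmeasurable f -> cmeasurable g ->
  (forall x, Rpos x -> cabs f x <= cabs g x) -> (LpN p f <= LpN p g)%E.
Proof.
move=> p0 mf mg fg; rewrite !(LpNE _ p0).
have i0 h : (0 <= \int[mu]_(x in Rpos) (cabs h x `^ p)%:E)%E.
  by apply: integral_ge0 => x _; rewrite lee_fin powR_ge0.
apply: gt0_ler_poweR.
- by rewrite invr_ge0 ltW.
- by rewrite in_itv/= i0 leey.
- by rewrite in_itv/= i0 leey.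
apply: ge0_le_integral => //.
- exact: measurable_Rpos.
- by move=> x _; rewrite lee_fin powR_ge0.
- exact: measurable_cabs_powR.
- exact: measurable_cabs_powR.
- move=> x xpos; rewrite lee_fin ge0_ler_powR ?nnegrE ?cabs_ge0 ?(ltW p0)//.
  exact: fg.
Qed.

Lemma LpND p f g : 1 <= p -> cmeasurable f -> cmeasurable g ->
  (LpN p (f + g)%R <= LpN p f + LpN p g)%E.
Proof.
move=> p1 mf mg.
apply: le_trans (minkowski_EFin (@lebesgue_measure R) (measurable_cabs_patch mf)
  (measurable_cabs_patch mg) p1).
pose h x := ((cabs f x + cabs g x)%:C : R[i]).
have abs_h : cabs h = cabs f \+ cabs g.
  apply/funext => x; rewrite /h [LHS]/cabs /= expr0n/= addr0 sqrtr_sqr.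
  by rewrite ger0_norm// addr_ge0// cabs_ge0.
have mh : cmeasurable h.
  split; last exact: measurable_cst.
  by apply: measurable_funD; exact: measurable_cabs.
have -> : cabs f \_ Rpos \+ cabs g \_ Rpos = cabs h \_ Rpos.
  by apply/funext => x; rewrite abs_h /= !patchE; case: ifP; rewrite ?addr0.
apply: le_LpN => //; first exact: lt_le_trans p1.
  exact: cmeasurableD.
by move=> x _; rewrite abs_h; exact: le_normcD.
Qed.

Lemma LpNZ p c f : 0 < p -> cmeasurable f ->
  LpN p (c *: f) = ((normc c)%:E * LpN p f)%E.
Proof.
move=> p0 mf; rewrite !(LpNE _ p0).
have c0 : 0 <= normc c by case: c => *; exact: sqrtr_ge0.
under eq_integral => x _.
  rewrite (_ : cabs (c *: f) x = normc c * cabs f x); last first.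
    by rewrite /cabs -normcM.
  rewrite powRM ?cabs_ge0// EFinM.
  over.
rewrite ge0_integralZl//.
- rewrite poweRM ?lee_fin ?powR_ge0 ?integral_ge0//.
    by rewrite poweR_EFin -powRrM mulfV ?gt_eqF// powRr1.
  by move=> x _; rewrite lee_fin powR_ge0.
- exact: measurable_Rpos.
- exact: measurable_cabs_powR.
- by move=> x _; rewrite lee_fin powR_ge0.
- by rewrite lee_fin powR_ge0.
Qed.

Lemma LpN_ae p f g : 0 < p -> cmeasurable f -> cmeasurable g ->
  ae_eq mu Rpos f g -> LpN p f = LpN p g.
Proof.
move=> p0 mf mg fg; rewrite (LpNE f p0) (LpNE g p0); congr (_ `^ _)%E.
apply: ae_eq_integral.
- exact: measurable_Rpos.
- exact: measurable_cabs_powR.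
- exact: measurable_cabs_powR.
- exact: (ae_eq_comp (fun z => (normc z `^ p)%:E) fg).
Qed.

Lemma LpN_eq0 p f : 0 < p -> cmeasurable f ->
  (LpN p f = 0)%E <-> ae_eq mu Rpos f (fun=> 0).
Proof.
move=> p0 mf; split; last first.
  move=> /(LpN_ae p0 mf (cmeasurable_cst _)) ->.
  rewrite /LpN (_ : EFin \o _ = cst 0%E) ?Lnorm0 ?eqe ?gt_eqF//.
  by apply/funext => x /=; rewrite patchE /cabs normc0 if_same.
move=> /Lnorm_eq0_eq0 h.
have {h} : ae_eq mu setT (EFin \o cabs f \_ Rpos) \0%E.
  apply: h; last by rewrite lte_fin.
  by apply/measurable_EFinP; exact: measurable_cabs_patch.
apply: (@filterS _ _ (ae_filter_ringOfSetsType mu)) => x /(_ I) [] + xpos.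
by rewrite patchE mem_set// => /eq0_normc.
Qed.

End LpFunctions.

Section LpSpace.
Context {R : realType} {p : R} (p1 : 1 < p).
Local Notation mu := (@lebesgue_measure R).
Local Open Scope quotient_scope.

Let p0 : 0 < p. Proof. exact: lt_trans p1. Qed.

(* The proof argument p1 is only there so that the submodule structure below can
   be inferred. *)
Definition Lp_fun of 1 < p : {pred R -> R[i]} :=
  fun f => `[< cmeasurable f /\ (LpN p f < +oo)%E >].

Lemma Lp_funP f : (f \in Lp_fun p1) <-> cmeasurable f /\ (LpN p f < +oo)%E.
Proof. by rewrite unfold_in; split => [/asboolP|/asboolP]. Qed.

Lemma Lp_fun_submod_closed : submod_closed (Lp_fun p1).
Proof.
split.
  apply/Lp_funP; split; first exact: (cmeasurable_cst 0).
  rewrite (_ : LpN p 0 = 0%E)//; apply/LpN_eq0 => //.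
  exact: aeW.
move=> c f g /Lp_funP[mf ff] /Lp_funP[mg fg]; apply/Lp_funP; split.
  exact/cmeasurableD/mg/cmeasurableZ.
apply: le_lt_trans (LpND (ltW p1) (cmeasurableZ c mf) mg) _.
by rewrite lte_add_pinfty// LpNZ// lte_mul_pinfty// lee_fin; case: (c) => *; exact: sqrtr_ge0.
Qed.

HB.instance Definition _ :=
  GRing.isSubmodClosed.Build _ _ (Lp_fun p1) Lp_fun_submod_closed.

Record LpFun : Type := MkLpFun {
  LpFun_fun :> R -> R[i] ;
  LpFun_prop : LpFun_fun \in Lp_fun p1 }.

HB.instance Definition _ := [isSub for LpFun_fun].
HB.instance Definition _ := [Choice of LpFun by <:].
HB.instance Definition _ := [SubChoice_isSubLmodule of LpFun by <:].

Definition Lp_null : {pred LpFun} :=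
  fun f => `[< ae_eq mu Rpos (f : R -> R[i]) (fun=> 0) >].

Lemma Lp_nullP (f : LpFun) : (f \in Lp_null) <-> LpN p (f : R -> R[i]) = 0%E.
Proof.
have /Lp_funP[mf _] := LpFun_prop f.
by rewrite unfold_in LpN_eq0//; split => [/asboolP|/asboolP].
Qed.

Lemma LpN_fun_fin (f : LpFun) : LpN p f \is a fin_num.
Proof.
have /Lp_funP[_ ff] := LpFun_prop f.
by rewrite ge0_fin_numE// LpN_ge0.
Qed.

Lemma LpFun_meas (f : LpFun) : cmeasurable f.
Proof. by have /Lp_funP[] := LpFun_prop f. Qed.

Lemma LpN_scale c (f : LpFun) :
  LpN p (c *: f : LpFun)  = ((normc c)%:E * LpN p f)%E.
Proof. by rewrite -LpNZ//; exact: LpFun_meas. Qed.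

Lemma LpN_add (f g : LpFun) : (LpN p (f + g : LpFun)%R <= LpN p f + LpN p g)%E.
Proof. by apply: LpND; [exact: ltW|exact: LpFun_meas..]. Qed.

Lemma LpN_opp (f : LpFun) : LpN p (- f : LpFun) = LpN p f.
Proof. by rewrite -scaleN1r LpN_scale normcN normc1 mul1e. Qed.

Lemma Lp_null_zmod_closed : zmod_closed Lp_null.
Proof.
split; first by apply/asboolP; exact: aeW.
move=> f g /Lp_nullP f0 /Lp_nullP g0; apply/Lp_nullP/eqP.
rewrite eq_le LpN_ge0 andbT (le_trans (LpN_add _ _))//.
by rewrite LpN_opp f0 g0 adde0.
Qed.

HB.instance Definition _ :=
  GRing.isZmodClosed.Build _ Lp_null Lp_null_zmod_closed.

(* Complex Lp space over Rpos: p-integrable functions up to equality almost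
   everywhere on Rpos. *)
Definition Lp : Type := ring_quotient.Quotient.quot Lp_null.

HB.instance Definition _ := Choice.on Lp.
HB.instance Definition _ := GRing.Zmodule.on Lp.
HB.instance Definition _ := EqQuotient.on Lp.


Lemma Lp_piP (f g : LpFun) :
  \pi_Lp f = \pi_Lp g <-> LpN p (f - g : LpFun) = 0%E.
Proof.
by rewrite -Lp_nullP ring_quotient.Quotient.idealrBE; split=> /eqP.
Qed.

Lemma LpFun_ae (f g : LpFun) :
  ae_eq mu Rpos (f : R -> R[i]) (g : R -> R[i]) <-> LpN p (f - g : LpFun) = 0%E.
Proof.
rewrite -Lp_nullP unfold_in.
split => [h|/asboolP h]; first apply/asboolP.
- apply: (@filterS _ _ (ae_filter_ringOfSetsType mu)) h => x /[apply].
  by rewrite /= /GRing.add/= /GRing.opp/= => ->; exact: subrr.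
- apply: (@filterS _ _ (ae_filter_ringOfSetsType mu)) h => x /[apply].
  by move=> /eqP; rewrite subr_eq0 => /eqP.
Qed.

End LpSpace.

Section LpNormed.
Context {R : realType} {p : R} (p1 : 1 < p).
Local Notation mu := (@lebesgue_measure R).
Local Notation Lp := (Lp p1).
Local Notation LpFun := (LpFun p1).
Local Open Scope quotient_scope.

Let p0 : 0 < p. Proof. exact: lt_trans p1. Qed.

Lemma LpN_triangle (f g : LpFun) : (LpN p f <= LpN p g + LpN p (f - g : LpFun)%R)%E.
Proof. by have := LpN_add g (f - g); rewrite addrC subrK. Qed.

Lemma LpN_congr (f g : LpFun) : \pi_Lp f = \pi_Lp g -> LpN p f = LpN p g.
Proof.
move=> fg; apply/eqP; rewrite eq_le; apply/andP; split.
  by move: (LpN_triangle f g); rewrite (Lp_piP _ _).1// adde0.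
by move: (LpN_triangle g f); rewrite (Lp_piP _ _).1// adde0.
Qed.

Definition Lp_scale (c : R[i]) (x : Lp) : Lp := \pi_Lp (c *: repr x).

Lemma Lp_scale_pi c (f : LpFun) : Lp_scale c (\pi_Lp f) = \pi_Lp (c *: f).
Proof.
apply/Lp_piP; rewrite -scalerBr LpN_scale (_ : LpN _ _ = 0%E) ?mule0//.
by apply/Lp_piP; rewrite reprK.
Qed.

Lemma Lp_piD (f g : LpFun) : \pi_Lp f + \pi_Lp g = \pi_Lp (f + g).
Proof. exact: (esym (@ring_quotient.Quotient.pi_add _ _ f g)). Qed.

Lemma Lp_pi0 : \pi_Lp (0 : LpFun) = 0.
Proof. by apply: (addrI (\pi_Lp (0 : LpFun))); rewrite Lp_piD !addr0. Qed.

Lemma Lp_ind (P : Lp -> Prop) : (forall f : LpFun, P (\pi_Lp f)) -> forall x, P x.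
Proof. by move=> h x; rewrite -[x]reprK. Qed.

Let scaleA a b (v : Lp) : Lp_scale a (Lp_scale b v) = Lp_scale (a * b) v.
Proof. by elim/Lp_ind: v => f; rewrite !Lp_scale_pi scalerA. Qed.

Let scale1 : left_id 1 Lp_scale.
Proof. by elim/Lp_ind => f; rewrite Lp_scale_pi scale1r. Qed.

Let scaleDr : right_distributive Lp_scale +%R.
Proof.
move=> a; elim/Lp_ind => f; elim/Lp_ind => g.
by rewrite Lp_piD !Lp_scale_pi Lp_piD scalerDr.
Qed.

Let scaleDl v : {morph Lp_scale^~ v : a b / a + b}.
Proof.
by move=> a b; elim/Lp_ind: v => f; rewrite !Lp_scale_pi Lp_piD scalerDl.
Qed.

HB.instance Definition _ :=
  GRing.Zmodule_isLmodule.Build R[i] Lp scaleA scale1 scaleDr scaleDl.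

Lemma Lp_piZ c (f : LpFun) : c *: \pi_Lp f = \pi_Lp (c *: f).
Proof. exact: Lp_scale_pi. Qed.

Definition Lp_norm (x : Lp) : R := fine (LpN p (repr x)).

Lemma Lp_norm_pi (f : LpFun) : (Lp_norm (\pi_Lp f))%:E = LpN p f.
Proof.
rewrite /Lp_norm fineK ?LpN_fun_fin//.
by apply: LpN_congr; rewrite reprK.
Qed.

Lemma Lp_normZ c x : Lp_norm (c *: x) = normc c * Lp_norm x.
Proof.
elim/Lp_ind: x => f; apply: EFin_inj.
by rewrite Lp_piZ EFinM !Lp_norm_pi LpN_scale.
Qed.

Let normD x y : Lp_norm (x + y) <= Lp_norm x + Lp_norm y.
Proof.
elim/Lp_ind: x => f; elim/Lp_ind: y => g.
by rewrite -lee_fin EFinD Lp_piD !Lp_norm_pi LpN_add.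
Qed.

Let norm_eq0 x : Lp_norm x = 0 -> x = 0.
Proof.
elim/Lp_ind: x => f f0; move: (Lp_norm_pi f); rewrite f0 => {}f0.
by rewrite -Lp_pi0; apply/Lp_piP; rewrite subr0.
Qed.

Let normMn x n : Lp_norm (x *+ n) = Lp_norm x *+ n.
Proof.
by rewrite -(scaler_nat n x) Lp_normZ normcMn normc1 mulr_natl.
Qed.

Let normN x : Lp_norm (- x) = Lp_norm x.
Proof. by rewrite -scaleN1r Lp_normZ normcN normc1 mul1r. Qed.

HB.instance Definition _ :=
  Num.Zmodule_isNormed.Build R Lp normD norm_eq0 normMn normN.

Lemma Lp_normrZ c (x : Lp) : `|c *: x| = normc c * `|x|.
Proof. exact: Lp_normZ. Qed.

Lemma Lp_normE (f : LpFun) : `|\pi_Lp f|%:E = LpN p f.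
Proof. exact: Lp_norm_pi. Qed.

(* The class of [f], and [0] when [f] is not p-integrable. *)
Definition toLp (f : R -> R[i]) : Lp := \pi_Lp (insubd 0 f : LpFun).

Definition ofLp (x : Lp) : R -> R[i] := repr x : LpFun.

Lemma toLpK (x : Lp) : toLp (ofLp x) = x.
Proof. by rewrite /toLp /ofLp valKd reprK. Qed.

Lemma toLp_eq (f g : R -> R[i]) : f \in Lp_fun p1 -> g \in Lp_fun p1 ->
  toLp f = toLp g <-> ae_eq mu Rpos f g.
Proof.
move=> fL gL; rewrite /toLp.
have ef : insubd 0 f = MkLpFun fL by apply: val_inj; rewrite val_insubd fL.
have eg : insubd 0 g = MkLpFun gL by apply: val_inj; rewrite val_insubd gL.
by rewrite ef eg Lp_piP -LpFun_ae.
Qed.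

Lemma ofLpP x : ofLp x \in Lp_fun p1.
Proof. exact: LpFun_prop. Qed.

Lemma ofLpK (f : R -> R[i]) : f \in Lp_fun p1 -> ae_eq mu Rpos (ofLp (toLp f)) f.
Proof. by move=> fL; apply/toLp_eq; rewrite ?ofLpP// toLpK. Qed.

Lemma toLpD f g : f \in Lp_fun p1 -> g \in Lp_fun p1 ->
  toLp (f + g) = toLp f + toLp g.
Proof.
move=> fL gL; rewrite /toLp Lp_piD; congr (\pi_Lp _); apply: val_inj => /=.
by rewrite !val_insubd fL gL rpredD.
Qed.

Lemma toLpZ c f : f \in Lp_fun p1 -> toLp (c *: f) = c *: toLp f.
Proof.
move=> fL; rewrite /toLp Lp_piZ; congr (\pi_Lp _); apply: val_inj => /=.
by rewrite !val_insubd fL rpredZ.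
Qed.

Lemma toLp_norm f : f \in Lp_fun p1 -> `|toLp f|%:E = LpN p f.
Proof. by move=> fL; rewrite /toLp Lp_normE val_insubd fL. Qed.

Lemma Lp_neq0 : exists x : Lp, x != 0.
Proof.
pose f : R -> R[i] := fun x => (\1_`[1, 2] x)%:C.
have mf : cmeasurable f.
  split; last exact: measurable_cst.
  rewrite (_ : (fun _ => _) = \1_`[1, 2])//; apply: measurable_funTS.
have LpNf : LpN p f = 1%E.
  rewrite LpNE// (_ : (\int[_]_(_ in _) _ = 1)%E) ?poweR1r//.
  under eq_integral => x _.
    rewrite (_ : _ `^ _ = \1_`[1, 2] x); last first.
      rewrite /cabs /f /= expr0n /= addr0 sqrtr_sqr normr_nat indicE.
      by case: (_ \in _) => /=; rewrite ?powR1// powR0// gt_eqF.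
    over.
  rewrite integral_indic ?measurable_Rpos//; last exact: measurable_itv.
  rewrite setIidl.
    rewrite /= lebesgue_measure_itv/= lte_fin ltr1n.
    by rewrite -EFinD -[2]/(1 + 1) addrK.
  by move=> x; rewrite /Rpos /= !in_itv/= andbT => /andP[+ _]; exact: lt_le_trans.
have fL : f \in Lp_fun p1 by apply/Lp_funP; rewrite LpNf ltry.
exists (toLp f); apply/eqP => f0.
have := toLp_norm fL; rewrite f0 normr0 LpNf => -[] /esym/eqP.
by rewrite oner_eq0.
Qed.

End LpNormed.

Section BoundedOperators.
Context {R : realType} {p : R} (p1 : 1 < p).
Local Notation Lp := (Lp p1).

Definition bounded_linear_op : {pred Lp -> Lp} :=
  fun T => `[< linear T /\ exists M : R, forall x, `|T x| <= M * `|x| >].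

Lemma bounded_linear_opP (T : Lp -> Lp) : T \in bounded_linear_op <->
  linear T /\ exists M : R, forall x, `|T x| <= M * `|x|.
Proof. by rewrite unfold_in; split => [/asboolP|/asboolP]. Qed.

Lemma bounded_linear_op_zmod_closed : zmod_closed bounded_linear_op.
Proof.
split.
  apply/bounded_linear_opP; split; first by move=> c x y; rewrite -[RHS]/(c *: 0 + 0) scaler0 addr0.
  by exists 0 => x; rewrite -[X in `|X|]/(0 : Lp) normr0 mul0r.
move=> S T /bounded_linear_opP[lS [M SM]] /bounded_linear_opP[lT [N TN]].
apply/bounded_linear_opP; split.
  move=> c x y; rewrite -[LHS]/(S (c *: x + y) - T (c *: x + y)).
  by rewrite lS lT opprD addrACA -scalerBr.
exists (M + N) => x; rewrite -[X in `|X|]/(S x - T x) mulrDl (le_trans (ler_normB _ _))//.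
exact: lerD.
Qed.

HB.instance Definition _ :=
  GRing.isZmodClosed.Build _ bounded_linear_op bounded_linear_op_zmod_closed.

Record Bop : Type := MkBop {
  Bop_fun :> Lp -> Lp ;
  Bop_prop : Bop_fun \in bounded_linear_op }.

HB.instance Definition _ := [isSub for Bop_fun].
HB.instance Definition _ := [Choice of Bop by <:].
HB.instance Definition _ := [SubChoice_isSubZmodule of Bop by <:].

Lemma BopP (S T : Bop) : (forall x, S x = T x) -> S = T.
Proof. by move=> ST; apply: val_inj; apply/funext. Qed.

Lemma Bop_linear (T : Bop) : linear T.
Proof. by have /bounded_linear_opP[] := Bop_prop T. Qed.

Lemma Bop_bounded (T : Bop) : exists M : R, forall x, `|T x| <= M * `|x|.
Proof. by have /bounded_linear_opP[] := Bop_prop T. Qed.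

Lemma BopDE (S T : Bop) x : (S + T) x = S x + T x. Proof. by []. Qed.
Lemma BopNE (T : Bop) x : (- T) x = - T x. Proof. by []. Qed.
Lemma Bop0E x : (0 : Bop) x = 0. Proof. by []. Qed.

Lemma Bop_mapD (T : Bop) x y : T (x + y) = T x + T y.
Proof. by have := Bop_linear T 1 x y; rewrite !scale1r. Qed.

Lemma Bop_map0 (T : Bop) : T 0 = 0.
Proof. by apply: (addrI (T 0)); rewrite -Bop_mapD !addr0. Qed.

Lemma Bop_mapZ (T : Bop) c x : T (c *: x) = c *: T x.
Proof. by have := Bop_linear T c x 0; rewrite Bop_map0 !addr0. Qed.

Lemma Bop_id_subproof : (@id Lp) \in bounded_linear_op.
Proof.
by apply/bounded_linear_opP; split => //; exists 1 => x; rewrite mul1r.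
Qed.

Definition Bop_id : Bop := MkBop Bop_id_subproof.

Lemma Bop_comp_subproof (S T : Bop) : S \o T \in bounded_linear_op.
Proof.
apply/bounded_linear_opP; split.
  by move=> c x y; rewrite /= (Bop_linear T) (Bop_linear S).
have [M SM] := Bop_bounded S; have [N TN] := Bop_bounded T.
exists (`|M| * N) => x /=; rewrite (le_trans (SM _))//.
rewrite (@le_trans _ _ (`|M| * `|T x|))//.
  by rewrite ler_wpM2r// ler_norm.
by rewrite -mulrA ler_wpM2l.
Qed.

Definition Bop_comp (S T : Bop) : Bop := MkBop (Bop_comp_subproof S T).

Let compA : associative Bop_comp. Proof. by move=> S T U; apply: BopP. Qed.
Let comp1l : left_id Bop_id Bop_comp. Proof. by move=> T; apply: BopP. Qed.
Let comp1r : right_id Bop_id Bop_comp. Proof. by move=> T; apply: BopP. Qed.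
Let compDl : left_distributive Bop_comp +%R.
Proof. by move=> S T U; apply: BopP. Qed.
Let compDr : right_distributive Bop_comp +%R.
Proof. by move=> S T U; apply: BopP => x; exact: (Bop_mapD S). Qed.
Let id_neq0 : Bop_id != 0.
Proof.
have [x x0] := Lp_neq0 p1; apply: contra x0 => /eqP id0.
by rewrite -[x]/(Bop_id x) id0.
Qed.

HB.instance Definition _ := GRing.Zmodule_isNzRing.Build Bop
  compA comp1l comp1r compDl compDr id_neq0.

Lemma BopME (S T : Bop) x : (S * T) x = S (T x). Proof. by []. Qed.
Lemma Bop1E x : (1 : Bop) x = x. Proof. by []. Qed.

(* Invertible in the algebra of bounded operators. *)
Definition Bop_unit : {pred Bop} :=
  fun T => `[< exists S : Bop, S * T = 1 /\ T * S = 1 >].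

Definition Bop_inv (T : Bop) : Bop :=
  xget T [set S : Bop | S * T = 1 /\ T * S = 1].

Lemma Bop_invP T : T \in Bop_unit -> Bop_inv T * T = 1 /\ T * Bop_inv T = 1.
Proof.
rewrite unfold_in => /asboolP uT.
exact: (xgetPex T uT).
Qed.

Let mulVB : {in Bop_unit, left_inverse 1 Bop_inv *%R}.
Proof. by move=> T /Bop_invP[]. Qed.
Let mulBV : {in Bop_unit, right_inverse 1 Bop_inv *%R}.
Proof. by move=> T /Bop_invP[]. Qed.
Let unitB S T : T * S = 1 /\ S * T = 1 -> S \in Bop_unit.
Proof. by move=> ST; rewrite unfold_in; apply/asboolP; exists T. Qed.
Let inv_out : {in [predC Bop_unit], Bop_inv =1 id}.
Proof.
move=> T; rewrite inE unfold_in => /asboolPn nT.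
by rewrite /Bop_inv xgetPN// => S ST; apply: nT; exists S.
Qed.

HB.instance Definition _ := GRing.NzRing_hasMulInverse.Build Bop
  mulVB mulBV unitB inv_out.

Lemma Bop_unitP (T : Bop) :
  (T \is a GRing.unit) <-> exists S : Bop, S * T = 1 /\ T * S = 1.
Proof. by split => [/asboolP|/asboolP]. Qed.

Definition opnorm (T : Bop) : R := sup [set `|T x| | x in [set x | `|x| <= 1]].

Lemma opnorm_ub (T : Bop) M : (forall x, `|T x| <= M * `|x|) ->
  forall x, `|x| <= 1 -> `|T x| <= `|M|.
Proof.
move=> TM x x1; rewrite (le_trans (TM x))//.
rewrite (@le_trans _ _ (`|M| * `|x|))//; first by rewrite ler_wpM2r// ler_norm.
by rewrite -[leRHS]mulr1 ler_wpM2l.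
Qed.

Lemma opnorm_has_sup (T : Bop) : has_sup [set `|T x| | x in [set x | `|x| <= 1]].
Proof.
split; first by exists `|T 0|, 0 => //=; rewrite normr0.
have [M TM] := Bop_bounded T; exists `|M| => _ [x x1 <-].
exact: opnorm_ub TM _ x1.
Qed.

Lemma opnorm_le1 (T : Bop) x : `|x| <= 1 -> `|T x| <= opnorm T.
Proof.
by move=> x1; apply: ub_le_sup; [exact: (opnorm_has_sup T).2|exists x].
Qed.

Lemma opnorm_ge0 (T : Bop) : 0 <= opnorm T.
Proof. by apply: le_trans (@opnorm_le1 T 0 _) => //; rewrite normr0. Qed.

Lemma opnormP (T : Bop) x : `|T x| <= opnorm T * `|x|.
Proof.
have [->|x0] := eqVneq x 0; first by rewrite Bop_map0 !normr0 mulr0.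
have nx : 0 < `|x| by rewrite normr_gt0.
have nc : normc ((`|x|^-1)%:C) = `|x|^-1.
  by rewrite /= expr0n /= addr0 sqrtr_sqr ger0_norm// invr_ge0.
have := @opnorm_le1 T ((`|x|^-1)%:C *: x).
rewrite Bop_mapZ !Lp_normrZ nc mulVf ?gt_eqF// => /(_ (lexx _)).
by rewrite mulrC ler_pdivrMr.
Qed.

Lemma opnorm_le (T : Bop) M : 0 <= M -> (forall x, `|T x| <= M * `|x|) ->
  opnorm T <= M.
Proof.
move=> M0 TM; apply: ge_sup; first exact: (opnorm_has_sup T).1.
by move=> _ [x /= x1 <-]; rewrite -(ger0_norm M0); exact: opnorm_ub TM _ x1.
Qed.

Let normD S T : opnorm (S + T) <= opnorm S + opnorm T.
Proof.
apply: opnorm_le; first by rewrite addr_ge0// opnorm_ge0.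
move=> x; rewrite BopDE mulrDl (le_trans (ler_normD _ _))//.
by apply: lerD; exact: opnormP.
Qed.

Let norm_eq0 T : opnorm T = 0 -> T = 0.
Proof.
move=> T0; apply: BopP => x; apply/eqP; rewrite -normr_le0.
by rewrite (le_trans (opnormP T x))// T0 mul0r.
Qed.

Let normN T : opnorm (- T) = opnorm T.
Proof.
rewrite /opnorm; congr sup; apply/seteqP.
by split=> _ [x x1 <-]; exists x => //; rewrite BopNE normrN.
Qed.

Let normMn T n : opnorm (T *+ n) = opnorm T *+ n.
Proof.
have TnE x : (T *+ n) x = T x *+ n.
  by elim: n => [|n IHn]; rewrite ?mulr0n// !mulrS BopDE IHn.
apply/eqP; rewrite eq_le; apply/andP; split.
  apply: opnorm_le; first by rewrite mulrn_wge0// opnorm_ge0.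
  by move=> x; rewrite TnE normrMn mulrnAl lerMn2r opnormP orbT.
case: n TnE => [|n] TnE; first by rewrite mulr0n opnorm_ge0.
rewrite -mulr_natl -ler_pdivlMl ?ltr0Sn//.
apply: opnorm_le; first by rewrite mulr_ge0 ?invr_ge0// opnorm_ge0.
move=> x; rewrite -mulrA ler_pdivlMl ?ltr0Sn// mulr_natl -normrMn -TnE.
exact: opnormP.
Qed.

HB.instance Definition _ :=
  Num.Zmodule_isNormed.Build R Bop normD norm_eq0 normMn normN.

Lemma Bop_normE (T : Bop) : `|T| = opnorm T. Proof. by []. Qed.

(* The operator with underlying map [T], and [0] when [T] is not a bounded
   linear map. *)
Definition toBop (T : Lp -> Lp) : Bop := insubd 0 T.

Definition left_invertible (T : Bop) := exists S : Bop, S * T = 1.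
Definition right_invertible (T : Bop) := exists S : Bop, T * S = 1.

(* Unconditional convergence in operator norm, along the directed set of finite
   subsets of int. *)
Definition is_opsum (T : int -> Bop) (S : Bop) :=
  `|S - \sum_(k <- J) T k| @[J --> @summability.totally int] --> (0 : R).

End BoundedOperators.

Arguments bounded_linear_op {R p} p1 _.

Section OpsumTheory.
Context {R : realType} {p : R} {p1 : 1 < p}.

Lemma is_opsum_unique (T : int -> Bop p1) S S' :
  is_opsum T S -> is_opsum T S' -> S = S'.
Proof.
move=> TS TS'; apply/eqP; rewrite -subr_eq0 -normr_le0.
pose FF := @summability.totally_filter int.
have h : (fun J : {fset int} => `|S - \sum_(k <- J) T k| + `|S' - \sum_(k <- J) T k|)
    @ @summability.totally int --> (0 : R).
  rewrite -[X in _ --> X]addr0.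
  exact: (@cvgD _ R _ _ _ _ _ 0 0 TS TS').
have <- := cvg_lim (@Rhausdorff R) h.
apply: limr_ge; first exact: cvgP h.
apply: nearW => J.
rewrite (_ : S - S' = (S - \sum_(k <- J) T k) - (S' - \sum_(k <- J) T k)).
  exact: ler_normB.
by rewrite opprB addrA subrK.
Qed.

End OpsumTheory.

Section SlowOscillation.
Context {R : realType}.
Implicit Types f : R -> R[i].

(* Scalar functions on Rpos are represented by functions on R; their values
   outside of Rpos are never used. *)
Definition continuous_bounded f :=
  [/\ {within Rpos, continuous (fun t => complex.Re (f t))},
      {within Rpos, continuous (fun t => complex.Im (f t))} &
      exists M : R, forall t, Rpos t -> normc (f t) <= M].

Definition cb_norm f : R := sup [set normc (f t) | t in Rpos].

Definition oscillation f (r : R) : R :=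
  sup [set normc (f t - f u) | t in `[r, 2 * r] & u in `[r, 2 * r]].

Definition SO f :=
  [/\ continuous_bounded f,
      oscillation f r @[r --> 0^'+] --> (0 : R) &
      oscillation f r @[r --> +oo] --> (0 : R)].

End SlowOscillation.

Section SlowlyOscillatingShifts.
Context {R : realType}.
Implicit Types (alpha : \bar R -> \bar R) (g : R -> R).

Definition Rpos_closure : set (\bar R) := `[0%E, +oo%E].

(* The inverse function of alpha on [0, +oo]. *)
Definition shift_inv alpha : \bar R -> \bar R :=
  'pinv_(fun=> 0%E) Rpos_closure alpha.

(* The restriction of alpha to Rpos, as a real function. *)
Definition fin_shift alpha : R -> R := fun t => fine (alpha t%:E).

(* Diffeomorphisms are of class C1. *)
Definition C1_Rpos g :=
  (forall t, Rpos t -> derivable g t 1) /\ {within Rpos, continuous (derive1 g)}.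

Definition orientation_preserving_homeo alpha :=
  [/\ set_bij Rpos_closure Rpos_closure alpha,
      {within Rpos_closure, continuous alpha},
      {within Rpos_closure, continuous (shift_inv alpha)} &
      {in `[0%E, +oo%E] &, {homo alpha : x y / (x < y)%E}}].

Definition diffeo_Rpos alpha :=
  [/\ set_bij Rpos Rpos (fin_shift alpha),
      C1_Rpos (fin_shift alpha) & C1_Rpos (fin_shift (shift_inv alpha))].

Definition SOS alpha :=
  [/\ orientation_preserving_homeo alpha,
      forall x, Rpos_closure x -> (alpha x = x <-> x = 0%E \/ x = +oo%E),
      diffeo_Rpos alpha,
      exists M : R, forall t, Rpos t -> `|ln (derive1 (fin_shift alpha) t)| <= M &
      SO (fun t => (derive1 (fin_shift alpha) t)%:C)].

Definition shift_iter alpha (k : int) : \bar R -> \bar R :=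
  match k with
  | Posz n => iter n alpha
  | Negz n => iter n.+1 (shift_inv alpha)
  end.

End SlowlyOscillatingShifts.

(* toLp and toBop only serve to make the next two definitions total: under the
   hypotheses in use (a continuous and bounded on Rpos, alpha in SOS) both maps
   are well defined on classes and bounded, see mul_opE below for the first;
   shift_op alpha is then an isometric isomorphism of Lp, by the change of
   variables u = alpha t. *)
Section FunctionalOperators.
Context {R : realType} {p : R} (p1 : 1 < p).

Definition mul_op (a : R -> R[i]) : Bop p1 :=
  toBop (fun x => toLp p1 (fun t => a t * ofLp x t)).

Definition shift_op (alpha : \bar R -> \bar R) : Bop p1 :=
  toBop (fun x => toLp p1 (fun t =>
    ((derive1 (fin_shift alpha) t) `^ p^-1)%:C * ofLp x (fin_shift alpha t))).

(* shift_op alpha ^ k for k : int is the integer power of a unit of the ring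
   Bop p1: a power of the inverse operator when k is negative. *)
Definition W_series (alpha : \bar R -> \bar R) (a : int -> R -> R[i])
    (A : Bop p1) :=
  [/\ forall k, SO (a k),
      summable [set: int] (fun k => (cb_norm (a k))%:E) &
      is_opsum (fun k => mul_op (a k) * shift_op alpha ^ k) A].

Definition W_SO (alpha : \bar R -> \bar R) : set (Bop p1) :=
  [set A | exists a, W_series alpha a A].

End FunctionalOperators.

Section FunctionalOperatorsTheory.
Context {R : realType} {p : R} (p1 : 1 < p).
Local Notation mu := (@lebesgue_measure R).

Let p0 : 0 < p. Proof. exact: lt_trans p1. Qed.

Lemma cmeasurable_continuous (a : R -> R[i]) :
  continuous_bounded a -> cmeasurable a.
Proof.
by move=> [ra ia _]; split; (apply: subspace_continuous_measurable_fun;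
  [exact: measurable_Rpos|]).
Qed.

Lemma toBopE (T : Lp p1 -> Lp p1) :
  T \in bounded_linear_op p1 -> toBop T =1 T.
Proof. by move=> bT x; rewrite /toBop val_insubd bT. Qed.

Lemma ae_eq_toLp (f g : R -> R[i]) : f \in Lp_fun p1 -> g \in Lp_fun p1 ->
  ae_eq mu Rpos f g -> toLp p1 f = toLp p1 g.
Proof. by move=> fL gL /toLp_eq; apply. Qed.

Lemma mul_Lp_fun (a f : R -> R[i]) (M : R) : cmeasurable a ->
  (forall t, Rpos t -> normc (a t) <= M) -> f \in Lp_fun p1 ->
  (fun t => a t * f t) \in Lp_fun p1 /\
  (LpN p (fun t => a t * f t)%R <= `|M|%:E * LpN p f)%E.
Proof.
move=> ma aM /Lp_funP[mf ff].
have le : (LpN p (fun t => a t * f t)%R <= `|M|%:E * LpN p f)%E.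
  have nM : normc (`|M|%:C) = `|M|.
    by rewrite /= expr0n /= addr0 sqrtr_sqr normr_id.
  rewrite -[X in (_ <= X%:E * _)%E]nM -LpNZ//; apply: le_LpN => //.
  - exact: cmeasurableM.
  - exact: cmeasurableZ.
  - move=> t t0; rewrite /cabs !normcM nM ler_wpM2r//; first exact: cabs_ge0.
    by rewrite (le_trans (aM _ t0))// ler_norm.
split=> //; apply/Lp_funP; split; first exact: cmeasurableM.
by rewrite (le_lt_trans le)// lte_mul_pinfty// lee_fin.
Qed.

Lemma mul_op_subproof (a : R -> R[i]) : continuous_bounded a ->
  (fun x => toLp p1 (fun t => a t * ofLp x t)) \in bounded_linear_op p1.
Proof.
move=> cba; have ma := cmeasurable_continuous cba.
have [_ _ [M aM]] := cba.
have aL (f : R -> R[i]) (fL : f \in Lp_fun p1) := (mul_Lp_fun ma aM fL).1.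
apply/bounded_linear_opP; split.
  move=> c x y; rewrite -toLpZ ?aL ?ofLpP// -toLpD ?aL ?ofLpP//; last first.
    by rewrite rpredZ// aL// ofLpP.
  apply: ae_eq_toLp.
  - by rewrite aL// ofLpP.
  - by rewrite rpredD// ?rpredZ// aL// ofLpP.
  have : ae_eq mu Rpos (ofLp (c *: x + y)) (c *: ofLp x + ofLp y).
    have sL : c *: ofLp x + ofLp y \in Lp_fun p1 by rewrite rpredD ?rpredZ ?ofLpP.
    apply: (toLp_eq (ofLpP _) sL).1.
    by rewrite toLpD ?toLpZ ?rpredZ ?ofLpP// !toLpK.
  apply: (@filterS _ _ (ae_filter_ringOfSetsType mu)) => t /[apply] ->.
  by rewrite !fctE mulrDr; congr (_ + _); exact: mulrCA.
exists `|M| => x; rewrite -lee_fin EFinM toLp_norm ?aL ?ofLpP//.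
rewrite -[X in (_ <= _ * `|X|%:E)%E]toLpK toLp_norm ?ofLpP//.
exact: (mul_Lp_fun ma aM (ofLpP x)).2.
Qed.

Lemma mul_opE (a : R -> R[i]) (x : Lp p1) : continuous_bounded a ->
  mul_op p1 a x = toLp p1 (fun t => a t * ofLp x t).
Proof. by move=> /mul_op_subproof /toBopE. Qed.

End FunctionalOperatorsTheory.

(* Main.v *)
Require Import Defs.
From HB Require Import structures.
From mathcomp Require Import all_boot all_order all_algebra.
From mathcomp Require Import complex finmap.
From mathcomp Require Import all_classical all_reals all_analysis.
From mathcomp Require Import measurable_realfun.
From mathcomp Require summability.
From mathcomp Require Import lra ring zify.
Set Implicit Arguments.
Unset Strict Implicit.
Unset Printing Implicit Defensive.
Import Order.TTheory GRing.Theory Num.Theory.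
Import numFieldNormedType.Exports.
Import Normc.
Local Open Scope classical_set_scope.
Local Open Scope ring_scope.
Local Open Scope complex_scope.

(** Let U be the shift operator, al_k the iterates of the shift and
    A = sum_k a_k U^k. The substance of the theorem is that inverses stay in the
    algebra of absolutely summable coefficients. The operator that is inverted
    is the Gram operator A^diamond A (for right inverses, A A^diamond), and all
    estimates are made along the orbits of the shift.

    From operators to orbits. On the values of a function along the orbit of a
    point t, the operator A acts by the doubly infinite matrix with entries
    a_k (al_m t) in row m and column m + k, called its fiber. If A is bounded
    below on L^p, then so are its fibers on l^p, uniformly in t: it suffices to
    test A on combinations of the images under U of a function concentrated near
    t, which have disjoint supports because the orbit of t consists of distinct
    points (fiber_below). If A is right invertible, pairing the coefficients of
    A B = 1 with a sequence gives lower bounds for the adjoint matrices on l^q,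
    where q is the conjugate exponent of p (fiber_adjoint_below).

    Change of the exponent. For matrices with absolutely summable diagonals, a
    lower bound on l^q implies one on l^r for every r (shift_sum_stability):
    after a localization by slowly varying cutoffs, the commutators with the
    cutoffs are small, so that the norms over windows of a sequence satisfy a
    recursion that can be solved in every l^r. One application replaces p by 2,
    where a lower bound for a matrix T is one for T^* T, and also for s + T^* T
    with s >= 0, with a constant independent of s. A second application, with
    r = 1 and all the orbits treated at once, returns from the fibers to the
    algebra: the norm of a coefficient family b is at most a constant times the
    norm of s b + (A^diamond A) b (gram_conv_below).

    Inversion. For large s the operator b |-> s b + (A^diamond A) b has dense
    range. By the uniform lower bounds the range stays dense while s decreases to
    0 (dense_range0), and completeness of the algebra yields a solution of
    (A^diamond A) b = 1. As A^diamond A equals its formal adjoint, b^diamond is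
    an inverse on the other side (gram_inverse). Throughout, A is replaced by its
    truncations to finitely many k, with constants independent of the
    truncation.

    This rests on the completeness of L^p and of its algebra of operators, on a
    change of variables that makes U isometric, and on the stability of slow
    oscillation under algebraic operations, uniform limits and composition with
    the al_k. *)

(** * Sequence spaces over the integers *)

Definition lqnorm {R : realType} (q : R) (x : int -> R) : \bar R :=
  ((\esum_(i in [set: int]) (`|x i| `^ q)%:E) `^ q^-1)%E.

Section LqNorm.
Context {R : realType}.
Implicit Types (q c : R) (x y : int -> R).

Definition nat_to_int (n : nat) : int := if odd n then Negz n./2 else Posz n./2.

Lemma nat_to_int_bij : set_bij [set: nat] [set: int] nat_to_int.
Proof.
split => //.
  move=> m n _ _; rewrite /nat_to_int => mn.
  rewrite -(odd_double_half m) -(odd_double_half n).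
  by move: mn; case: (odd m); case: (odd n) => // -[->].
move=> k _; case: k => n.
  by exists n.*2 => //; rewrite /nat_to_int odd_double doubleK.
by exists n.*2.+1 => //; rewrite /nat_to_int /= odd_double /= uphalf_double.
Qed.

(** Minkowski's inequality is available for measures; the counting measure of nat
    is reached by enumerating int. *)
Lemma lqnormE q x : 0 < q ->
  lqnorm q x = ('N[@counting nat R]_q%:E [EFin \o (x \o nat_to_int)])%E.
Proof.
move=> q0; rewrite /lqnorm Lnorm_counting//.
rewrite nneseries_esumT; last by move=> n; exact: poweR_ge0.
by rewrite (reindex_esum _ _ _ _ nat_to_int_bij).
Qed.

Lemma lqnorm_ge0 q x : (0 <= lqnorm q x)%E.
Proof. exact: poweR_ge0. Qed.

Lemma lqnormD q x y : 1 <= q ->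
  (lqnorm q (fun i => x i + y i)%R <= lqnorm q x + lqnorm q y)%E.
Proof.
move=> q1; have q0 : 0 < q by exact: lt_le_trans q1.
by rewrite !lqnormE//; apply: (minkowski_EFin (@counting nat R)).
Qed.

Lemma esum_powR_ge0 q x : (0 <= \esum_(i in [set: int]) (`|x i| `^ q)%:E)%E.
Proof. by apply: esum_ge0 => i _; rewrite lee_fin powR_ge0. Qed.

Lemma le_lqnorm q x y : 0 < q -> (forall i, `|x i| <= `|y i|) ->
  (lqnorm q x <= lqnorm q y)%E.
Proof.
move=> q0 xy; apply: gt0_ler_poweR.
- by rewrite invr_ge0 ltW.
- by rewrite in_itv/= esum_powR_ge0 leey.
- by rewrite in_itv/= esum_powR_ge0 leey.
- by apply: le_esum => i _; rewrite lee_fin ge0_ler_powR ?nnegrE ?(ltW q0).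
Qed.

Lemma eq_lqnorm q x y : (forall i, `|x i| = `|y i|) -> lqnorm q x = lqnorm q y.
Proof. by move=> xy; congr (_ `^ _)%E; apply: eq_esum => i _; rewrite xy. Qed.

Lemma lqnorm0 q : 0 < q -> lqnorm q (fun=> 0) = 0%E.
Proof.
move=> q0; rewrite /lqnorm esum1 ?poweR0r ?invr_neq0 ?gt_eqF// => i _.
by rewrite normr0 powR0// gt_eqF.
Qed.

Lemma ge0_esumZl (c : R) (f : int -> R) : 0 <= c -> (forall i, 0 <= f i) ->
  (\esum_(i in [set: int]) (c * f i)%:E = c%:E * \esum_(i in [set: int]) (f i)%:E)%E.
Proof.
move=> c0 f0; rewrite !(reindex_esum _ _ _ _ nat_to_int_bij).
rewrite -!nneseries_esumT; last 2 first.
- by move=> n; rewrite lee_fin.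
- by move=> n; rewrite lee_fin mulr_ge0.
rewrite -nneseriesZl//; last by move=> n _; rewrite lee_fin.
Qed.

Lemma lqnormZ q c x : 0 < q -> lqnorm q (fun i => c * x i) = (`|c|%:E * lqnorm q x)%E.
Proof.
move=> q0; rewrite /lqnorm.
under eq_esum do rewrite normrM powRM//.
rewrite ge0_esumZl ?powR_ge0//.
rewrite poweRM ?esum_powR_ge0 ?lee_fin ?powR_ge0//.
by rewrite poweR_EFin -powRrM mulfV ?gt_eqF// powRr1.
Qed.

Lemma lqnorm_shift q x (a : int) : lqnorm q (fun i => x (i + a)) = lqnorm q x.
Proof.
congr (_ `^ _)%E; symmetry.
apply: (reindex_esum [set: int] [set: int] (fun i => i + a) (fun i => (`|x i| `^ q)%:E)).
split => //; first by move=> i j _ _ /addIr.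
by move=> i _; exists (i - a) => //; rewrite subrK.
Qed.

Lemma lqnorm_sum q (I : Type) (r : seq I) (x : I -> int -> R) : 1 <= q ->
  (lqnorm q (fun i => \sum_(k <- r) x k i)%R <= \sum_(k <- r) lqnorm q (x k))%E.
Proof.
move=> q1; have q0 : 0 < q by exact: lt_le_trans q1.
elim: r => [|k r IHr].
  by rewrite big_nil (@eq_lqnorm _ _ (fun=> 0)) ?lqnorm0// => i; rewrite big_nil.
rewrite big_cons (@eq_lqnorm _ _ (fun i => x k i + \sum_(k <- r) x k i)); last first.
  by move=> i; rewrite big_cons.
by apply: (le_trans (lqnormD _ _ q1)); exact: leeD2l.
Qed.

Lemma le_lqnorm_coord q x i : 0 < q -> (`|x i|%:E <= lqnorm q x)%E.
Proof.
move=> q0; rewrite -[X in (X%:E <= _)%E](powRr1 (normr_ge0 _)).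
rewrite -[X in _ `^ X](divff (lt0r_neq0 q0)) powRrM -poweR_EFin.
apply: gt0_ler_poweR.
- by rewrite invr_ge0 ltW.
- by rewrite in_itv/= lee_fin powR_ge0 leey.
- by rewrite in_itv/= esum_powR_ge0 leey.
apply: esum_ge; exists [set i]; last by rewrite fsbig_set1.
by split => //; exact: finite_set1.
Qed.

Lemma lqnorm_delta q i c : 0 < q ->
  lqnorm q (fun n => if n == i then c else 0) = `|c|%:E.
Proof.
move=> q0; rewrite /lqnorm (esumID [set i]); last first.
  by move=> ? _; rewrite lee_fin powR_ge0.
rewrite setTI esum_set1; last by rewrite lee_fin powR_ge0.
rewrite eqxx esum1 ?adde0.
  by rewrite poweR_EFin -powRrM mulfV ?gt_eqF// powRr1.
by move=> j [_ /= /eqP/negbTE ->]; rewrite normr0 powR0 ?gt_eqF.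
Qed.

(** By Minkowski's inequality, as a finitely supported sequence is a sum of
    multiples of coordinate vectors. *)
Lemma lqnorm_le_l1 q x (J : seq int) : 1 <= q -> uniq J ->
  (forall i, i \notin J -> x i = 0) ->
  (lqnorm q x <= (\sum_(i <- J) `|x i|)%:E)%E.
Proof.
move=> q1 uJ xJ; have q0 : 0 < q by exact: lt_le_trans q1.
rewrite (@eq_lqnorm _ _ (fun n => \sum_(i <- J) (if n == i then x i else 0))); last first.
  move=> n; congr `|_|; have [nJ|nJ] := boolP (n \in J).
    rewrite (big_rem n nJ)/= eqxx big1_seq ?addr0// => i /=.
    rewrite mem_rem_uniq// inE => /andP[/negbTE ni _].
    by rewrite eq_sym ni.
  by rewrite xJ// big1_seq// => i iJ; case: eqP => // ni; rewrite -ni (negbTE nJ) in iJ.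
apply: (le_trans (lqnorm_sum _ _ q1)).
by rewrite -sumEFin; apply: lee_sum => i _; rewrite lqnorm_delta.
Qed.

Lemma lqnorm1 x : lqnorm 1 x = (\esum_(i in [set: int]) `|x i|%:E)%E.
Proof.
rewrite /lqnorm invr1 poweRe1; last exact: esum_powR_ge0.
by apply: eq_esum => i _; rewrite powRr1.
Qed.

End LqNorm.

HB.lock Definition lnorm {R : realType} (q : R) (J : seq int) (u : int -> R) : R :=
  (\sum_(k <- J) `|u k| `^ q) `^ q^-1.

Section FiniteLq.
Context {R : realType}.
Implicit Types (q : R) (J : seq int) (u v : int -> R).

Lemma lnorm_ge0 q J u : 0 <= lnorm q J u.
Proof. by rewrite lnorm.unlock; exact: powR_ge0. Qed.

Lemma eq_lnorm q J u v : (forall k, k \in J -> `|u k| = `|v k|) ->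
  lnorm q J u = lnorm q J v.
Proof.
by move=> uv; rewrite lnorm.unlock; congr (_ `^ _); apply: eq_big_seq => k /uv ->.
Qed.

Lemma lqnorm_lnorm q J u : 0 < q -> uniq J -> (forall k, k \notin J -> u k = 0) ->
  lqnorm q u = (lnorm q J u)%:E.
Proof.
move=> q0 uJ uJ0; rewrite /lqnorm lnorm.unlock -poweR_EFin; congr (_ `^ _)%E.
transitivity (\esum_(i in [set` [fset k | k in J]%fset]) (`|u i| `^ q)%:E)%E.
  rewrite [RHS]esum_mkcond; apply: eq_esum => k _; case: ifPn => //.
  by rewrite mem_setE inE => kJ; rewrite uJ0// normr0 powR0// gt_eqF.
rewrite esum_fset// fsbig_finite//= set_fsetK sumEFin; congr EFin.
rewrite (perm_big J)//=.
by apply: uniq_perm; [exact: fset_uniq|by []|move=> k; rewrite !inE].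
Qed.

Lemma le_lnorm_lqnorm q J u : 0 < q -> uniq J -> ((lnorm q J u)%:E <= lqnorm q u)%E.
Proof.
move=> q0 uJ; pose u' k := if k \in J then u k else 0.
have -> : lnorm q J u = lnorm q J u'.
  by apply: eq_lnorm => k kJ; rewrite /u' kJ.
rewrite -(lqnorm_lnorm q0 uJ); last by move=> k kJ; rewrite /u' (negbTE kJ).
by apply: le_lqnorm => // k; rewrite /u'; case: ifP => // _; rewrite normr0.
Qed.

Lemma lnorm_restr q J u : 0 < q -> uniq J ->
  (lnorm q J u)%:E = lqnorm q (fun k => if k \in J then u k else 0).
Proof.
move=> q0 uJ; rewrite [RHS](lqnorm_lnorm q0 uJ); last by move=> k /negbTE ->.
by congr EFin; apply: eq_lnorm => k ->.
Qed.

Lemma le_lnorm q J u v : 0 < q -> uniq J -> (forall k, k \in J -> `|u k| <= `|v k|) ->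
  lnorm q J u <= lnorm q J v.
Proof.
move=> q0 uJ uv; have e := lnorm_restr _ q0 uJ; rewrite -lee_fin (e u) (e v); apply: (le_lqnorm q0) => k.
by case: ifP => [kJ|_]; [exact: uv|exact: lexx].
Qed.

Lemma lnormD q J u v : 1 <= q -> uniq J ->
  lnorm q J (fun k => u k + v k) <= lnorm q J u + lnorm q J v.
Proof.
move=> q1 uJ; have q0 : 0 < q := lt_le_trans ltr01 q1.
have e := lnorm_restr _ q0 uJ; rewrite -lee_fin EFinD 3!e; apply: le_trans (lqnormD _ _ q1).
by apply: (le_lqnorm q0) => k; case: ifP => _; rewrite ?addr0 lexx.
Qed.

Lemma lnorm_le_l1 q J u : 1 <= q -> uniq J -> lnorm q J u <= \sum_(k <- J) `|u k|.
Proof.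
move=> q1 uJ; have e := lnorm_restr u (lt_le_trans ltr01 q1) uJ; rewrite -lee_fin e.
apply: le_trans (lqnorm_le_l1 q1 uJ _) _; first by move=> k /negbTE ->.
by rewrite lee_fin le_eqVlt; apply/orP; left; apply/eqP/eq_big_seq => k ->.
Qed.

Lemma lnorm_powR q J u : 0 < q -> lnorm q J u `^ q = \sum_(k <- J) `|u k| `^ q.
Proof.
move=> q0; rewrite lnorm.unlock -powRrM mulVf ?gt_eqF// powRr1//.
by apply: sumr_ge0 => k _; exact: powR_ge0.
Qed.

Lemma lnorm2E J u : lnorm 2 J u = Num.sqrt (\sum_(k <- J) u k ^+ 2).
Proof.
rewrite lnorm.unlock -powR12_sqrt; last by apply: sumr_ge0 => k _; rewrite sqr_ge0.
congr (_ `^ _); apply: eq_bigr => k _.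
by rewrite -[2]/(2%:R) powR_mulrn// real_normK ?num_real.
Qed.

(** By Young's inequality for the sequences divided by their norms. *)
Lemma lnorm_hoelder (p q : R) J u v : 0 < p -> 0 < q -> p^-1 + q^-1 = 1 ->
  \sum_(k <- J) `|u k| * `|v k| <= lnorm p J u * lnorm q J v.
Proof.
move=> p0 q0 pq; set A := lnorm p J u; set B := lnorm q J v.
have lnorm0 (r : R) (w : int -> R) : 0 < r -> lnorm r J w = 0 -> forall k, k \in J -> w k = 0.
  move=> r0; rewrite lnorm.unlock => /powR_eq0_eq0/eqP; rewrite psumr_eq0; last by move=> k _; exact: powR_ge0.
  move=> /allP h k /h /implyP/(_ isT); rewrite powR_eq0 => /andP[+ _].
  by rewrite normr_eq0 => /eqP.
have [A0|A0] := eqVneq A 0.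
  rewrite A0 mul0r big_seq big1// => k kJ.
  by rewrite (lnorm0 _ _ p0 A0 k kJ) normr0 mul0r.
have [B0|B0] := eqVneq B 0.
  rewrite B0 mulr0 big_seq big1// => k kJ.
  by rewrite (lnorm0 _ _ q0 B0 k kJ) normr0 mulr0.
have Ap : 0 < A by rewrite lt_neqAle eq_sym A0 lnorm_ge0.
have Bp : 0 < B by rewrite lt_neqAle eq_sym B0 lnorm_ge0.
have unit (r : R) (w : int -> R) : 0 < r -> 0 < lnorm r J w ->
    \sum_(k <- J) (`|w k| / lnorm r J w) `^ r / r = r^-1.
  move=> r0 w0; under eq_bigr do rewrite powRM ?invr_ge0 ?(ltW w0)//.
  rewrite -2!mulr_suml -(lnorm_powR J w r0) -powRM ?invr_ge0 ?(ltW w0)//.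
  by rewrite mulfV ?gt_eqF// powR1 mul1r.
have uP := unit p u p0 Ap; have vP := unit q v q0 Bp; rewrite -/A in uP; rewrite -/B in vP.
clearbody A B.
have step : \sum_(k <- J) `|u k| / A * (`|v k| / B) <= 1.
  apply: (@le_trans _ _ (\sum_(k <- J) ((`|u k| / A) `^ p / p + (`|v k| / B) `^ q / q))).
    apply: ler_sum => k _.
    have A1 : 0 <= `|u k| / A by apply: divr_ge0; [exact: normr_ge0|exact: ltW].
    have B1 : 0 <= `|v k| / B by apply: divr_ge0; [exact: normr_ge0|exact: ltW].
    exact: (conjugate_powR A1 B1 p0 q0 pq).
  by rewrite big_split/= uP vP pq.
have e : (\sum_(k <- J) `|u k| * `|v k|) / (A * B) = \sum_(k <- J) `|u k| / A * (`|v k| / B).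
  by rewrite mulr_suml; apply: eq_bigr => k _; rewrite invfM mulrACA.
by rewrite -e ler_pdivrMr ?mulr_gt0// mul1r in step.
Qed.

End FiniteLq.

(** * Localization of sequences by cutoffs *)

Section Cutoff.
Context {R : realType}.
Implicit Types (x y : R) (k l : int) (N : nat).

Definition trapezoid x : R := Num.max 0 (Num.min 1 (Num.min (x + 1) (2 - x))).

Lemma trapezoid_ge0 x : 0 <= trapezoid x.
Proof. by rewrite /trapezoid le_max lexx. Qed.

Lemma trapezoid_le1 x : trapezoid x <= 1.
Proof. by rewrite /trapezoid ge_max ler01 ge_min lexx. Qed.

Lemma trapezoid1 x : 0 <= x -> x <= 1 -> trapezoid x = 1.
Proof.
move=> x0 x1; rewrite /trapezoid (min_idPl _) ?(max_idPr _)//.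
by rewrite le_min; apply/andP; split; lra.
Qed.

Lemma trapezoid0 x : x <= -1 \/ 2 <= x -> trapezoid x = 0.
Proof.
move=> xx; rewrite /trapezoid (max_idPl _)// !ge_min.
by case: xx => xx; apply/orP; right; apply/orP; [left|right]; lra.
Qed.

Lemma trapezoid_lip x y : `|trapezoid x - trapezoid y| <= `|x - y|.
Proof.
have nB (a b : R) : a - b <= `|a - b| /\ b - a <= `|a - b|.
  by split; [exact: ler_norm|rewrite distrC ler_norm].
have maxl (a b c : R) : `|Num.max a b - Num.max a c| <= `|b - c|.
  have [] := nB b c; move: `|b - c| => d ? ?; rewrite ler_norml /Num.max.
  by do 2 case: ltP => ?; lra.
have minl (a b c : R) : `|Num.min a b - Num.min a c| <= `|b - c|.
  have [] := nB b c; move: `|b - c| => d ? ?; rewrite ler_norml /Num.min.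
  by do 2 case: ltP => ?; lra.
apply: (le_trans (maxl _ _ _)); apply: (le_trans (minl _ _ _)).
have [] := nB x y; move: `|x - y| => d ? ?; rewrite ler_norml /Num.min.
by do 2 case: ltP => ?; lra.
Qed.

(** Cutoffs equal to 1 on [0, N) and to 0 outside of [-N, 2N), with slope at most
    1/N. *)
Definition cutoff N k : R := trapezoid (k%:~R / N%:R).

Lemma cutoff_ge0 N k : 0 <= cutoff N k. Proof. exact: trapezoid_ge0. Qed.

Lemma cutoff_le1 N k : cutoff N k <= 1. Proof. exact: trapezoid_le1. Qed.

Lemma cutoff1 N k : 0 <= k < N%:Z -> cutoff N k = 1.
Proof.
move=> /andP[k0 kN]; have N0 : 0 < N%:R :> R.
  by rewrite ltr0n; lia.
apply: trapezoid1; first by rewrite divr_ge0 ?ler0z ?ler0n.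
by rewrite ler_pdivrMr// mul1r -[N%:R]/(N%:Z%:~R) ler_int ltW.
Qed.

Lemma cutoff0 N k : (0 < N)%N -> ~~ (- N%:Z <= k < N%:Z *+ 2) -> cutoff N k = 0.
Proof.
move=> N0 kN; have N0' : 0 < N%:R :> R by rewrite ltr0n.
apply: trapezoid0; have [kN'|kN'] : k <= - N%:Z \/ N%:Z *+ 2 <= k by lia.
  by left; rewrite ler_pdivrMr// mulN1r -[N%:R]/(N%:Z%:~R) -mulrNz ler_int.
right; rewrite ler_pdivlMr// (_ : 2 * N%:R = (N%:Z *+ 2)%:~R :> R) ?ler_int//.
by rewrite rmorphMn/= mulr_natl.
Qed.

(** Variation of the cutoff over a step of length l: at most 1, and small when l is
    short compared with N. *)
Definition cutoff_gap N l : R := Num.min 1 (`|l|%N%:R / N%:R).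

Lemma cutoff_gap_ge0 N l : 0 <= cutoff_gap N l.
Proof. by rewrite le_min ler01/= divr_ge0. Qed.

Lemma cutoff_gapP N k l : (0 < N)%N -> `|cutoff N (k + l) - cutoff N k| <= cutoff_gap N l.
Proof.
move=> N0; have N0' : 0 < N%:R :> R by rewrite ltr0n.
rewrite le_min; apply/andP; split.
  have := cutoff_ge0 N k; have := cutoff_ge0 N (k + l).
  have := cutoff_le1 N k; have := cutoff_le1 N (k + l).
  by rewrite ler_norml; lra.
apply: (le_trans (trapezoid_lip _ _)).
rewrite -mulrBl rmorphD/= addrAC subrr add0r normrM.
by rewrite [X in _ * X]ger0_norm ?invr_ge0// -intr_norm natr_absz.
Qed.

End Cutoff.

Section LocalToGlobal.
Context {R : realType}.
Local Notation C := R[i].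

Lemma normc_ge0 (z : C) : 0 <= normc z.
Proof. by case: z => a b; exact: sqrtr_ge0. Qed.

Lemma normc_realE (x : R) : normc x%:C = `|x|.
Proof. by rewrite /= expr0n/= addr0 sqrtr_sqr. Qed.

Lemma normc_sum (I : Type) (r : seq I) (F : I -> C) :
  normc (\sum_(k <- r) F k) <= \sum_(k <- r) normc (F k).
Proof.
elim: r => [|k r IHr]; first by rewrite !big_nil normc0.
by rewrite !big_cons (le_trans (le_normcD _ _))// lerD2l.
Qed.

Definition cseq_norm (q : R) (c : int -> C) : \bar R := lqnorm q (fun n => normc (c n)).

Definition finsupp (c : int -> C) := exists J : seq int, forall i, i \notin J -> c i = 0.

(** The operator s + sum_k w_k S^(kap k), where S is the left translation. The
    index type is arbitrary in order to cover products of two such sums. *)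
Definition shift_sum (I : Type) (K : seq I) (kap : I -> int) (s : C)
    (w : I -> int -> C) (c : int -> C) : int -> C :=
  fun m => s * c m + \sum_(k <- K) w k m * c (m + kap k).

Definition bounded_below (q M : R) (T : (int -> C) -> int -> C) :=
  forall c, finsupp c -> (cseq_norm q c <= M%:E * cseq_norm q (T c))%E.

Definition window (N : nat) (i : int) (x : int -> R) : int -> R :=
  fun n => if i <= n < i + N%:Z then x n else 0.

Lemma window_seq (N : nat) (i n : int) :
  (i <= n < i + N%:Z) = (n \in [seq i + a%:Z | a <- iota 0 N]).
Proof.
apply/idP/mapP => [ni|[a +->]].
  by exists `|n - i|%N; rewrite ?mem_iota; lia.
by rewrite mem_iota; lia.
Qed.

Lemma lqnorm_window_le q N i (x : int -> R) : 1 <= q ->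
  (lqnorm q (window N i x) <= (\sum_(a <- iota 0 N) `|x (i + a%:Z)|)%:E)%E.
Proof.
move=> q1; set J := [seq i + a%:Z | a <- iota 0 N].
have uJ : uniq J by rewrite map_inj_uniq ?iota_uniq// => a b /addrI[].
apply: (le_trans (lqnorm_le_l1 q1 uJ _)).
  by move=> n; rewrite -window_seq /window => /negbTE ->.
rewrite lee_fin big_map; apply: ler_sum => a _.
by rewrite /window; case: ifP => // _; rewrite normr0.
Qed.

Lemma lqnorm_window_fin q N i (x : int -> R) : 1 <= q ->
  lqnorm q (window N i x) \is a fin_num.
Proof.
move=> q1; rewrite ge0_fin_numE ?lqnorm_ge0//.
exact: le_lt_trans (lqnorm_window_le _ _ _ q1) (ltry _).
Qed.

Lemma window3 N i (x : int -> R) n : (0 < N)%N ->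
  (if i - N%:Z <= n < i + N%:Z *+ 2 then x n else 0) =
  \sum_(a <- [:: - N%:Z; 0; N%:Z]) window N (i + a) x n.
Proof.
move=> N0; rewrite !big_cons big_nil /window !addr0.
case: ifP => h; case: ifP => h1; case: ifP => h2; case: ifP => h3;
  rewrite ?addr0 ?add0r//; lia.
Qed.

Definition window_norm (q : R) (N : nat) (c : int -> C) (j : int) : \bar R :=
  lqnorm q (window N j (fun n => normc (c n))).

Variables (I : Type) (K : seq I) (kap : I -> int) (beta : I -> R).
Hypothesis beta_ge0 : forall k, 0 <= beta k.

(** Bounds the commutators of the operator with the cutoffs. It tends to 0 as N
    grows, by absolute summability of the weights. *)
Definition gap_sum (N : nat) : R := \sum_(k <- K) beta k * cutoff_gap N (kap k).

Lemma gap_sum_ge0 N : 0 <= gap_sum N.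
Proof. by apply: sumr_ge0 => k _; rewrite mulr_ge0 ?cutoff_gap_ge0. Qed.

(** The lower bound is applied to the sequence phi c, where phi is the cutoff of the
    window at i. The image of phi c is phi times the image of c, up to commutators:
    these carry the factors cutoff_gap N (kap k), and only see c near i and near
    i + kap k. *)
Lemma window_recursion (q M : R) (N : nat) (s : C) (w : I -> int -> C) (c : int -> C) i :
  1 <= q -> 0 <= M -> (0 < N)%N -> (forall k m, normc (w k m) <= beta k) ->
  bounded_below q M (shift_sum K kap s w) ->
  (window_norm q N c i <= M%:E * ((\sum_(a <- iota 0 (N * 3)) normc (shift_sum K kap s w c (i - N%:Z + a%:Z)))%:E
    + \sum_(k <- K) (beta k * cutoff_gap N (kap k))%:E *
      \sum_(a <- [:: (- N%:Z)%R; 0%R; N%:Z]) (window_norm q N c (i + a)%R + window_norm q N c (i + kap k + a)%R)))%E.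
Proof.
move=> q1 M0 N0 w_le lb; set u := window_norm q N c.
have q0 : 0 < q by exact: lt_le_trans q1.
pose T := shift_sum K kap s w.
pose d n := (cutoff N (n - i))%:C * c n.
have nd n : normc (d n) = cutoff N (n - i) * normc (c n).
  by rewrite normcM normc_realE ger0_norm ?cutoff_ge0.
have fd : finsupp d.
  exists [seq (i - N%:Z) + a%:Z | a <- iota 0 (N * 3)] => n.
  rewrite -window_seq => nJ; rewrite /d cutoff0 ?mul0r//; lia.
have ud : (u i <= cseq_norm q d)%E.
  apply: le_lqnorm => // n; rewrite nd /window; case: ifPn => ni.
    by rewrite cutoff1 ?mul1r//; lia.
  by rewrite normr0.
apply: (le_trans ud); apply: (le_trans (lb _ fd)); apply: lee_wpmul2l; first by rewrite lee_fin.
pose g0 := window (N * 3) (i - N%:Z) (fun n => normc (T c n)).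
pose x n := normc (c n).
pose g k n := beta k * cutoff_gap N (kap k) *
  \sum_(a <- [:: - N%:Z; 0; N%:Z]) (window N (i + a) x (n + kap k) + window N (i + kap k + a) x (n + kap k)).
have x0 n : 0 <= x n by exact: normc_ge0.
have win0 j n : 0 <= window N j x n by rewrite /window; case: ifP.
have g_ge0 k n : 0 <= g k n.
  rewrite mulr_ge0 ?mulr_ge0 ?cutoff_gap_ge0//.
  by apply: sumr_ge0 => a _; rewrite addr_ge0.
have Td n : normc (T d n) <= g0 n + \sum_(k <- K) g k n.
  (* commuting T with the cutoff *)
  have -> : T d n = (cutoff N (n - i))%:C * T c n + \sum_(k <- K)
      w k n * ((cutoff N (n + kap k - i) - cutoff N (n - i))%:C * c (n + kap k)).
    rewrite /T /shift_sum mulrDr -addrA; congr (_ + _); first by rewrite /d mulrCA.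
    rewrite mulr_sumr -big_split; apply: eq_bigr => k _ /=.
    rewrite /d rmorphB/=; ring.
  apply: (le_trans (le_normcD _ _)); apply: lerD.
    rewrite normcM normc_realE ger0_norm ?cutoff_ge0// /g0 /window; case: ifPn => h.
      by rewrite ler_piMl ?normc_ge0// cutoff_le1.
    by rewrite cutoff0 ?mul0r//; lia.
  apply: (le_trans (normc_sum _ _)); apply: ler_sum => k _.
  rewrite !normcM normc_realE /g -mulrA; apply: ler_pM => //; rewrite ?normc_ge0//.
    by rewrite mulr_ge0 ?normc_ge0.
  rewrite big_split/= -!window3//.
  have le1 := @cutoff_gapP R N (n - i) (kap k) N0.
  have e : n - i + kap k = n + kap k - i by lia.
  rewrite e in le1.
  have gap0 := @cutoff_gap_ge0 R N (kap k).
  case: ifPn => h1; case: ifPn => h2; rewrite ?addr0 ?add0r.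
  - by apply: ler_pM; rewrite ?lerDl ?normc_ge0.
  - by apply: ler_pM; rewrite ?normc_ge0.
  - by apply: ler_pM; rewrite ?normc_ge0.
  - by rewrite !cutoff0 ?subrr ?normr0 ?mul0r ?mulr0//; lia.
have l1 : (cseq_norm q (T d) <= lqnorm q (fun n => g0 n + \sum_(k <- K) g k n)%R)%E.
  apply: le_lqnorm => // n; rewrite ger0_norm ?normc_ge0//.
  exact: le_trans (Td n) (ler_norm _).
apply: (le_trans l1); apply: (le_trans (lqnormD _ _ q1)); apply: leeD.
  apply: (le_trans (lqnorm_window_le _ _ _ q1)).
  by rewrite lee_fin; apply: ler_sum => a _; rewrite ger0_norm ?normc_ge0.
apply: (le_trans (lqnorm_sum _ _ q1)); apply: lee_sum => k _.
rewrite /g lqnormZ// ger0_norm ?mulr_ge0 ?cutoff_gap_ge0//.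
apply: lee_wpmul2l; first by rewrite lee_fin mulr_ge0 ?cutoff_gap_ge0.
apply: (le_trans (lqnorm_sum _ _ q1)); apply: lee_sum => a _.
apply: (le_trans (lqnormD _ _ q1)); rewrite /u /window_norm.
by rewrite (lqnorm_shift q (window N (i + a) x)) (lqnorm_shift q (window N (i + kap k + a) x)).
Qed.

End LocalToGlobal.

(** * Stability of lower bounds in the exponent *)

Section GlobalBound.
Context {R : realType}.
Local Notation C := R[i].
Lemma sume_cst (J : Type) (l : seq J) (y : \bar R) : (0 <= y)%E ->
  (\sum_(a <- l) y = (size l)%:R%:E * y)%E.
Proof.
move=> y0; elim: l => [|a l IHl]; first by rewrite big_nil mul0e.
by rewrite big_cons IHl /= -natr1 EFinD addeC ge0_muleDl ?mul1e// lee_fin.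
Qed.

Variables (I : Type) (K : seq I) (kap : I -> int) (beta : I -> R).
Hypothesis beta_ge0 : forall k, 0 <= beta k.

(** By window_recursion the norms u of c over windows of length N satisfy
    u <= Y + G u, where Y comes from the image of c and G, a sum of translations,
    has norm at most 1/2 on l^r for every r, by the smallness of gap_sum. Hence
    the l^r norm of u is controlled by that of Y; the exponent q only enters
    inside the windows, where it is harmless. All bounds are uniform in the
    parameter x, so the conclusion holds for the supremum U over x; the finite
    norm of ch allows to absorb the term with factor 1/2. *)
Theorem shift_sum_stability (q r M : R) (N : nat) (X : Type) (x0 : X)
    (s : X -> C) (w : X -> I -> int -> C) (c : X -> int -> C) (ch yh : int -> R) :
  1 <= q -> 1 <= r -> 0 <= M -> (0 < N)%N ->
  6 * M * gap_sum K kap beta N <= 2^-1 ->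
  (forall x k m, normc (w x k m) <= beta k) ->
  (forall x, bounded_below q M (shift_sum K kap (s x) (w x))) ->
  (forall x i, normc (c x i) <= ch i) -> (lqnorm r ch < +oo)%E ->
  (forall x i, normc (shift_sum K kap (s x) (w x) (c x) i) <= yh i) ->
  exists U : int -> R, (forall x i, normc (c x i) <= U i) /\
    (lqnorm r U <= (6 * N%:R * M)%:E * lqnorm r yh)%E.
Proof.
move=> q1 r1 M0 N0 small w_le lb c_le ch_fin T_le.
have q0 : 0 < q by exact: lt_le_trans q1.
have r0 : 0 < r by exact: lt_le_trans r1.
pose u x i : R := fine (window_norm q N (c x) i).
have uE x i : (u x i)%:E = window_norm q N (c x) i.
  by rewrite /u fineK//; exact: lqnorm_window_fin.
have u_ge0 x i : 0 <= u x i by rewrite fine_ge0// lqnorm_ge0.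
have ch0 i : 0 <= ch i by rewrite (le_trans _ (c_le x0 i)) ?normc_ge0.
have yh0 i : 0 <= yh i by rewrite (le_trans _ (T_le x0 i)) ?normc_ge0.
pose V i := \sum_(a <- iota 0 N) ch (i + a%:Z).
have V0 i : 0 <= V i by apply: sumr_ge0.
have u_le x i : u x i <= V i.
  rewrite -lee_fin uE (le_trans (lqnorm_window_le _ _ _ q1))// lee_fin.
  by apply: ler_sum => a _; rewrite ger0_norm ?normc_ge0.
pose A i := [set u x i | x in [set: X]].
pose U i := sup (A i).
have supA i : has_sup (A i).
  split; first by exists (u x0 i), x0.
  by exists (V i) => _ [x _ <-].
have leU x i : u x i <= U i by apply: ub_le_sup; [exact: (supA i).2|exists x].
have U0 i : 0 <= U i by exact: le_trans (leU x0 i).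
have leV i : U i <= V i by apply: ge_sup; [exact: (supA i).1|move=> _ [x _ <-]].
exists U; split.
  move=> x i; apply: le_trans (leU x i).
  rewrite -lee_fin uE; apply: le_trans (le_lqnorm_coord _ i q0).
  rewrite /window lexx/= ifT; last by lia.
  by rewrite lee_fin ler_norm.
have U_fin : lqnorm r U \is a fin_num.
  rewrite ge0_fin_numE ?lqnorm_ge0//.
  apply: (@le_lt_trans _ _ (lqnorm r V)).
    by apply: le_lqnorm => // i; rewrite !ger0_norm.
  apply: (le_lt_trans (lqnorm_sum _ _ r1)).
  apply: lte_sum_pinfty => a _.
  by rewrite (lqnorm_shift r ch).
pose Y i := M * \sum_(a <- iota 0 (N * 3)) yh (i + (a%:Z - N%:Z)).
pose Z i := \sum_(k <- K) M * (beta k * cutoff_gap N (kap k)) *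
   \sum_(a <- [:: - N%:Z; 0; N%:Z]) (U (i + a) + U (i + (kap k + a))).
have rec x i : u x i <= Y i + Z i.
  rewrite -lee_fin uE.
  have := window_recursion beta_ge0 (c x) i q1 M0 N0 (w_le x) (lb x); move=> /le_trans; apply.
  apply: (@le_trans _ _ (M * (\sum_(a <- iota 0 (N * 3))
     normc (shift_sum K kap (s x) (w x) (c x) (i - N%:Z + a%:Z)) +
     \sum_(k <- K) (beta k * cutoff_gap N (kap k)) *
      \sum_(a <- [:: - N%:Z; 0; N%:Z]) (u x (i + a) + u x (i + kap k + a))))%:E).
    rewrite EFinM EFinD; apply: lee_wpmul2l; first by rewrite lee_fin.
    apply: leeD2l; rewrite -[leRHS]sumEFin; apply: lee_sum => k _.
    rewrite [leRHS]EFinM; apply: lee_wpmul2l.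
      by rewrite lee_fin mulr_ge0// cutoff_gap_ge0.
    by rewrite -[leRHS]sumEFin; apply: lee_sum => a _; rewrite EFinD !uE.
  rewrite lee_fin mulrDr; apply: lerD.
    rewrite /Y ler_wpM2l//; apply: ler_sum => a _.
    by rewrite (_ : i + (a%:Z - N%:Z) = i - N%:Z + a%:Z)//; lia.
  rewrite mulr_sumr /Z; apply: ler_sum => k _; rewrite -[leRHS]mulrA.
  rewrite ler_wpM2l// ler_wpM2l ?mulr_ge0 ?cutoff_gap_ge0//.
  by apply: ler_sum => a _; rewrite addrA lerD.
have Y0 i : 0 <= Y i by rewrite mulr_ge0// sumr_ge0.
have Z0 i : 0 <= Z i.
  apply: sumr_ge0 => k _; rewrite !mulr_ge0 ?cutoff_gap_ge0//.
  by apply: sumr_ge0 => a _; rewrite addr_ge0.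
have recU i : `|U i| <= `|Y i + Z i|.
  rewrite !ger0_norm ?addr_ge0//.
  by apply: ge_sup; [exact: (supA i).1|move=> _ [x _ <-]].
have Yle : (lqnorm r Y <= (3 * N%:R * M)%:E * lqnorm r yh)%E.
  rewrite lqnormZ// ger0_norm// (mulrC _ M) EFinM -muleA.
  apply: lee_wpmul2l; first by rewrite lee_fin.
  apply: (le_trans (lqnorm_sum _ _ r1)).
  rewrite (eq_bigr (fun=> lqnorm r yh)); last first.
    by move=> a _; rewrite (lqnorm_shift r yh).
  by rewrite sume_cst ?lqnorm_ge0// size_iota natrM mulrC.
have Zle : (lqnorm r Z <= (6 * M * gap_sum K kap beta N)%:E * lqnorm r U)%E.
  apply: (le_trans (lqnorm_sum _ _ r1)).
  apply: (@le_trans _ _ (\sum_(k <- K) (M * (beta k * cutoff_gap N (kap k)) * 6)%:E * lqnorm r U)%E).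
    apply: lee_sum => k _; rewrite lqnormZ// ger0_norm; last first.
      by rewrite !mulr_ge0 ?cutoff_gap_ge0.
    rewrite [in leRHS]EFinM -muleA.
    apply: lee_wpmul2l; first by rewrite lee_fin !mulr_ge0 ?cutoff_gap_ge0.
    apply: (le_trans (lqnorm_sum _ _ r1)).
    apply: (@le_trans _ _ (\sum_(a <- [:: (- N%:Z)%R; 0%R; N%:Z]) (lqnorm r U + lqnorm r U))%E).
      apply: lee_sum => a _; apply: (le_trans (lqnormD _ _ r1)).
      have e1 := lqnorm_shift r U a; have e2 := lqnorm_shift r U (kap k + a).
      by apply: leeD; [rewrite e1|rewrite e2].
    rewrite sume_cst ?adde_ge0 ?lqnorm_ge0//.
    by move: (lqnorm r U) U_fin => [y _||]//; rewrite lee_fin /=; lra.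
  rewrite -(fineK U_fin) -EFinM.
  under eq_bigr do rewrite -EFinM.
  rewrite sumEFin lee_fin /gap_sum -mulr_suml ler_wpM2r//.
    by rewrite fine_ge0// lqnorm_ge0.
  by rewrite mulr_sumr; apply: ler_sum => k _; rewrite mulrC !mulrA lexx.
have main : (lqnorm r U <= (3 * N%:R * M)%:E * lqnorm r yh + (2^-1)%:E * lqnorm r U)%E.
  apply: (@le_trans _ _ (lqnorm r Y + lqnorm r Z)%E).
    by apply: le_trans (lqnormD _ _ r1); exact: le_lqnorm.
  apply: leeD => //; apply: (le_trans Zle).
  by apply: lee_wpmul2r; rewrite ?lqnorm_ge0 ?lee_fin.
have [y_fin|] := boolP (lqnorm r yh \is a fin_num).
  move: main; rewrite -(fineK U_fin) -(fineK y_fin) -!EFinM -EFinD !lee_fin.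
  by lra.
rewrite ge0_fin_numE ?lqnorm_ge0// ltey negbK => /eqP y_inf.
(* the image of c has infinite norm: the bound is trivial unless M = 0 *)
have [M_eq|M_gt0] := eqVneq M 0.
  move: main; rewrite y_inf M_eq !mulr0 !mul0e add0e -(fineK U_fin) -EFinM !lee_fin.
  by lra.
rewrite y_inf gt0_muley ?leey// lte_fin !mulr_gt0 ?ltr0n//.
by rewrite lt_neqAle eq_sym M_gt0.
Qed.

End GlobalBound.

(** * Completeness of the Lebesgue space *)

Section LpComplete.
Context {R : realType}.
Implicit Types (p : R).

Lemma limn_einf_le (u : (\bar R)^nat) (B : \bar R) :
  (forall n, (u n <= B)%E) -> (limn_einf u <= B)%E.
Proof.
move=> uB; rewrite limn_einf_lim; apply: lime_le; first exact: is_cvg_einfs.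
apply: nearW => n; apply: le_trans (uB n).
by apply: ereal_inf_lbound; exists n => //=.
Qed.

Lemma measurable_limn_einf d (T : measurableType d) (D : set T) (f : nat -> T -> \bar R) :
  (forall n, measurable_fun D (f n)) ->
  measurable_fun D (fun t => limn_einf (fun n => f n t)).
Proof.
move=> mf; rewrite /limn_einf.
apply: (@measurableT_comp _ _ _ _ _ _ (@oppe R)); first exact: oppe_measurable.
apply: measurable_fun_limn_esup => n.
by apply: (@measurableT_comp _ _ _ _ _ _ (@oppe R)); first exact: oppe_measurable.
Qed.

Lemma powR_le_liminf p (x_ : R^nat) (x : R) : 0 < p -> 0 <= x ->
  x_ @ \oo --> x ->
  ((x `^ p)%:E <= limn_einf (fun n => (x_ n `^ p)%:E))%E.
Proof.
move=> p0; rewrite le_eqVlt => /predU1P[<- _|x0 xx].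
  rewrite powR0 ?gt_eqF// limn_einf_lim; apply: lime_ge; first exact: is_cvg_einfs.
  by apply: nearW => n; apply: le_ereal_inf_tmp => _ [m _ <-]; rewrite lee_fin powR_ge0.
have cvg_pow : (x_ n `^ p) @[n --> \oo] --> x `^ p.
  have : expR (p * ln (x_ n)) @[n --> \oo] --> expR (p * ln x).
    apply: continuous_cvg; first exact: continuous_expR.
    apply: cvgMr; apply: continuous_cvg => //; exact: continuous_ln.
  rewrite [X in _ --> X -> _](_ : _ = x `^ p); last by rewrite /powR gt_eqF.
  apply: cvg_trans; apply: near_eq_cvg.
  near=> n; rewrite /powR gt_eqF//.
  by near: n; exact: (cvgr_gt _ xx _ x0).
have /cvg_limn_einf_sup[-> _] // : (x_ n `^ p)%:E @[n --> \oo] --> (x `^ p)%:E.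
by apply/fine_cvgP; split; [exact: nearW|exact: cvg_pow].
Unshelve. all: by end_near. Qed.

Lemma cvg_normc (z_ : nat -> R[i]) (a b : R) :
  complex.Re (z_ n) @[n --> \oo] --> a -> complex.Im (z_ n) @[n --> \oo] --> b ->
  normc (z_ n) @[n --> \oo] --> normc (a +i* b).
Proof.
move=> za zb.
have -> : (fun n => normc (z_ n)) =
    (fun n => Num.sqrt (complex.Re (z_ n) ^+ 2 + complex.Im (z_ n) ^+ 2)).
  by apply/funext => n; case: (z_ n).
apply: continuous_cvg; first exact: sqrt_continuous.
by apply: cvgD; rewrite !expr2; apply: cvgM.
Qed.

Lemma Re_le_normc (z : R[i]) : `|complex.Re z| <= normc z.
Proof.
by case: z => a b /=; rewrite -sqrtr_sqr ler_sqrt ?lerDl ?addr_ge0 ?sqr_ge0.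
Qed.

Lemma Im_le_normc (z : R[i]) : `|complex.Im z| <= normc z.
Proof.
by case: z => a b /=; rewrite -sqrtr_sqr ler_sqrt ?lerDr ?addr_ge0 ?sqr_ge0.
Qed.

(** By comparison with the series of the moduli. *)
Lemma cvg_csum (z_ : nat -> R[i]) (B : R) :
  (forall n, \sum_(i < n) normc (z_ i) <= B) ->
  cvgn (fun n => complex.Re (\sum_(i < n) z_ i)) /\
  cvgn (fun n => complex.Im (\sum_(i < n) z_ i)).
Proof.
move=> zB.
have H (h : {additive R[i] -> R}) : (forall z, `|h z| <= normc z) ->
    cvgn (fun n => h (\sum_(i < n) z_ i)).
  move=> hle; have -> : (fun n => h (\sum_(i < n) z_ i)) = series (h \o z_).
    by apply/funext => n; rewrite raddf_sum seriesEord.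
  apply: normed_cvg; rewrite /normed_series_of seriesEord; apply: nondecreasing_is_cvgn.
    by apply/nondecreasing_seqP => n; rewrite /= big_ord_recr/= lerDl.
  exists B => _ [n _ <-]; rewrite /= (le_trans _ (zB n))//.
  by apply: ler_sum => i _; exact: hle.
split.
- exact: (H (@complex.Re R) Re_le_normc).
- exact: (H (@complex.Im R) Im_le_normc).
Qed.

End LpComplete.

Section RieszFischer.
Context {R : realType} {p : R} (p1 : 1 < p).
Local Notation mu := (@lebesgue_measure R).
Local Notation Lp := (Lp p1).

Let p0 : 0 < p. Proof. exact: lt_trans p1. Qed.

Lemma LpN_le (f : R -> R[i]) (d : R) : 0 <= d ->
  (\int[mu]_(x in Rpos) (cabs f x `^ p)%:E <= (d `^ p)%:E)%E -> (LpN p f <= d%:E)%E.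
Proof.
move=> d0 h; rewrite LpNE// -[d in leRHS](powRr1 d0) -(divff (lt0r_neq0 p0)).
rewrite powRrM -poweR_EFin; apply: gt0_ler_poweR => //.
- by rewrite invr_ge0 ltW.
- rewrite in_itv/= leey andbT; apply: integral_ge0 => x _.
  by rewrite lee_fin powR_ge0.
- by rewrite in_itv/= leey andbT lee_fin powR_ge0.
Qed.

Lemma le_LpN_integral (f : R -> R[i]) (d : R) : 0 <= d -> (LpN p f <= d%:E)%E ->
  (\int[mu]_(x in Rpos) (cabs f x `^ p)%:E <= (d `^ p)%:E)%E.
Proof.
move=> d0; rewrite LpNE// => h.
set J := (\int[mu]_(x in Rpos) _)%E in h *.
have J0 : (0 <= J)%E by apply: integral_ge0 => x _; rewrite lee_fin powR_ge0.
have -> : J = ((J `^ p^-1) `^ p)%E.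
  by rewrite -poweRrM ?mulVf ?gt_eqF// ?poweRe1.
rewrite -poweR_EFin; apply: gt0_ler_poweR => //; first exact: ltW.
- by rewrite in_itv/= poweR_ge0 leey.
- by rewrite in_itv/= lee_fin d0 leey.
Qed.

Lemma toLp_sum (I : Type) (r : seq I) (f : I -> R -> R[i]) :
  (forall i, f i \in Lp_fun p1) ->
  \sum_(i <- r) f i \in Lp_fun p1 /\
  toLp p1 (\sum_(i <- r) f i) = \sum_(i <- r) toLp p1 (f i).
Proof.
move=> fL; have S : \sum_(i <- r) f i \in Lp_fun p1 by exact: rpred_sum.
split => //; elim: r S => [|i r IHr] _.
  rewrite !big_nil /toLp (_ : insubd _ _ = 0); first by rewrite Lp_pi0.
  apply: val_inj; rewrite val_insubd; case: ifP => //.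
by rewrite !big_cons toLpD ?IHr ?rpred_sum.
Qed.

(** By Fatou's lemma the sums of the moduli are finite almost everywhere, so the
    series converges pointwise almost everywhere; a second use of Fatou's lemma
    bounds the distance from the limit to the partial sums. *)
Theorem Lp_complete (x : nat -> Lp) (M : R) :
  (forall n, \sum_(i < n) `|x i| <= M) ->
  exists y : Lp, forall n d, (forall m, \sum_(i < m) `|x (n + i)%N| <= d) ->
    `|y - \sum_(i < n) x i| <= d.
Proof.
move=> xM.
pose f i := ofLp (x i).
have fL i : f i \in Lp_fun p1 by exact: ofLpP.
have mf i : cmeasurable (f i) by case/Lp_funP: (fL i).
(* the sequence of the norms, as a complex function *)
pose g i : R -> R[i] := fun t => (cabs (f i) t)%:C.
have cg i : cabs (g i) = cabs (f i).
  by apply/funext => t; rewrite /g /cabs normc_realE ger0_norm ?normc_ge0.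
have mg i : cmeasurable (g i).
  by split; [exact: measurable_cabs|exact: measurable_cst].
have gN i : LpN p (g i) = (`|x i|)%:E.
  rewrite -[x i]toLpK toLp_norm ?ofLpP// /LpN.
  by congr (Lnorm _ _ _); rewrite cg.
have gL i : g i \in Lp_fun p1.
  by apply/Lp_funP; split => //; rewrite gN ltry.
pose F n := \sum_(i < n) f i; pose G n := \sum_(i < n) g i.
have FL n : F n \in Lp_fun p1 by exact: (toLp_sum _ (fun i : 'I_n => fL i)).1.
have GL n : G n \in Lp_fun p1 by exact: (toLp_sum _ (fun i : 'I_n => gL i)).1.
have mF n : cmeasurable (F n) by case/Lp_funP: (FL n).
have mG n : cmeasurable (G n) by case/Lp_funP: (GL n).
have GE n t : cabs (G n) t = \sum_(i < n) normc (f i t).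
  rewrite /G /cabs fct_sumE /g -rmorph_sum normc_realE ger0_norm ?sumr_ge0//.
  by move=> i _; exact: normc_ge0.
have GN n : (LpN p (G n) <= M%:E)%E.
  rewrite -(toLp_norm (GL n)) lee_fin (toLp_sum _ (fun i : 'I_n => gL i)).2 (le_trans (ler_norm_sum _ _ _))//.
  apply: le_trans (xM n); apply: ler_sum => i _.
  by rewrite -lee_fin (toLp_norm (gL i)) gN.
have M0 : 0 <= M by have := xM 0%N; rewrite big_ord0.
have mGp n : measurable_fun Rpos (fun t => (cabs (G n) t `^ p)%:E).
  exact: measurable_cabs_powR.
pose H t := limn_einf (fun n => (cabs (G n) t `^ p)%:E).
have mH : measurable_fun Rpos H.
  exact: measurable_limn_einf.
have H0 t : (0 <= H t)%E.
  rewrite /H limn_einf_lim; apply: lime_ge; first exact: is_cvg_einfs.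
  by apply: nearW => n; apply: le_ereal_inf_tmp => _ [m _ <-]; rewrite lee_fin powR_ge0.
have intH : (\int[mu]_(t in Rpos) H t <= (M `^ p)%:E)%E.
  apply: le_trans (fatou mu measurable_Rpos mGp _) _.
    by move=> n t _; rewrite lee_fin powR_ge0.
  by apply: limn_einf_le => n; exact: le_LpN_integral.
have aeH : \forall t \ae mu, Rpos t -> H t \is a fin_num.
  apply: integrable_ae; first exact: measurable_Rpos.
  apply/integrableP; split => //.
  under eq_integral do rewrite gee0_abs//.
  exact: le_lt_trans intH (ltry _).
pose hR t := fine (limn_esup (fun n => (complex.Re (F n t))%:E)).
pose hI t := fine (limn_esup (fun n => (complex.Im (F n t))%:E)).
pose h t : R[i] := hR t +i* hI t.
have mh : cmeasurable h.
  split.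
  - apply: (@measurableT_comp _ _ _ _ _ _ fine) => //.
    apply: measurable_fun_limn_esup => n; apply/measurable_EFinP.
    by case: (mF n).
  - apply: (@measurableT_comp _ _ _ _ _ _ fine) => //.
    apply: measurable_fun_limn_esup => n; apply/measurable_EFinP.
    by case: (mF n).
have FE n t : F n t = \sum_(i < n) f i t by rewrite /F fct_sumE.
have cvgF t : H t \is a fin_num ->
    complex.Re (F n t) @[n --> \oo] --> hR t /\
    complex.Im (F n t) @[n --> \oo] --> hI t.
  move=> Hfin.
  have Gle n : \sum_(i < n) normc (f i t) <= (fine (H t)) `^ p^-1.
    have : ((cabs (G n) t `^ p)%:E <= H t)%E.
      rewrite /H limn_einf_lim; apply: lime_ge; first exact: is_cvg_einfs.
      near=> m; apply: le_ereal_inf_tmp => _ [k /= mk <-].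
      rewrite lee_fin ge0_ler_powR ?nnegrE ?cabs_ge0 ?(ltW p0)// !GE.
      have nk : (n <= k)%N by apply: leq_trans mk; near: m; exact: nbhs_infty_ge.
      rewrite -(subnKC nk) big_split_ord/= lerDl sumr_ge0// => i _.
      exact: normc_ge0.
    rewrite -{1}(fineK Hfin) lee_fin -GE => le1.
    rewrite -[leLHS]powRr1 ?cabs_ge0// -(divff (lt0r_neq0 p0)) powRrM.
    by apply: ge0_ler_powR => //; rewrite ?invr_ge0 ?(ltW p0)// nnegrE ?powR_ge0 ?fine_ge0.
  have [cR cI] := @cvg_csum R (fun i => f i t) _ Gle.
  split.
  - rewrite /hR; have cR' : cvgn (fun n => complex.Re (F n t)).
      by under eq_fun do rewrite FE.
    have e : (complex.Re (F n t))%:E @[n --> \oo] --> (limn (fun n => complex.Re (F n t)))%:E.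
      by apply/fine_cvgP; split; [exact: nearW|exact: cR'].
    by rewrite (cvg_limn_einf_sup e).2.
  - rewrite /hI; have cI' : cvgn (fun n => complex.Im (F n t)).
      by under eq_fun do rewrite FE.
    have e : (complex.Im (F n t))%:E @[n --> \oo] --> (limn (fun n => complex.Im (F n t)))%:E.
      by apply/fine_cvgP; split; [exact: nearW|exact: cI'].
    by rewrite (cvg_limn_einf_sup e).2.
have key n d : (forall m, \sum_(i < m) `|x (n + i)%N| <= d) ->
    (LpN p (h - F n)%R <= d%:E)%E.
  move=> xd; have d0 : 0 <= d by have := xd 0%N; rewrite big_ord0.
  have mhF : cmeasurable (h - F n).
    by rewrite -scaleN1r; apply: cmeasurableD => //; exact: cmeasurableZ.
  have mD m : cmeasurable (F (n + m)%N - F n).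
    by rewrite -scaleN1r; apply: cmeasurableD => //; exact: cmeasurableZ.
  apply: LpN_le => //.
  apply: (@le_trans _ _ (\int[mu]_(t in Rpos)
      limn_einf (fun m => (cabs (F (n + m)%N - F n) t `^ p)%:E))%E).
    apply: ae_ge0_le_integral => //.
    - exact: measurable_Rpos.
    - by move=> t _; rewrite lee_fin powR_ge0.
    - exact: measurable_cabs_powR.
    - move=> t _; rewrite limn_einf_lim; apply: lime_ge; first exact: is_cvg_einfs.
      by apply: nearW => m; apply: le_ereal_inf_tmp => _ [k _ <-]; rewrite lee_fin powR_ge0.
    - by apply: measurable_limn_einf => m; exact: measurable_cabs_powR.
    move: aeH; apply: (@filterS _ _ (ae_filter_ringOfSetsType mu)) => t + tpos.
    move=> /(_ tpos) /cvgF[cR cI].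
    apply: powR_le_liminf => //; first exact: cabs_ge0.
    rewrite /cabs !fctE /h.
    have -> : hR t +i* hI t - F n t = (hR t - complex.Re (F n t)) +i* (hI t - complex.Im (F n t)).
      by case: (F n t).
    apply: cvg_normc.
    - have -> : (fun m => complex.Re ((F (n + m)%N + - F n) t)) =
          (fun m => complex.Re (F (m + n)%N t) - complex.Re (F n t)).
        by apply/funext => m; rewrite addnC !fctE; case: (F _ t) (F _ t) => [? ?] [].
      apply: cvgB; last exact: cvg_cst.
      by move: cR; rewrite -(cvg_shiftn n).
    - have -> : (fun m => complex.Im ((F (n + m)%N + - F n) t)) =
          (fun m => complex.Im (F (m + n)%N t) - complex.Im (F n t)).
        by apply/funext => m; rewrite addnC !fctE; case: (F _ t) (F _ t) => [? ?] [].
      apply: cvgB; last exact: cvg_cst.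
      by move: cI; rewrite -(cvg_shiftn n).
  apply: le_trans (fatou mu measurable_Rpos _ _) _.
  - by move=> m; exact: measurable_cabs_powR.
  - by move=> m t _; rewrite lee_fin powR_ge0.
  apply: limn_einf_le => m; apply: le_LpN_integral => //.
  have -> : F (n + m)%N - F n = \sum_(i < m) f (n + i)%N.
    by rewrite /F big_split_ord/= addrC addrK.
  rewrite -(toLp_norm (toLp_sum _ (fun i : 'I_m => fL (n + i)%N)).1) lee_fin (toLp_sum _ (fun i : 'I_m => fL (n + i)%N)).2.
  apply: le_trans (xd m); apply: le_trans (ler_norm_sum _ _ _) _.
  by apply: ler_sum => i _; rewrite /f toLpK.
have hL : h \in Lp_fun p1.
  apply/Lp_funP; split => //; have := key 0%N M xM.
  by rewrite /F big_ord0 subr0 => /le_lt_trans; apply; exact: ltry.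
exists (toLp p1 h) => n d xd.
have -> : \sum_(i < n) x i = toLp p1 (F n).
  by rewrite (toLp_sum _ (fun i : 'I_n => fL i)).2; apply: eq_bigr => i _; rewrite toLpK.
rewrite -[X in _ - X]scale1r -scaleNr -toLpZ// -toLpD ?rpredZ//.
rewrite -lee_fin toLp_norm; last by rewrite rpredD ?rpredZ.
by rewrite scaleN1r; exact: key.
Unshelve. all: by end_near. Qed.

End RieszFischer.

(** * Series of bounded operators *)

Section Summability.
Context {R : realType}.
Variable beta : int -> R.
Hypothesis beta_ge0 : forall k, 0 <= beta k.
Hypothesis beta_fin : (\esum_(k in [set: int]) (beta k)%:E < +oo)%E.

Definition total_sum : R := fine (\esum_(k in [set: int]) (beta k)%:E).

Lemma total_sumE : (total_sum%:E = \esum_(k in [set: int]) (beta k)%:E)%E.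
Proof.
by rewrite /total_sum fineK// ge0_fin_numE// esum_ge0// => k _; rewrite lee_fin.
Qed.

Lemma sum_uniq_le (s : seq int) : uniq s -> \sum_(k <- s) beta k <= total_sum.
Proof.
move=> us; rewrite -lee_fin total_sumE; apply: esum_ge.
exists [set` [fset x | x in s]%fset]; first by split => //; exact: finite_fset.
rewrite fsbig_finite//= set_fsetK sumEFin lee_fin le_eqVlt; apply/orP; left.
by apply/eqP; rewrite (perm_big [fset x | x in s]%fset)//= uniq_perm// => k; rewrite !inE.
Qed.

Lemma sum_tail_small (e : R) : 0 < e ->
  exists J0 : {fset int}, forall s : seq int, uniq s -> (forall k, k \in s -> k \notin J0) ->
    \sum_(k <- s) beta k <= e.
Proof.
move=> e0.
have fin : (\esum_(k in [set: int]) (beta k)%:E)%E \is a fin_num by rewrite -total_sumE.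
have [_ [A [finA _] <-]] := ub_ereal_sup_adherent e0 fin.
rewrite -/(esum _ _) -total_sumE fsbig_finite//= sumEFin -EFinB lte_fin => lt.
exists (fset_set A) => s us sA.
have /sum_uniq_le : uniq (fset_set A ++ s).
  rewrite cat_uniq us fset_uniq andbT/=; apply/hasPn => k /sA.
  by [].
by rewrite big_cat/=; lra.
Qed.

End Summability.

Section BopSeries.
Context {R : realType} {p : R} {p1 : 1 < p}.
Local Notation Lp := (Lp p1).
Local Notation Bop := (Bop p1).
Implicit Types (S T : Bop).

Lemma Bop_normM S T : `|S * T| <= `|S| * `|T|.
Proof.
rewrite !Bop_normE; apply: opnorm_le; first by rewrite mulr_ge0 ?opnorm_ge0.
move=> x; rewrite BopME (le_trans (opnormP _ _))// -mulrA ler_wpM2l ?opnorm_ge0//.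
exact: opnormP.
Qed.

Lemma Bop_norm_le S (M : R) : 0 <= M -> (forall x, `|S x| <= M * `|x|) -> `|S| <= M.
Proof. by move=> M0 SM; rewrite Bop_normE; exact: opnorm_le. Qed.

Lemma Bop_normP S x : `|S x| <= `|S| * `|x|.
Proof. exact: opnormP. Qed.

Lemma Bop_sumE (I : Type) (r : seq I) (T : I -> Bop) x :
  (\sum_(i <- r) T i) x = \sum_(i <- r) T i x.
Proof. by elim: r => [|i r IHr]; rewrite ?big_nil// !big_cons BopDE IHr. Qed.

Lemma sum_iota (V : nmodType) (n : nat) (f : nat -> V) :
  \sum_(i <- iota 0 n) f i = \sum_(i < n) f i.
Proof. by rewrite -(big_mkord xpredT) /index_iota subn0. Qed.

Lemma series_tail (u : nat -> R) (M e : R) : (forall i, 0 <= u i) ->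
  (forall n, \sum_(i < n) u i <= M) -> 0 < e ->
  exists n, forall m, \sum_(i < m) u (n + i)%N <= e.
Proof.
move=> u0 uM e0; pose A := [set \sum_(i < n) u i | n in [set: nat]].
have sA : has_sup A by split; [exists 0, 0%N => //; rewrite big_ord0|exists M => _ [n _ <-]].
have [_ [n _ <-] nA] := sup_adherent e0 sA.
exists n => m.
have : \sum_(i < n + m) u i <= sup A by apply: ub_le_sup; [exact: sA.2|exists (n + m)%N].
by rewrite big_split_ord/=; lra.
Qed.

(** The limit is taken pointwise, by completeness of Lp. The tail bounds d determine
    the values of the limit and thereby give its linearity. *)
Theorem Bop_complete (T : nat -> Bop) (M : R) :
  (forall n, \sum_(i < n) `|T i| <= M) ->
  exists S, forall n d, (forall m, \sum_(i < m) `|T (n + i)%N| <= d) ->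
    `|S - \sum_(i < n) T i| <= d.
Proof.
move=> TM.
have ex x : exists y : Lp, forall n d, (forall m, \sum_(i < m) `|T (n + i)%N| <= d) ->
    `|y - \sum_(i < n) T i x| <= d * `|x|.
  have [|y yP] := @Lp_complete _ _ p1 (fun i => T i x) (M * `|x|).
    move=> n; apply: le_trans (ler_wpM2r (normr_ge0 x) (TM n)).
    by rewrite mulr_suml; apply: ler_sum => i _; exact: Bop_normP.
  exists y => n d dP; apply: yP => m.
  apply: le_trans (ler_wpM2r (normr_ge0 x) (dP m)).
  by rewrite mulr_suml; apply: ler_sum => i _; exact: Bop_normP.
have [F FP] := choice ex.
have M0 : 0 <= M by have := TM 0%N; rewrite big_ord0.
have F_lin : linear F.
  move=> c x y; apply/eqP; rewrite -subr_eq0 -normr_le0; apply/ler_addgt0Pl => e e0.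
  rewrite addr0.
  pose K := `|c *: x + y| + normc c * `|x| + `|y| + 1.
  have K0 : 0 < K.
    by rewrite ltr_wpDl// addr_ge0// addr_ge0// mulr_ge0// normc_ge0.
  have [n nP] := series_tail (fun i => normr_ge0 (T i)) TM (divr_gt0 e0 K0).
  pose S z := \sum_(i < n) T i z.
  have -> : F (c *: x + y) - (c *: F x + F y) =
      (F (c *: x + y) - S (c *: x + y)) - (c *: (F x - S x) + (F y - S y)).
    rewrite (_ : S (c *: x + y) = c *: S x + S y); last first.
      rewrite /S scaler_sumr -big_split; apply: eq_bigr => i _.
      exact: Bop_linear.
    by rewrite scalerBr addrACA -opprD opprB addrA subrK.
  have h1 := FP (c *: x + y) _ _ nP.
  have h2 := FP x _ _ nP.
  have h3 := FP y _ _ nP.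
  apply: (le_trans (ler_normB _ _)); apply: (le_trans (lerD (lexx _) (ler_normD _ _))).
  rewrite Lp_normrZ.
  have h2' := ler_wpM2l (normc_ge0 c) h2.
  apply: (le_trans (lerD h1 (lerD h2' h3))).
  rewrite (_ : _ + _ = e / K * (K - 1)); last by rewrite /K; ring.
  rewrite mulrAC ler_pdivrMr// ler_wpM2l ?ltW//; lra.
have F_bd x : `|F x| <= M * `|x|.
  have := FP x 0%N M; rewrite big_ord0 subr0; apply.
  by move=> m; exact: TM.
have FB : F \in bounded_linear_op p1 by apply/bounded_linear_opP; split => //; exists M.
exists (MkBop FB) => n d dP; apply: Bop_norm_le.
  by have := dP 0%N; rewrite big_ord0.
by move=> x; rewrite BopDE BopNE Bop_sumE; exact: FP.
Qed.

Lemma is_opsumP (T : int -> Bop) S : is_opsum T S <->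
  forall e, 0 < e -> exists J0 : {fset int}, forall J : {fset int}, (J0 `<=` J)%fset ->
    `|S - \sum_(k <- J) T k| <= e.
Proof.
pose FF := @summability.totally_filter int.
split.
  move=> TS e e0.
  have /cvgrPdist_le /(_ e e0) [J0 _ J0P] := TS.
  by exists J0 => J JJ; have := J0P _ JJ; rewrite /= sub0r normrN normr_id.
move=> h; apply/cvgrPdist_le => e e0; have [J0 J0P] := h e e0.
by exists J0 => // J JJ /=; rewrite sub0r normrN normr_id; exact: J0P.
Qed.

(** An enumeration of int turns the family into a convergent series of operators.
    Its sum does not depend on the order, because the sums over finite sets that
    avoid a large finite set are small. *)
Theorem opsum_exists (T : int -> Bop) (beta : int -> R) :
  (forall k, `|T k| <= beta k) -> (\esum_(k in [set: int]) (beta k)%:E < +oo)%E ->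
  exists S, is_opsum T S.
Proof.
move=> Tb bfin.
have b0 k : 0 <= beta k by exact: le_trans (Tb k).
have inj_e : injective nat_to_int.
  by have [_ + _] := nat_to_int_bij; move=> h x y; apply: h; rewrite ?inE.
pose e := nat_to_int.
have eP (n : nat) f : \sum_(i < n) f (e i) = \sum_(k <- map e (iota 0 n)) f k :> R.
  by rewrite big_map sum_iota.
have ue (s : seq nat) : uniq s -> uniq (map e s) by rewrite map_inj_uniq.
have [S SP] : exists S : Bop, forall n d, (forall m, \sum_(i < m) `|T (e (n + i)%N)| <= d) ->
    `|S - \sum_(i < n) T (e i)| <= d.
  apply: (@Bop_complete (T \o e) (total_sum beta)) => n.
  apply: (@le_trans _ _ (\sum_(i < n) beta (e i))); first by apply: ler_sum => i _; exact: Tb.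
  by rewrite eP; apply: sum_uniq_le => //; exact/ue/iota_uniq.
exists S; apply/is_opsumP => d d0.
have d20 : 0 < d / 2 by rewrite divr_gt0.
have [J0 J0P] := sum_tail_small b0 bfin d20.
exists J0 => J J0J.
have [N NP] : exists N, forall k, k \in J -> exists2 i, (i < N)%N & e i = k.
  have [_ _ se] := nat_to_int_bij.
  have [f fP] : exists f : int -> nat, forall k, e (f k) = k.
    have /choice[f fP] : forall k, exists i, e i = k by move=> k; have [i _ <-] := se k I; exists i.
    by exists f.
  exists (\max_(k <- J) f k).+1 => k kJ; exists (f k) => //.
  by rewrite ltnS; exact: leq_bigmax_seq.
have JN k : k \in J -> k \in map e (iota 0 N).
  by move=> /NP[i iN <-]; rewrite map_f// mem_iota.
have farJ0 k : k \notin J -> k \notin J0 by apply: contra => /(fsubsetP J0J).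
rewrite (splitr d) -(subrK (\sum_(i < N) T (e i)) S) -addrA.
apply: (le_trans (ler_normD _ _)); apply: lerD.
  apply: SP => m.
  apply: (@le_trans _ _ (\sum_(k <- [seq e i | i <- iota N m]) beta k)).
    rewrite big_map -{2}(addn0 N) iotaDl big_map sum_iota.
    by apply: ler_sum => i _; exact: Tb.
  apply: J0P; first exact/ue/iota_uniq.
  move=> _ /mapP[i + ->]; rewrite mem_iota => /andP[Ni _]; apply: farJ0.
  by apply/negP => /JN /mapP[j + /inj_e ij]; rewrite mem_iota -ij; lia.
rewrite (_ : \sum_(i < N) T (e i) - \sum_(k <- J) T k =
    \sum_(k <- [seq k <- map e (iota 0 N) | k \notin J]) T k); last first.
  rewrite big_filter; apply/eqP; rewrite subr_eq; apply/eqP.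
  have -> : \sum_(i < N) T (e i) = \sum_(k <- map e (iota 0 N)) T k.
    by rewrite big_map sum_iota.
  rewrite (bigID [pred k | k \in J]) addrC/=; congr (_ + _).
  rewrite -big_filter; apply: perm_big; apply: uniq_perm.
  - by rewrite filter_uniq// ue// iota_uniq.
  - exact: fset_uniq.
  move=> k; rewrite mem_filter; have [kJ|//] := boolP (k \in J).
  exact: JN.
apply: (le_trans (ler_norm_sum _ _ _)).
apply: (@le_trans _ _ (\sum_(k <- [seq k <- map e (iota 0 N) | k \notin J]) beta k)).
  by apply: ler_sum => k _; exact: Tb.
apply: J0P; first by rewrite filter_uniq// ue// iota_uniq.
by move=> k; rewrite mem_filter => /andP[/farJ0].
Qed.

Lemma eq_opsum (T T' : int -> Bop) S : T =1 T' -> is_opsum T S -> is_opsum T' S.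
Proof. by move=> /funext ->. Qed.

Lemma opsumB (T T' : int -> Bop) S S' : is_opsum T S -> is_opsum T' S' ->
  is_opsum (fun k => T k - T' k) (S - S').
Proof.
move=> /is_opsumP TS /is_opsumP TS'; apply/is_opsumP => e e0.
have e20 : 0 < e / 2 by rewrite divr_gt0.
have [J1 J1P] := TS _ e20; have [J2 J2P] := TS' _ e20.
exists (J1 `|` J2)%fset => J; rewrite fsubUset => /andP[/J1P h1 /J2P h2].
rewrite sumrB opprD addrACA -opprD (splitr e).
by apply: (le_trans (ler_normB _ _)); exact: lerD.
Qed.

Lemma opsum_norm_le (T : int -> Bop) S (M : R) : is_opsum T S ->
  (forall J : {fset int}, `|\sum_(k <- J) T k| <= M) -> `|S| <= M.
Proof.
move=> /is_opsumP TS TM; apply/ler_addgt0Pl => e e0; have [J /(_ J (fsubset_refl _)) h] := TS e e0.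
rewrite -(subrK (\sum_(k <- J) T k) S); apply: (le_trans (ler_normD _ _)).
exact: lerD.
Qed.

Lemma opsum_mull (T : int -> Bop) S B : is_opsum T S -> is_opsum (fun k => B * T k) (B * S).
Proof.
move=> /is_opsumP TS; apply/is_opsumP => e e0.
have B0 : 0 < `|B| + 1 by rewrite ltr_wpDl.
have [J0 J0P] := TS _ (divr_gt0 e0 B0); exists J0 => J /J0P h.
rewrite -mulr_sumr -mulrBr; apply: (le_trans (Bop_normM _ _)).
apply: (@le_trans _ _ ((`|B| + 1) * (e / (`|B| + 1)))).
  by apply: ler_pM => //; rewrite lerDl.
by rewrite mulrCA mulfV ?mulr1// gt_eqF.
Qed.

Lemma opsum_mulr (T : int -> Bop) S B : is_opsum T S -> is_opsum (fun k => T k * B) (S * B).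
Proof.
move=> /is_opsumP TS; apply/is_opsumP => e e0.
have B0 : 0 < `|B| + 1 by rewrite ltr_wpDl.
have [J0 J0P] := TS _ (divr_gt0 e0 B0); exists J0 => J /J0P h.
rewrite -mulr_suml -mulrBl; apply: (le_trans (Bop_normM _ _)).
apply: (@le_trans _ _ (e / (`|B| + 1) * (`|B| + 1))).
  by apply: ler_pM => //; rewrite lerDl.
by rewrite mulfVK// gt_eqF.
Qed.

Lemma opsum_reindex (T : int -> Bop) S (f f' : int -> int) : cancel f f' -> cancel f' f ->
  is_opsum T S -> is_opsum (T \o f) S.
Proof.
move=> fK f'K /is_opsumP TS; apply/is_opsumP => e e0; have [J0 J0P] := TS _ e0.
exists [fset f' k | k in J0]%fset => J JJ.
rewrite (_ : \sum_(k <- J) (T \o f) k = \sum_(k <- [fset f k | k in J]%fset) T k); last first.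
  by rewrite big_imfset//= => x y _ _ /(can_inj fK).
apply: J0P; apply/fsubsetP => k kJ0; apply/imfsetP; exists (f' k); rewrite ?f'K//=.
by apply: (fsubsetP JJ); rewrite in_imfset.
Qed.

Lemma opsum_fin (T : int -> Bop) (J0 : {fset int}) :
  (forall k, k \notin J0 -> T k = 0) -> is_opsum T (\sum_(k <- J0) T k).
Proof.
move=> T0; apply/is_opsumP => e e0; exists J0 => J JJ.
rewrite (big_fset_incl _ JJ) ?subrr ?normr0 ?ltW//.
by move=> k _ /T0.
Qed.

End BopSeries.

(** * Change of variables *)

Section Density.
Context d (T : measurableType d) (R : realType) (mu : {sigma_finite_measure set T -> \bar R}).
Context (w : T -> R) (mw : measurable_fun [set: T] w) (w0 : forall x, 0 <= w x).
Local Open Scope ereal_scope.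

(** The proof arguments allow the measure structure to be inferred. *)
Definition density of measurable_fun [set: T] w & (forall x, (0 <= w x)%R) :
  set T -> \bar R := fun A => \int[mu]_(x in A) (w x)%:E.

Let density0 : density mw w0 set0 = 0.
Proof. by rewrite /density integral_set0. Qed.

Let density_ge0 A : 0 <= density mw w0 A.
Proof. by apply: integral_ge0 => x _; rewrite lee_fin. Qed.

Let density_sigma : semi_sigma_additive (density mw w0).
Proof.
move=> F mF tF mUF; rewrite /density ge0_integral_bigcup//; last 2 first.
- exact/measurable_EFinP/measurable_funTS.
- by move=> x _; rewrite lee_fin.
apply: is_cvg_nneseries => n _ _; apply: integral_ge0 => x _.
by rewrite lee_fin.
Qed.

HB.instance Definition _ := isMeasure.Build _ _ _ (density mw w0)
  density0 density_ge0 density_sigma.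

Let la := (@lebesgue_measure R).
Let hypograph : set (T * R) := [set z | (0 < z.2 < w z.1)%R].

Let measurable_hypograph : measurable hypograph.
Proof.
have m1 : measurable_fun [set: T * R] (fun z : T * R => w z.1 - z.2)%R.
  by apply: measurable_funB => //; apply: measurableT_comp.
have -> : hypograph = (snd @^-1` `]0%R, +oo[%classic) `&`
    ((fun z : T * R => w z.1 - z.2)%R @^-1` `]0%R, +oo[%classic).
  apply/seteqP; split => z; rewrite /hypograph /= !in_itv/= !andbT subr_gt0.
    by move=> /andP[].
  by case=> -> ->.
apply: measurableI.
- by rewrite -[X in measurable X]setTI; apply: measurable_snd.
- by rewrite -[X in measurable X]setTI; apply: m1.
Qed.

(** Tonelli's theorem on the region below the graph of the density. *)
Let integral_hypograph (E : set T) (f : T -> \bar R) : measurable E ->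
  measurable_fun E f -> (forall x, E x -> 0 <= f x) ->
  \int[mu \x la]_(z in fst @^-1` E `&` hypograph) f z.1 = \int[mu]_(x in E) (f x * (w x)%:E).
Proof.
move=> mE mf f0.
have mE1 : measurable (fst @^-1` E : set (T * R)).
  by rewrite -[X in measurable X]setTI; exact: measurable_fst.
have mD : measurable (fst @^-1` E `&` hypograph) by exact: measurableI.
rewrite integral_mkcond (fubini_tonelli1 (m2 := la)); last 2 first.
- apply/(measurable_restrictT _ mD).
  apply: (measurable_comp mE _ mf); first by move=> _ [z [Ez _] <-].
  exact: measurable_funTS.
- by move=> z; apply: erestrict_ge0 => {}z [Ez _]; exact: f0.
rewrite [RHS]integral_mkcond; apply: eq_integral => x _.
rewrite /fubini_F patchE; case: ifPn => xE; last first.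
  by rewrite integral0_eq// => r _; rewrite patchE memNset// => -[/= /mem_set]; rewrite (negbTE xE).
rewrite inE in xE; pose I := `]0%R, w x[%classic.
transitivity (\int[la]_r (f x * (\1_I r)%:E)).
  apply: eq_integral => r _; rewrite patchE indicE; have [rI|rI] := boolP (r \in I).
    rewrite mule1 mem_set//; split => //.
    by move: rI; rewrite inE /I /= in_itv.
  rewrite mule0 memNset// => -[_] h; move: rI; rewrite notin_setE; apply.
  by rewrite /I /= in_itv.
rewrite ge0_integralZl//; last exact: f0.
- rewrite integral_indic//; last exact: measurable_itv.
  rewrite (_ : I `&` _ = I); last exact: setIT.
  rewrite /I /= /la lebesgue_measure_itv/= lte_fin; congr (_ * _).
  have [_|] := ltP 0%R (w x); first by rewrite sube0.
  by move=> h; congr EFin; apply/eqP; rewrite eq_le w0 h.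
- by apply/measurable_EFinP; apply: measurable_indic; exact: measurable_itv.
Qed.

Let below := mrestr (mu \x la) measurable_hypograph.

(** The measure with density w is the image, under the projection, of the restriction
    of the product measure to the region below the graph of w. *)
Lemma ge0_integral_density (E : set T) (f : T -> \bar R) : measurable E ->
  measurable_fun E f -> (forall x, E x -> 0 <= f x) ->
  \int[density mw w0]_(x in E) f x = \int[mu]_(x in E) (f x * (w x)%:E).
Proof.
move=> mE mf f0.
have mfst (A : set T) : measurable A -> measurable (fst @^-1` A : set (T * R)).
  by move=> mA; rewrite -[X in measurable X]setTI; exact: measurable_fst.
rewrite (eq_measure_integral (pushforward below fst)); last first.
  move=> A mA _; transitivity (\int[mu]_(x in A) (1 * (w x)%:E)).
    by apply: eq_integral => x _; rewrite mul1e.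
  rewrite -(integral_hypograph (f := fun=> 1))//.
  rewrite integral_cst ?mul1e//; exact: measurableI (mfst _ mA) _.
rewrite ge0_integral_pushforward//; last by move=> x /[!inE]; exact: f0.
have mfE : measurable_fun (fst @^-1` E) (f \o fst : T * R -> \bar R).
  by apply: (measurable_comp mE _ mf) => //; [move=> _ [z Ez <-]|exact: measurable_funTS].
rewrite (@ge0_negligible_integral _ _ _ below _ (~` hypograph))//.
- rewrite setDE setCK -(integral_hypograph mE mf f0).
  apply: eq_measure_integral => A mA AE.
  transitivity ((mu \x la) (A `&` hypograph)); first by [].
  by rewrite setIidl// => z /AE[].
- exact: measurableC.
- exact: mfst.
- by move=> z /f0.
- transitivity ((mu \x la) (~` hypograph `&` hypograph)); first by [].
  by rewrite setICl measure0.
Qed.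

End Density.

Record pos_diffeo {R : realType} (g h : R -> R) : Prop := PosDiffeo {
  pd_pos : forall t, Rpos t -> Rpos (g t);
  pd_inv_pos : forall t, Rpos t -> Rpos (h t);
  pd_K : forall t, Rpos t -> h (g t) = t;
  pd_invK : forall t, Rpos t -> g (h t) = t;
  pd_incr : forall t u, Rpos t -> Rpos u -> t < u -> g t < g u;
  pd_derivable : forall t, Rpos t -> derivable g t 1;
  pd_derive_cont : forall t, Rpos t -> {for t, continuous (derive1 g)};
  pd_derive_gt0 : forall t, Rpos t -> 0 < derive1 g t }.

Section ChangeOfVariables.
Context {R : realType}.
Local Notation mu := (@lebesgue_measure R).
Variables (g h : R -> R).
Hypothesis gh : pos_diffeo g h.

Lemma RposE (t : R) : Rpos t = is_true (0 < t).
Proof. by rewrite /Rpos /mkset in_itv/= andbT. Qed.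

(** Extending g by the identity makes it possible to characterize Lebesgue measure
    on the whole line. *)
Let gext (t : R) : R := if t \in (Rpos : set R) then g t else t.
Let wext (t : R) : R := if t \in (Rpos : set R) then derive1 g t else 1.

Let gext_pos t : Rpos t -> gext t = g t.
Proof. by move=> t0; rewrite /gext mem_set. Qed.
Let gext_npos t : ~ Rpos t -> gext t = t.
Proof. by move=> t0; rewrite /gext memNset. Qed.
Let wext_pos t : Rpos t -> wext t = derive1 g t.
Proof. by move=> t0; rewrite /wext mem_set. Qed.
Let wext_npos t : ~ Rpos t -> wext t = 1.
Proof. by move=> t0; rewrite /wext memNset. Qed.

Lemma open_Rpos : open (@Rpos R).
Proof. exact: interval_open. Qed.

Lemma nbhs_Rpos (t : R) : Rpos t -> \forall u \near t, Rpos u.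
Proof. by move=> t0; apply: open_nbhs_nbhs; split => //; exact: open_Rpos. Qed.

Lemma within_Rpos_continuous (f : R -> R) :
  {within Rpos, continuous f} <-> forall t, Rpos t -> {for t, continuous f}.
Proof.
rewrite continuous_open_subspace; last exact: open_Rpos.
by split => fc t; [move=> t0; apply: fc; rewrite inE|rewrite inE => /fc].
Qed.

Lemma pd_cont t : Rpos t -> {for t, continuous g}.
Proof.
by move=> t0; apply: differentiable_continuous; exact/derivable1_diffP/(pd_derivable gh).
Qed.

Lemma pd_measurable : measurable_fun Rpos g.
Proof.
apply: subspace_continuous_measurable_fun; first exact: measurable_Rpos.
by apply/within_Rpos_continuous => t; exact: pd_cont.
Qed.

Lemma pd_derive_measurable : measurable_fun Rpos (derive1 g).
Proof.
apply: subspace_continuous_measurable_fun; first exact: measurable_Rpos.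
by apply/within_Rpos_continuous => t; exact: (pd_derive_cont gh).
Qed.

Let wext_ge0 t : 0 <= wext t.
Proof.
have [t0|t0] := pselect (Rpos t); last by rewrite wext_npos.
by rewrite wext_pos// ltW// (pd_derive_gt0 gh).
Qed.

Let measurable_ext (f1 f2 : R -> R) : measurable_fun Rpos f1 ->
  measurable_fun [set: R] f2 ->
  measurable_fun [set: R] (fun t => if t \in (Rpos : set R) then f1 t else f2 t).
Proof.
move=> m1 m2; rewrite -(setUv (@Rpos R)).
apply/(measurable_funU _ measurable_Rpos (measurableC measurable_Rpos)).
split.
- by apply: (eq_measurable_fun f1) => // t /[!inE] t0; rewrite mem_set.
- apply: (eq_measurable_fun f2); last exact: measurable_funTS.
  by move=> t /[!inE] t0; rewrite memNset.
Qed.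

Let gext_meas : measurable_fun [set: R] gext.
Proof. by apply: measurable_ext => //; exact: pd_measurable. Qed.
Let wext_meas : measurable_fun [set: R] wext.
Proof. by apply: measurable_ext => //; exact: pd_derive_measurable. Qed.

Let m : {measure set (measurableTypeR R) -> \bar R} :=
  @measure_function_pushforward__canonical__measure_function_Measure
    _ _ _ (measurableTypeR R) _ (density mu wext_meas wext_ge0) gext gext_meas.

Let mE A : m A = (\int[mu]_(t in gext @^-1` A) (wext t)%:E)%E.
Proof. by []. Qed.

Let m_itv (a b : R) : 0 < a -> a <= b -> m `]a, b]%classic = (b - a)%:E.
Proof.
move=> a0; rewrite le_eqVlt => /predU1P[<-|ab].
  by rewrite set_itvoc0 measure0 subrr.
have b0 : 0 < b by exact: lt_trans ab.
have [ha0 hb0] : 0 < h a /\ 0 < h b.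
  by rewrite -!RposE; split; apply: (pd_inv_pos gh); rewrite RposE.
have mono t u : 0 < t -> 0 < u -> (g t < g u) = (t < u).
  move=> t0 u0; case: (ltgtP t u) => [tu|tu|->]; rewrite ?ltxx//.
  - by apply: (pd_incr gh) => //; rewrite RposE.
  - by apply/negbTE; rewrite -leNgt ltW//; apply: (pd_incr gh) => //; rewrite RposE.
have hab : h a < h b by rewrite -mono// !(pd_invK gh)// RposE.
rewrite mE.
have -> : gext @^-1` `]a, b]%classic = `]h a, h b]%classic.
  apply/seteqP; split => t /=; rewrite !in_itv/=.
    have [t0|t0] := pselect (Rpos t).
      have t0' : 0 < t by rewrite -RposE.
      rewrite gext_pos// -{1}(pd_invK gh (t := a)) ?RposE//.
      by rewrite -{1}(pd_invK gh (t := b)) ?RposE// mono// !leNgt mono.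
    rewrite gext_npos// => /andP[at_ _]; exfalso; apply: t0; rewrite RposE.
    exact: lt_trans at_.
  move=> /andP[h1 h2]; have t0 : 0 < t by exact: lt_trans h1.
  rewrite gext_pos ?RposE// -[X in X < _](pd_invK gh (t := a)) ?RposE//.
  rewrite -[X in _ <= X](pd_invK gh (t := b)) ?RposE// mono// h1/=.
  by rewrite leNgt mono// -leNgt.
have mono_pos t : h a <= t -> Rpos t by rewrite RposE; exact: lt_le_trans.
rewrite integral_itv_obnd_cbnd; last exact/measurable_EFinP/measurable_funTS.
rewrite (@continuous_FTC2 _ wext g (h a) (h b))//.
- by rewrite !(pd_invK gh) ?RposE// EFinB.
- have W t : Rpos t -> {for t, continuous wext}.
    move=> t0; have := pd_derive_cont gh t0.
    rewrite /prop_for /continuous_at (wext_pos t0); apply: cvg_trans; apply: near_eq_cvg.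
    near=> u; suff up : Rpos u by rewrite /wext mem_set.
    by near: u; exact: nbhs_Rpos.
  apply: (@continuous_subspaceW _ _ _ Rpos).
    by move=> t /=; rewrite in_itv/= => /andP[/mono_pos].
  by apply/within_Rpos_continuous.
- split.
  + move=> t; rewrite in_itv/= => /andP[/ltW/mono_pos t0 _].
    exact: (pd_derivable gh).
  + by apply: cvg_at_right_filter; apply: pd_cont; rewrite RposE.
  + by apply: cvg_at_left_filter; apply: pd_cont; rewrite RposE.
- move=> t; rewrite in_itv/= => /andP[/ltW/mono_pos t0 _].
  by rewrite wext_pos.
Unshelve. all: by end_near. Qed.

Let lebesgue_itv (a b : R) : a <= b -> mu `]a, b]%classic = (b - a)%:E.
Proof.
move=> ab; rewrite lebesgue_measure_itv/= lte_fin.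
by move: ab; rewrite le_eqVlt => /predU1P[->|->]; rewrite ?ltxx ?subrr ?EFinB.
Qed.

Let m_npos (a b : R) : b <= 0 -> m `]a, b]%classic = mu `]a, b]%classic.
Proof.
move=> b0; rewrite mE.
have npos t : t <= b -> ~ Rpos t.
  by move=> tb; rewrite RposE; apply/negP; rewrite -leNgt (le_trans tb).
have -> : gext @^-1` `]a, b]%classic = `]a, b]%classic.
  apply/seteqP; split => t /=; rewrite !in_itv/=; last first.
    by move=> /andP[at_ tb]; rewrite gext_npos ?at_//; exact: npos.
  have [t0|t0] := pselect (Rpos t); last by rewrite gext_npos.
  have := pd_pos gh t0; rewrite gext_pos// RposE => gt0 /andP[_ gb].
  by have := lt_le_trans gt0 (le_trans gb b0); rewrite ltxx.
under eq_integral => t.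
  rewrite inE/= in_itv/= => /andP[_ /npos tb]; rewrite wext_npos//.
  over.
by rewrite integral_cst//= mul1e.
Qed.

Let m_pos (b : R) : 0 < b -> m `]0, b]%classic = mu `]0, b]%classic.
Proof.
move=> b0.
pose F n := `]b / n.+1%:R, b]%classic : set R.
have UF : \bigcup_n F n = `]0, b]%classic.
  apply/seteqP; split => t.
    move=> [n _]; rewrite /F /= !in_itv/= => /andP[nt ->]; rewrite andbT.
    by apply: lt_trans nt; rewrite divr_gt0.
  rewrite /= in_itv/= => /andP[t0 tb].
  exists (Num.trunc (b / t)) => //; rewrite /F/= in_itv/= tb andbT.
  by rewrite ltr_pdivrMr// mulrC -ltr_pdivrMr// truncnS_gt.
have ndF : nondecreasing_seq F.
  move=> i j ij; apply/subsetPset => t; rewrite /F /= !in_itv/= => /andP[it ->].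
  rewrite andbT; apply: le_lt_trans it.
  by rewrite ler_pM2l// lef_pV2 ?posrE// ler_nat.
have mF n : measurable (F n) by exact: measurable_itv.
have mU : measurable (\bigcup_n F n) by exact: bigcupT_measurable.
have c1 := @nondecreasing_cvg_mu _ _ _ m F mF mU ndF.
have c2 := @nondecreasing_cvg_mu _ _ _ mu F mF mU ndF.
rewrite -UF; apply: (@cvg_unique _ _ (mu (F n) @[n --> \oo])) => //.
have -> : (fun n => mu (F n)) = (fun n => m (F n)) => //.
apply/funext => n; rewrite /F m_itv ?lebesgue_itv ?divr_gt0//.
- by rewrite ler_pdivrMr// ler_peMr ?ler1n// ltW.
- by rewrite ler_pdivrMr// ler_peMr ?ler1n// ltW.
Qed.

(** By the fundamental theorem of calculus the image under g of the measure with
    density g' gives intervals their length, which determines a measure. *)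
Let m_lebesgue (A : set (measurableTypeR R)) : measurable A -> mu A = m A.
Proof.
apply: lebesgue_measure_unique => _ [[a b] _ <-] /=.
have [ba|ab] := leP b a; first by rewrite set_itv_ge ?measure0// bnd_simp -leNgt.
have [b0|b0] := leP b 0; first by rewrite m_npos.
have [a0|a0] := ltP 0 a.
  by rewrite m_itv ?lebesgue_itv ?(ltW ab).
have -> : `]a, b]%classic = `]a, 0]%classic `|` `]0, b]%classic.
  rewrite -(@itv_bndbnd_setU _ _ _ (BRight (0 : R)))//; rewrite bnd_simp//.
  exact: ltW.
have dis : `]a, (0 : R)]%classic `&` `]0, b]%classic = set0.
  apply/seteqP; split => // t [] /=.
  rewrite !in_itv/= => /andP[_ t0] /andP[t0' _].
  by have := lt_le_trans t0' t0; rewrite ltxx.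
transitivity (m (`]a, 0]%classic `|` `]0, b]%classic)); last by [].
rewrite !measureU//; congr (_ + _)%E; apply/esym; first exact: m_npos.
exact: m_pos.
Qed.

Theorem change_of_variables (F : R -> \bar R) :
  measurable_fun Rpos F -> (forall t, Rpos t -> (0 <= F t)%E) ->
  (\int[mu]_(t in Rpos) (F (g t) * (derive1 g t)%:E) = \int[mu]_(t in Rpos) F t)%E.
Proof.
move=> mF F0.
rewrite [RHS](eq_measure_integral m); last first.
  by move=> A mA _; exact: m_lebesgue.
have preim : gext @^-1` Rpos = Rpos.
  apply/seteqP; split => t /=.
    have [//|t0] := pselect (Rpos t); first by rewrite gext_npos.
  by move=> t0; rewrite /= gext_pos//; exact: (pd_pos gh).
rewrite /m ge0_integral_pushforward//; last 2 first.
- exact: measurable_Rpos.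
- by move=> t /[!inE]; exact: F0.
rewrite preim ge0_integral_density//.
- by apply: eq_integral => t /[!inE] t0; rewrite /= gext_pos// wext_pos.
- exact: measurable_Rpos.
- apply: (measurable_comp measurable_Rpos _ mF).
    by move=> _ [t t0 <-]; rewrite gext_pos//; exact: (pd_pos gh).
  exact: measurable_funTS.
- by move=> t t0; rewrite /= gext_pos//; apply: F0; exact: (pd_pos gh).
Qed.

End ChangeOfVariables.

(** * Multiplication and weighted composition operators *)

Section MulOp.
Context {R : realType} {p : R} (p1 : 1 < p).
Local Notation mu := (@lebesgue_measure R).
Implicit Types (a b f : R -> R[i]).

Let p0 : 0 < p. Proof. exact: lt_trans p1. Qed.

Definition mult_symbol b := cmeasurable b /\ exists M : R, forall t, Rpos t -> normc (b t) <= M.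

Lemma mult_symbol_cb b : continuous_bounded b -> mult_symbol b.
Proof. by move=> cb; split; [exact: cmeasurable_continuous|case: cb]. Qed.

Lemma mult_symbolD a b : mult_symbol a -> mult_symbol b -> mult_symbol (fun t => a t + b t).
Proof.
move=> [ma [M aM]] [mb [N bN]]; split; first exact: cmeasurableD.
by exists (M + N) => t t0; rewrite (le_trans (le_normcD _ _))// lerD ?aM ?bN.
Qed.

Lemma mult_symbolM a b : mult_symbol a -> mult_symbol b -> mult_symbol (fun t => a t * b t).
Proof.
move=> [ma [M aM]] [mb [N bN]]; split; first exact: cmeasurableM.
by exists (M * N) => t t0; rewrite normcM ler_pM ?normc_ge0 ?aM ?bN.
Qed.

Lemma mult_symbol_cst c : mult_symbol (fun=> c).
Proof. by split; [exact: cmeasurable_cst|exists (normc c)]. Qed.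

Lemma toLp_eq_pos f g : f \in Lp_fun p1 -> g \in Lp_fun p1 ->
  (forall t, Rpos t -> f t = g t) -> toLp p1 f = toLp p1 g.
Proof. by move=> fL gL fg; apply/toLp_eq => //; apply: aeW => t t0; exact: fg. Qed.

Lemma mul_Lp b f : mult_symbol b -> f \in Lp_fun p1 -> (fun t => b t * f t) \in Lp_fun p1.
Proof. by move=> [mb [M bM]] fL; exact: (mul_Lp_fun mb bM fL).1. Qed.

Lemma toLp_mul_congr b f g : mult_symbol b -> f \in Lp_fun p1 -> g \in Lp_fun p1 ->
  toLp p1 f = toLp p1 g -> toLp p1 (fun t => b t * f t) = toLp p1 (fun t => b t * g t).
Proof.
move=> bs fL gL /toLp_eq -/(_ fL gL) fg; apply: ae_eq_toLp; rewrite ?mul_Lp//.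
by apply: (@filterS _ _ (ae_filter_ringOfSetsType mu)) fg => t /[apply] ->.
Qed.

Lemma mul_op_toLp b f : mult_symbol b -> f \in Lp_fun p1 ->
  mul_op p1 b (toLp p1 f) = toLp p1 (fun t => b t * f t).
Proof.
move=> bs fL; rewrite toBopE; last first.
  apply/bounded_linear_opP; split.
    move=> c x y; rewrite -[x]toLpK -[y]toLpK -toLpZ ?ofLpP// -toLpD ?rpredZ ?ofLpP//.
    have H z : z \in Lp_fun p1 -> toLp p1 (fun t => b t * ofLp (toLp p1 z) t) =
        toLp p1 (fun t => b t * z t).
      by move=> zL; apply: toLp_mul_congr => //; rewrite ?ofLpP// toLpK.
    rewrite !H ?rpredD ?rpredZ ?ofLpP// -toLpZ ?mul_Lp ?ofLpP//.
    rewrite -toLpD ?rpredZ ?mul_Lp ?ofLpP//; congr toLp; apply/funext => t.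
    by rewrite !fctE mulrDr; congr (_ + _); exact: mulrCA.
  have [mb [M bM]] := bs.
  exists `|M| => x; rewrite -lee_fin EFinM toLp_norm ?mul_Lp ?ofLpP//.
  rewrite -[X in (_ <= _ * `|X|%:E)%E]toLpK toLp_norm ?ofLpP//.
  exact: (mul_Lp_fun mb bM (ofLpP x)).2.
by apply: toLp_mul_congr; rewrite ?ofLpP// toLpK.
Qed.

Lemma toLpP (P : Lp p1 -> Prop) : (forall f, f \in Lp_fun p1 -> P (toLp p1 f)) -> forall x, P x.
Proof. by move=> H x; rewrite -[x]toLpK; apply: H; exact: ofLpP. Qed.

Lemma mul_op_norm_le b x (M : R) : mult_symbol b -> 0 <= M ->
  (forall t, Rpos t -> normc (b t) <= M) -> `|mul_op p1 b x| <= M * `|x|.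
Proof.
move=> bs M0 bM; elim/toLpP: x => f fL; rewrite mul_op_toLp//.
rewrite -lee_fin EFinM !toLp_norm ?mul_Lp//.
by have := (mul_Lp_fun bs.1 bM fL).2; rewrite (ger0_norm M0).
Qed.

Lemma mul_opD a b : mult_symbol a -> mult_symbol b ->
  mul_op p1 (fun t => a t + b t) = mul_op p1 a + mul_op p1 b.
Proof.
move=> sa sb; apply: BopP; elim/toLpP => f fL.
rewrite BopDE !mul_op_toLp//; last exact: mult_symbolD.
rewrite -toLpD ?mul_Lp//; congr toLp; apply/funext => t.
by rewrite mulrDl.
Qed.

Lemma mul_opM a b : mult_symbol a -> mult_symbol b ->
  mul_op p1 (fun t => a t * b t) = mul_op p1 a * mul_op p1 b.
Proof.
move=> sa sb; apply: BopP; elim/toLpP => f fL.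
rewrite BopME !mul_op_toLp ?mul_Lp//; last exact: mult_symbolM.
by congr toLp; apply/funext => t; rewrite mulrA.
Qed.

Lemma eq_mul_op a b : mult_symbol a -> mult_symbol b ->
  (forall t, Rpos t -> a t = b t) -> mul_op p1 a = mul_op p1 b.
Proof.
move=> sa sb ab; apply: BopP; elim/toLpP => f fL; rewrite !mul_op_toLp//.
by apply: toLp_eq_pos; rewrite ?mul_Lp// => t t0; rewrite ab.
Qed.

Lemma mul_op_cst c x : mul_op p1 (fun=> c) x = c *: x.
Proof.
elim/toLpP: x => f fL; rewrite mul_op_toLp//; last exact: mult_symbol_cst.
by rewrite -toLpZ.
Qed.

Lemma mul_op1 : mul_op p1 (fun=> 1) = 1.
Proof. by apply: BopP => x; rewrite mul_op_cst scale1r. Qed.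

Lemma mul_op0 : mul_op p1 (fun=> 0) = 0.
Proof. by apply: BopP => x; rewrite mul_op_cst scale0r. Qed.

End MulOp.

(** The factor makes the composition with g isometric for the p-norm. *)
Definition wcomp {R : realType} (p : R) (g : R -> R) (f : R -> R[i]) : R -> R[i] :=
  fun t => ((derive1 g t) `^ p^-1)%:C * f (g t).

HB.lock Definition comp_op {R : realType} {p : R} (p1 : 1 < p) (g : R -> R) : Bop p1 :=
  toBop (fun x => toLp p1 (wcomp p g (ofLp x))).

Section CompOp.
Context {R : realType} {p : R} (p1 : 1 < p).
Implicit Types (g h : R -> R) (b f : R -> R[i]).

Let p0 : 0 < p. Proof. exact: lt_trans p1. Qed.

Lemma cmeasurable_comp g h f : pos_diffeo g h -> cmeasurable f -> cmeasurable (f \o g).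
Proof.
move=> gh [fr fi]; split.
- apply: (measurable_comp measurable_Rpos _ fr (pd_measurable gh)).
  by move=> _ [t t0 <-]; exact: (pd_pos gh).
- apply: (measurable_comp measurable_Rpos _ fi (pd_measurable gh)).
  by move=> _ [t t0 <-]; exact: (pd_pos gh).
Qed.

Lemma mult_symbol_comp g h b : pos_diffeo g h -> mult_symbol b -> mult_symbol (b \o g).
Proof.
move=> gh [mb [M bM]]; split; first exact: cmeasurable_comp gh mb.
by exists M => t t0; apply: bM; exact: (pd_pos gh).
Qed.

Lemma wcomp_Lp g h f : pos_diffeo g h -> f \in Lp_fun p1 ->
  wcomp p g f \in Lp_fun p1 /\ LpN p (wcomp p g f) = LpN p f.
Proof.
move=> gh /Lp_funP[mf ff].
have mw : cmeasurable (wcomp p g f).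
  apply: cmeasurableM; last exact: cmeasurable_comp gh mf.
  split; last exact: measurable_cst.
  apply: (@measurableT_comp _ _ _ _ _ _ (@powR R ^~ p^-1)) => //.
  exact: pd_derive_measurable gh.
have N : LpN p (wcomp p g f) = LpN p f.
  rewrite (LpNE f p0) (LpNE (wcomp p g f) p0); congr (_ `^ _)%E.
  rewrite -[RHS](change_of_variables gh); last 2 first.
  - exact: measurable_cabs_powR.
  - by move=> t _; rewrite lee_fin powR_ge0.
  apply: eq_integral => t /[!inE] t0; rewrite -EFinM; congr EFin.
  have d0 := pd_derive_gt0 gh t0.
  rewrite /cabs /wcomp normcM normc_realE ger0_norm ?powR_ge0//.
  by rewrite powRM ?powR_ge0 ?normc_ge0// -powRrM mulVf ?gt_eqF// powRr1 ?ltW// mulrC.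
by split => //; apply/Lp_funP; rewrite N.
Qed.

Lemma toLp_wcomp_congr g h f1 f2 : pos_diffeo g h ->
  f1 \in Lp_fun p1 -> f2 \in Lp_fun p1 -> toLp p1 f1 = toLp p1 f2 ->
  toLp p1 (wcomp p g f1) = toLp p1 (wcomp p g f2).
Proof.
move=> gh f1L f2L f12; apply/eqP; rewrite -subr_eq0 -normr_eq0; apply/eqP.
have [w1 _] := wcomp_Lp gh f1L; have [w2 _] := wcomp_Lp gh f2L.
rewrite -scaleN1r -toLpZ// -toLpD ?rpredZ//.
have -> : wcomp p g f1 + (-1) *: wcomp p g f2 = wcomp p g (f1 + (-1) *: f2).
  apply/funext => t; rewrite !fctE /wcomp mulrDr; congr (_ + _).
  exact: (mulrCA (-1)).
have dL : f1 + (-1) *: f2 \in Lp_fun p1 by rewrite rpredD ?rpredZ.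
apply: EFin_inj; have [wL wN] := wcomp_Lp gh dL.
rewrite (toLp_norm wL) wN -(toLp_norm dL) toLpD ?rpredZ// toLpZ// scaleN1r.
by rewrite f12 subrr normr0.
Qed.

Lemma comp_op_toLp g h f : pos_diffeo g h -> f \in Lp_fun p1 ->
  comp_op p1 g (toLp p1 f) = toLp p1 (wcomp p g f).
Proof.
move=> gh fL.
have W z : z \in Lp_fun p1 -> wcomp p g z \in Lp_fun p1 by move=> zL; case: (wcomp_Lp gh zL).
rewrite comp_op.unlock toBopE; last first.
  apply/bounded_linear_opP; split.
    move=> c x y; rewrite -[x]toLpK -[y]toLpK -toLpZ ?ofLpP// -toLpD ?rpredZ ?ofLpP//.
    have H z : z \in Lp_fun p1 -> toLp p1 (wcomp p g (ofLp (toLp p1 z))) =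
        toLp p1 (wcomp p g z).
      by move=> zL; apply: (toLp_wcomp_congr gh) => //; rewrite ?ofLpP// toLpK.
    rewrite !H ?rpredD ?rpredZ ?ofLpP// -toLpZ ?W ?ofLpP//.
    rewrite -toLpD ?rpredZ ?W ?ofLpP//; congr toLp; apply/funext => t.
    by rewrite !fctE /wcomp mulrDr; congr (_ + _); exact: mulrCA.
  exists 1 => x; rewrite mul1r -lee_fin toLp_norm ?W ?ofLpP//.
  rewrite -[X in (_ <= `|X|%:E)%E]toLpK toLp_norm ?ofLpP//.
  by rewrite (wcomp_Lp gh (ofLpP x)).2.
by apply: (toLp_wcomp_congr gh); rewrite ?ofLpP// toLpK.
Qed.

Lemma comp_op_norm g h x : pos_diffeo g h -> `|comp_op p1 g x| = `|x|.
Proof.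
move=> gh; elim/(@toLpP _ _ p1): x => f fL; rewrite (comp_op_toLp gh)//.
by apply: EFin_inj; have [wL wN] := wcomp_Lp gh fL; rewrite !toLp_norm.
Qed.

Lemma comp_op_mul g h b : pos_diffeo g h -> mult_symbol b ->
  comp_op p1 g * mul_op p1 b = mul_op p1 (b \o g) * comp_op p1 g.
Proof.
move=> gh bs; apply: BopP; elim/(@toLpP _ _ p1) => f fL; rewrite !BopME.
rewrite mul_op_toLp// (comp_op_toLp gh)//; last exact: mul_Lp.
rewrite (comp_op_toLp gh)// mul_op_toLp.
- by congr toLp; apply/funext => t; rewrite /wcomp mulrCA.
- exact: mult_symbol_comp gh bs.
- by case: (wcomp_Lp gh fL).
Qed.

Lemma pd_derive_inv g h t : pos_diffeo g h -> pos_diffeo h g -> Rpos t ->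
  derive1 h (g t) * derive1 g t = 1.
Proof.
move=> gh hg t0; have gt0 := pd_pos gh t0.
rewrite -derive1_comp; [|exact: (pd_derivable gh)|exact: (pd_derivable hg)].
rewrite derive1E (near_eq_derive (g := id)) ?derive_id//.
by near=> u; rewrite /= (pd_K gh)//; near: u; exact: nbhs_Rpos.
Unshelve. all: by end_near. Qed.

Lemma comp_opK g h : pos_diffeo g h -> pos_diffeo h g -> comp_op p1 g * comp_op p1 h = 1.
Proof.
move=> gh hg; apply: BopP; elim/(@toLpP _ _ p1) => f fL; rewrite BopME Bop1E.
have [wL _] := wcomp_Lp hg fL; have [wwL _] := wcomp_Lp gh wL.
move: (comp_op p1 h (toLp p1 f)) (comp_op_toLp hg fL) => y ->.
move: (comp_op p1 g _) (comp_op_toLp gh wL) => y' ->.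
apply: (toLp_eq_pos wwL fL) => t t0.
rewrite /wcomp mulrA -rmorphM/= -powRM ?(pd_K gh)//; last 2 first.
- exact/ltW/(pd_derive_gt0 gh).
- exact/ltW/(pd_derive_gt0 hg)/(pd_pos gh).
by rewrite mulrC (mulrC (derive1 g t)) (pd_derive_inv gh hg)// powR1 mulr1.
Qed.

End CompOp.

(** * Orbits of the shift *)

Section Orbits.
Context {R : realType}.
Implicit Types (g h : R -> R) (k l : int).

Definition orbit_map g h k : R -> R :=
  match k with Posz n => iter n g | Negz n => iter n.+1 h end.

Variables (g h : R -> R).
Hypotheses (gh : pos_diffeo g h) (hg : pos_diffeo h g).
Local Notation al := (orbit_map g h).

Lemma orbit_map_pos k t : Rpos t -> Rpos (al k t).
Proof.
move=> t0; case: k => n /=; first by elim: n => //= n; exact: (pd_pos gh).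
by apply: (pd_pos hg); elim: n => //= n; exact: (pd_pos hg).
Qed.

Lemma orbit_mapS k t : Rpos t -> al (k + 1) t = g (al k t).
Proof.
move=> t0; case: k => n; first by rewrite -PoszD addn1.
have n0 m : Rpos (iter m h t) by elim: m => //= m; exact: (pd_pos hg).
case: n => [|n]; first by rewrite /= (pd_invK gh).
rewrite (_ : Negz n.+1 + 1 = Negz n); last by lia.
by rewrite [in RHS]/= (pd_invK gh)// -/(iter n.+1 h t).
Qed.

Lemma orbit_mapP k t : Rpos t -> al (k - 1) t = h (al k t).
Proof.
by move=> t0; rewrite -{2}(subrK 1 k) orbit_mapS// (pd_K gh)//; exact: orbit_map_pos.
Qed.

Lemma orbit_mapD k l t : Rpos t -> al (k + l) t = al k (al l t).
Proof.
move=> t0; have l0 := orbit_map_pos l t0.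
elim/int_rec: k => [|n IHn|n IHn]; first by rewrite add0r.
- by rewrite -addn1 PoszD -addrA (addrC 1) addrA !orbit_mapS// IHn.
- rewrite -addn1 PoszD opprD -!addrA (addrC (-1)) addrA !orbit_mapP// IHn//.
Qed.

Lemma orbit_mapK k t : Rpos t -> al (- k) (al k t) = t.
Proof. by move=> t0; rewrite -orbit_mapD// addNr. Qed.

Lemma orbit_mapNK k t : Rpos t -> al k (al (- k) t) = t.
Proof. by move=> t0; rewrite -orbit_mapD// addrN. Qed.

Lemma orbit_map_cont k t : Rpos t -> {for t, continuous (al k)}.
Proof.
move=> t0; elim/int_rec: k => [|n IHn|n IHn]; first by move=> A; rewrite nbhs_simpl.
- exact: (continuous_comp IHn (pd_cont gh (orbit_map_pos n t0))).
- have nS : - n.+1%:Z = - n%:Z - 1 by lia.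
  have e : {near t, (h \o al (- n%:Z)) =1 al (- n.+1%:Z)}.
    near=> u; rewrite nS orbit_mapP//; near: u.
    exact: nbhs_Rpos.
  rewrite /prop_for /continuous_at {2}nS orbit_mapP//.
  apply: cvg_trans (continuous_comp IHn (pd_cont hg (orbit_map_pos (- n%:Z) t0))).
  exact: near_eq_cvg.
Unshelve. all: by end_near. Qed.

(** An increasing map moves the points of an orbit in one direction, that of the
    first step. *)
Lemma orbit_map_free : (forall t, Rpos t -> g t != t) ->
  forall k t, Rpos t -> al k t = t -> k = 0.
Proof.
move=> gfree.
have pos n t : Rpos t -> iter n.+1 g t <> t.
  move=> t0; have ipos m : Rpos (iter m g t) by elim: m => //= m; exact: (pd_pos gh).
  have [gt|gt|/eqP] := ltgtP (g t) t; last by rewrite (negbTE (gfree _ t0)).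
    suff : iter n.+1 g t < t by move=> + e; rewrite e ltxx.
    elim: n => //= n IHn; apply: lt_trans gt; exact: (pd_incr gh (ipos n.+1) t0 IHn).
  suff : t < iter n.+1 g t by move=> + e; rewrite e ltxx.
  elim: n => //= n IHn; apply: (lt_trans gt); exact: (pd_incr gh t0 (ipos n.+1) IHn).
move=> [[|n]|n] t t0 //; first by move=> /pos -/(_ t0).
move=> e; have := @orbit_mapNK n.+1 t t0; rewrite -NegzE e => /pos.
by move=> /(_ t0).
Qed.

End Orbits.

Section OrbitOperators.
Context {R : realType} {p : R} (p1 : 1 < p).
Variables (g h : R -> R).
Hypotheses (gh : pos_diffeo g h) (hg : pos_diffeo h g).
Local Notation al := (orbit_map g h).
Local Notation U := (comp_op p1 g).

Lemma comp_op_unit : U \is a GRing.unit.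
Proof. by apply/Bop_unitP; exists (comp_op p1 h); rewrite !comp_opK. Qed.

Lemma comp_opV : U^-1 = comp_op p1 h.
Proof. by apply: (mulrI comp_op_unit); rewrite divrr ?comp_op_unit// comp_opK. Qed.

Lemma mult_symbol_orbit b k : mult_symbol b -> mult_symbol (b \o al k).
Proof.
move=> bs; case: k => n /=.
  elim: n b bs => [//|n IHn] b bs.
  exact: (IHn (b \o g) (mult_symbol_comp gh bs)).
elim: n b bs => [|n IHn] b bs; first exact: mult_symbol_comp hg bs.
exact: (IHn (b \o h) (mult_symbol_comp hg bs)).
Qed.

(** This commutation rule is the only way in which the coefficients and the shift
    interact. *)
Lemma comp_opXz_mul k b : mult_symbol b -> U ^ k * mul_op p1 b = mul_op p1 (b \o al k) * U ^ k.
Proof.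
move=> bs; have uU := comp_op_unit.
elim/int_rec: k b bs => [|n IHn|n IHn] b bs.
- by rewrite expr0z mul1r mulr1.
- have -> : U ^ n.+1 = U ^ n * U by rewrite -exprSr.
  rewrite -mulrA (comp_op_mul _ gh)// !mulrA IHn; last exact: mult_symbol_comp gh bs.
  by congr (mul_op _ _ * _ * _); apply/funext => t /=; rewrite -iterSr.
- have -> : U ^ (- n.+1%:Z) = U ^ (- n%:Z) * comp_op p1 h.
    by rewrite -comp_opV -exprN1 -exprzDr// -[n.+1]addn1 PoszD opprD.
  rewrite -mulrA (comp_op_mul _ hg)// !mulrA IHn; last exact: mult_symbol_comp hg bs.
  congr (mul_op _ _ * _ * _); apply/funext => t.
  by case: n {IHn}.
Qed.

Lemma comp_opXz_norm k x : `|(U ^ k) x| = `|x|.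
Proof.
have uU := comp_op_unit.
elim/int_rec: k x => [|n IHn|n IHn] x; first by rewrite expr0z Bop1E.
- have -> : U ^ n.+1 = U ^ n * U by rewrite -exprSr.
  by rewrite BopME IHn (comp_op_norm _ gh).
- have -> : U ^ (- n.+1%:Z) = U ^ (- n%:Z) * comp_op p1 h.
    by rewrite -comp_opV -exprN1 -exprzDr// -[n.+1]addn1 PoszD opprD.
  by rewrite BopME IHn (comp_op_norm _ hg).
Qed.

End OrbitOperators.

Section ShiftDiffeo.
Context {R : realType}.
Variable alpha : \bar R -> \bar R.
Hypothesis alphaP : SOS alpha.
Local Notation g := (fin_shift alpha).
Local Notation h := (fin_shift (shift_inv alpha)).

Lemma Rpos_sub_closure (t : R) : Rpos t -> Rpos_closure t%:E.
Proof. by rewrite RposE /Rpos_closure /= in_itv/= leey lee_fin andbT => /ltW. Qed.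

Let homeo : orientation_preserving_homeo alpha. Proof. by case: alphaP. Qed.
Let alpha_bij : set_bij Rpos_closure Rpos_closure alpha. Proof. by case: homeo. Qed.
Let g_bij : set_bij Rpos Rpos g. Proof. by case: alphaP => _ _ []. Qed.

Let g_pos t : Rpos t -> Rpos (g t).
Proof. by case: g_bij => fg _ _; exact: fg. Qed.

Lemma fin_shiftE t : Rpos t -> alpha t%:E = (g t)%:E.
Proof.
by move=> /g_pos; rewrite RposE /fin_shift; case: (alpha t%:E) => //=; rewrite ltxx.
Qed.

Lemma shift_invK x : Rpos_closure x -> shift_inv alpha (alpha x) = x.
Proof.
move=> xA; have [_ inj_a _] := alpha_bij.
by apply: pinvKV => //; rewrite inE.
Qed.

Lemma fin_shift_inv_pos t : Rpos t -> Rpos (h t).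
Proof.
move=> t0; have [_ _ /(_ _ t0)[u u0 <-]] := g_bij.
by rewrite /fin_shift -fin_shiftE// shift_invK//; exact: Rpos_sub_closure.
Qed.

Lemma fin_shiftK t : Rpos t -> h (g t) = t.
Proof.
by move=> t0; rewrite {1}/fin_shift -fin_shiftE// shift_invK//; exact: Rpos_sub_closure.
Qed.

Lemma fin_shift_invK t : Rpos t -> g (h t) = t.
Proof.
move=> t0; have [_ _ /(_ _ t0)[u u0 <-]] := g_bij.
by rewrite fin_shiftK.
Qed.

Lemma shift_inv_finE t : Rpos t -> shift_inv alpha t%:E = (h t)%:E.
Proof.
move=> t0; have := fin_shiftE (fin_shift_inv_pos t0); rewrite fin_shift_invK// => <-.
by rewrite shift_invK//; exact/Rpos_sub_closure/fin_shift_inv_pos.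
Qed.

Let g_incr t u : Rpos t -> Rpos u -> t < u -> g t < g u.
Proof.
move=> t0 u0 tu; have [_ _ _ incr] := homeo.
have := incr t%:E u%:E (Rpos_sub_closure t0) (Rpos_sub_closure u0).
by rewrite !fin_shiftE// !lte_fin => /(_ tu).
Qed.

Let h_incr t u : Rpos t -> Rpos u -> t < u -> h t < h u.
Proof.
move=> t0 u0 tu; rewrite ltNge; apply/negP; rewrite le_eqVlt => /predU1P[e|].
  by move: tu; rewrite -(fin_shift_invK t0) -(fin_shift_invK u0) e ltxx.
move=> /(g_incr (fin_shift_inv_pos u0) (fin_shift_inv_pos t0)).
by rewrite !fin_shift_invK// => /(lt_trans tu); rewrite ltxx.
Qed.

Let C1_at (f : R -> R) : C1_Rpos f -> forall t, Rpos t -> {for t, continuous (derive1 f)}.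
Proof. by case=> _ /within_Rpos_continuous. Qed.

(** The derivatives of mutually inverse functions are mutually inverse, hence
    nonzero; monotonicity decides their sign. *)
Let derive_gt0 (f k : R -> R) : (forall t, Rpos t -> Rpos (f t)) ->
  (forall t, Rpos t -> k (f t) = t) ->
  (forall t u, Rpos t -> Rpos u -> t < u -> f t < f u) ->
  (forall t, Rpos t -> derivable f t 1) -> (forall t, Rpos t -> derivable k t 1) ->
  forall t, Rpos t -> 0 < derive1 f t.
Proof.
move=> f_pos fK f_incr df dk t t0.
have int_pos : (@Rpos R)° = Rpos by apply/interior_id/open_Rpos.
rewrite lt_neqAle eq_sym; apply/andP; split; last first.
  apply: (@incr_derive1_ge0 _ _ Rpos).
  - by move=> u; rewrite int_pos inE; exact: df.
  - by move=> u v; rewrite !inE; exact: f_incr.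
  - by rewrite int_pos.
have : derive1 k (f t) * derive1 f t = 1.
  rewrite -derive1_comp; [|exact: df|exact/dk/f_pos].
  rewrite derive1E (near_eq_derive (g := id)) ?derive_id//.
  by near=> u; rewrite /= fK//; near: u; exact: nbhs_Rpos.
by apply: contra_eq_neq => ->; rewrite mulr0 eq_sym oner_eq0.
Unshelve. all: by end_near. Qed.

Theorem SOS_diffeo : pos_diffeo g h.
Proof.
have [_ _ [_ cg ch] _ _] := alphaP.
split => //; [exact: fin_shift_inv_pos|exact: fin_shiftK|exact: fin_shift_invK| | |].
- by case: cg.
- exact: C1_at.
- apply: (derive_gt0 (k := h)) => //; first exact: fin_shiftK.
  + by case: cg.
  + by case: ch.
Qed.

Theorem SOS_inv_diffeo : pos_diffeo h g.
Proof.
have [_ _ [_ cg ch] _ _] := alphaP.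
split => //; [exact: fin_shift_inv_pos|exact: fin_shift_invK|exact: fin_shiftK| | |].
- by case: ch.
- exact: C1_at.
- apply: (derive_gt0 (k := g)) => //; [exact: fin_shift_inv_pos|exact: fin_shift_invK| | ].
  + by case: ch.
  + by case: cg.
Qed.

Lemma SOS_free t : Rpos t -> g t != t.
Proof.
move=> t0; apply/eqP => gt; have [_ fixP _ _ _] := alphaP.
have /fixP[] : Rpos_closure t%:E by exact: Rpos_sub_closure.
rewrite fin_shiftE// gt => /(_ erefl)[[e]|//] _.
by move: t0; rewrite RposE e ltxx.
Qed.

Lemma shift_iterE k t : Rpos t -> shift_iter alpha k t%:E = (orbit_map g h k t)%:E.
Proof.
move=> t0; case: k => n /=.
  elim: n => //= n ->; rewrite fin_shiftE//.
  exact: (orbit_map_pos SOS_diffeo SOS_inv_diffeo n t0).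
rewrite -/(iter n.+1 _ _) -/(iter n.+1 _ _); elim: n.+1 => //= m ->.
rewrite shift_inv_finE//; case: m => //= m.
exact: (orbit_map_pos SOS_diffeo SOS_inv_diffeo (Negz m) t0).
Qed.

(** Integrating the bounds on the derivative from the fixed point 0. *)
Lemma SOS_ratio : exists2 L : R, 0 < L &
  forall t, Rpos t -> L^-1 * t <= g t /\ g t <= L * t.
Proof.
have [_ _ _ [M logM] _] := alphaP; exists (expR M); first exact: expR_gt0.
have dg := pd_derive_gt0 SOS_diffeo.
have bd t : Rpos t -> expR (- M) <= derive1 g t <= expR M.
  move=> t0; have := logM t t0; rewrite ler_norml => /andP[h1 h2].
  by rewrite -{1}(lnK (dg t t0)) -{2}(lnK (dg t t0)) !ler_expR h1 h2.
have mvt s t : Rpos s -> s < t -> expR (- M) * (t - s) <= g t - g s <= expR M * (t - s).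
  move=> s0 st; have pos u : s <= u -> Rpos u by rewrite !RposE in s0 *; exact: lt_le_trans.
  have [||c] := @MVT R g (derive1 g) s t st.
  - move=> c; rewrite in_itv/= => /andP[/ltW/pos c0 _].
    by rewrite derive1E; apply: DeriveDef => //; exact: (pd_derivable SOS_diffeo).
  - apply: (@continuous_subspaceW _ _ _ Rpos).
      by move=> u /=; rewrite in_itv/= => /andP[/pos].
    by apply/within_Rpos_continuous => u; exact: (pd_cont SOS_diffeo).
  rewrite in_itv/= => /andP[sc ct] ->.
  have /andP[h1 h2] := bd c (pos _ (ltW sc)).
  by apply/andP; split; rewrite ler_wpM2r ?subr_ge0// ltW.
move=> t t0; have t0' : 0 < t by rewrite -RposE.
have gt0 : 0 < g t by rewrite -RposE; exact: g_pos.
split; apply/ler_addgt0Pl => e e0.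
  rewrite -expRN.
  (* the fixed point 0 is replaced by a positive point close to it *)
  pose s := Num.min (t / 2) (e / expR (- M)).
  have s0 : 0 < s by rewrite lt_min !divr_gt0// expR_gt0.
  have st : s < t by rewrite gt_min; apply/orP; left; rewrite ltr_pdivrMr// ltr_pMr// ltr1n.
  have se : expR (- M) * s <= e.
    by rewrite mulrC -ler_pdivlMr ?expR_gt0// ge_min lexx orbT.
  have sP : Rpos s by rewrite RposE.
  have /andP[h1 _] := mvt s t sP st.
  have gs0 : 0 < g s by rewrite -RposE; exact: g_pos.
  move: h1 se; rewrite mulrBr; lra.
pose y := Num.min (g t / 2) e.
have y0 : 0 < y by rewrite lt_min divr_gt0.
have yt : y < g t by rewrite gt_min; apply/orP; left; rewrite ltr_pdivrMr// ltr_pMr// ltr1n.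
have yP : Rpos y by rewrite RposE.
have sP := fin_shift_inv_pos yP.
have st : h y < t by rewrite -[X in _ < X]fin_shiftK//; apply: h_incr => //; exact: g_pos.
have /andP[_ h2] := mvt _ _ sP st; rewrite fin_shift_invK// mulrBr in h2.
have ye : y <= e by rewrite ge_min lexx orbT.
have : 0 <= expR M * h y by rewrite mulr_ge0 ?expR_ge0// ltW// -RposE.
by move: h2 ye; lra.
Qed.

Lemma orbit_ratio k : exists2 L : R, 0 < L &
  forall t, Rpos t -> L^-1 * t <= orbit_map g h k t /\ orbit_map g h k t <= L * t.
Proof.
have [L L0 LP] := SOS_ratio.
have LhP t : Rpos t -> L^-1 * t <= h t /\ h t <= L * t.
  move=> t0; have [h1 h2] := LP _ (fin_shift_inv_pos t0).
  move: h1 h2; rewrite !fin_shift_invK// => h1 h2.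
  by rewrite ler_pdivrMl// h2 -ler_pdivrMl.
have iterP (f : R -> R) : (forall t, Rpos t -> Rpos (f t)) ->
    (forall t, Rpos t -> L^-1 * t <= f t /\ f t <= L * t) -> forall n t, Rpos t ->
    Rpos (iter n f t) /\ (L ^+ n)^-1 * t <= iter n f t /\ iter n f t <= L ^+ n * t.
  move=> f_pos fP; elim=> [|n IHn] t t0 /=; first by rewrite expr0 invr1 !mul1r.
  have [n0 [h1 h2]] := IHn t t0; have [h3 h4] := fP _ n0.
  split; first exact: f_pos.
  rewrite exprS invfM -!mulrA; split.
  - by apply: le_trans h3; rewrite ler_pM2l ?invr_gt0.
  - by apply: (le_trans h4); rewrite ler_pM2l.
case: k => n.
  exists (L ^+ n) => [|t t0]; first exact: exprn_gt0.
  by have [_] := iterP _ g_pos LP n t t0.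
exists (L ^+ n.+1) => [|t t0]; first exact: exprn_gt0.
by have [_] := iterP _ fin_shift_inv_pos LhP n.+1 t t0.
Qed.

End ShiftDiffeo.

Lemma shift_opE {R : realType} {p : R} (p1 : 1 < p) (alpha : \bar R -> \bar R) :
  shift_op p1 alpha = comp_op p1 (fin_shift alpha).
Proof. by rewrite comp_op.unlock. Qed.

(** * Slowly oscillating functions *)

Section SlowOscillationClosure.
Context {R : realType}.
Implicit Types (f g : R -> R[i]).

Definition bounded_on_Rpos f := exists M : R, forall t, Rpos t -> normc (f t) <= M.

Definition osc_small f (e r : R) :=
  forall t u, r <= t <= 2 * r -> r <= u <= 2 * r -> normc (f t - f u) <= e.

(** The two limits of the oscillation in a single condition: the oscillation over
    [r, 2r] is small as soon as r or its inverse is small. *)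
Definition epsilon_SO f :=
  [/\ forall t, Rpos t -> forall e, 0 < e -> \forall u \near t, normc (f u - f t) <= e,
      bounded_on_Rpos f &
      forall e, 0 < e -> exists2 d, 0 < d &
        forall r, 0 < r -> (r < d) || (d^-1 < r) -> osc_small f e r].

Lemma normc_le_ReIm (z : R[i]) : normc z <= `|complex.Re z| + `|complex.Im z|.
Proof.
case: z => a b /=; rewrite -[leRHS]ger0_norm ?addr_ge0// -sqrtr_sqr ler_wsqrtr//.
by rewrite sqrrD !real_normK ?num_real// addrAC lerDl mulrn_wge0// mulr_ge0.
Qed.

Lemma continuous_boundedP f : continuous_bounded f <->
  (forall t, Rpos t -> forall e, 0 < e -> \forall u \near t, normc (f u - f t) <= e)
  /\ bounded_on_Rpos f.
Proof.
split=> [[/within_Rpos_continuous cr /within_Rpos_continuous ci bf]|[cf bf]].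
  split => // t t0 e e0; have e20 : 0 < e / 2 by rewrite divr_gt0.
  have /cvgrPdist_le /(_ _ e20) hr := cr t t0.
  have /cvgrPdist_le /(_ _ e20) hi := ci t t0.
  apply: filterS2 hr hi => u hr hi; apply: (le_trans (normc_le_ReIm _)).
  rewrite !raddfB/= (splitr e) lerD// distrC//.
split => //; apply/within_Rpos_continuous => t t0; apply/cvgrPdist_le => e e0.
- have := cf t t0 e e0; apply: filterS => u; rewrite distrC.
  by apply: le_trans; rewrite -raddfB; exact: Re_le_normc.
- have := cf t t0 e e0; apply: filterS => u; rewrite distrC.
  by apply: le_trans; rewrite -raddfB; exact: Im_le_normc.
Qed.

Lemma oscillationP f (e r : R) : bounded_on_Rpos f -> 0 < r ->
  oscillation f r <= e <-> osc_small f e r.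
Proof.
move=> [M fM] r0; rewrite /oscillation; set A := [set _ | _ in _ & _ in _].
have pos t : r <= t -> Rpos t by rewrite RposE; exact: lt_le_trans.
have r2 : r <= 2 * r by rewrite mulr_natl mulr2n lerDl ltW.
have supA : has_sup A.
  split; first by exists (normc (f r - f r)); exists r; rewrite /= ?in_itv/= ?lexx//; exists r; rewrite /= ?in_itv/= ?lexx.
  exists (M + M) => _ [t /= ht] [u /= hu] <-; rewrite !in_itv/= in ht hu.
  case/andP: ht => /pos ht _; case/andP: hu => /pos hu _.
  by apply: (le_trans (le_normcD _ _)); rewrite normcN lerD ?fM.
split=> [le t u ht hu|small].
  apply: le_trans le; apply: ub_le_sup; first exact: supA.2.
  by exists t; rewrite /= ?in_itv//; exists u; rewrite /= ?in_itv.
apply: ge_sup; first exact: supA.1.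
by move=> _ [t /= ht] [u /= hu] <-; rewrite !in_itv/= in ht hu; exact: small.
Qed.

Lemma oscillation_ge0 f r : bounded_on_Rpos f -> 0 < r -> 0 <= oscillation f r.
Proof.
move=> bf r0; have /(oscillationP _ bf r0) := lexx (oscillation f r).
have r2 : r <= r <= 2 * r by rewrite lexx/= mulr_natl mulr2n lerDl ltW.
by move=> /(_ r r r2 r2); apply: le_trans; exact: normc_ge0.
Qed.

Theorem SOP f : SO f <-> epsilon_SO f.
Proof.
split=> [[/continuous_boundedP[cf bf] o0 oy]|[cf bf h]].
  split => // e e0.
  have /cvgrPdist_le /(_ e e0) /nbhs_ballP[/= d1 d10 h1] := o0.
  have /cvgrPdist_le /(_ e e0) [M [_ h2]] := oy.
  pose M' := Num.max M 1; have M'0 : 0 < M' by rewrite lt_max ltr01 orbT.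
  exists (Num.min d1 M'^-1); first by rewrite lt_min d10 invr_gt0.
  move=> r r0 /orP[rd|rd]; apply/(oscillationP _ bf r0).
    have := h1 r; rewrite /ball/= sub0r normrN gtr0_norm// sub0r normrN.
    rewrite ger0_norm ?oscillation_ge0//; apply => //.
    by apply: (lt_le_trans rd); rewrite ge_min lexx.
  have := h2 r; rewrite sub0r normrN ger0_norm ?oscillation_ge0//; apply.
  apply: le_lt_trans rd; rewrite -[X in X <= _]invrK.
  have [M0|M0] := leP M 0.
    apply: (@le_trans _ _ 0); first by rewrite invrK.
    by rewrite invr_ge0 le_min (ltW d10) invr_ge0 ltW.
  rewrite lef_pV2 ?posrE ?invr_gt0//; last by rewrite lt_min d10 invr_gt0.
  rewrite ge_min; apply/orP; right; rewrite lef_pV2 ?posrE//.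
  by rewrite le_max lexx.
split; first exact/continuous_boundedP.
- apply/cvgrPdist_le => e e0; have [d d0 hd] := h e e0.
  near=> r; have r0 : 0 < r by near: r; exact: nbhs_right_gt.
  rewrite sub0r normrN ger0_norm ?oscillation_ge0//.
  apply/(oscillationP _ bf r0)/hd => //; apply/orP; left.
  by near: r; exact: nbhs_right_lt.
- apply/cvgrPdist_le => e e0; have [d d0 hd] := h e e0.
  near=> r; have r0 : 0 < r by near: r; apply: nbhs_pinfty_gt; rewrite num_real.
  rewrite sub0r normrN ger0_norm ?oscillation_ge0//.
  apply/(oscillationP _ bf r0)/hd => //; apply/orP; right.
  by near: r; apply: nbhs_pinfty_gt; rewrite num_real.
Unshelve. all: by end_near. Qed.

Lemma SO_bounded f : SO f -> bounded_on_Rpos f.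
Proof. by case=> -[]. Qed.

(** Continuity and slow oscillation only depend on increments, so that an estimate of
    the increments of h by those of f and g transfers both. *)
Lemma SO_lipschitz2 (f g h : R -> R[i]) (K : R) : 0 < K -> SO f -> SO g ->
  bounded_on_Rpos h ->
  (forall t u, Rpos t -> Rpos u ->
    normc (h t - h u) <= K * (normc (f t - f u) + normc (g t - g u))) -> SO h.
Proof.
move=> K0 /SOP[cf _ of_] /SOP[cg _ og] bh lip; apply/SOP; split => //.
- move=> t t0 e e0; have e'0 : 0 < e / K / 2 by rewrite !divr_gt0.
  near=> u.
  have u0 : Rpos u by near: u; exact: nbhs_Rpos.
  have h1 : normc (f u - f t) <= e / K / 2 by near: u; exact: cf.
  have h2 : normc (g u - g t) <= e / K / 2 by near: u; exact: cg.
  apply: (le_trans (lip _ _ u0 t0)).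
  by rewrite mulrC -ler_pdivlMr// (splitr (e / K)) lerD.
- move=> e e0; have e'0 : 0 < e / K / 2 by rewrite !divr_gt0.
  have [d1 d10 h1] := of_ _ e'0; have [d2 d20 h2] := og _ e'0.
  exists (Num.min d1 d2); first by rewrite lt_min d10.
  move=> r r0 rd t u ht hu.
  have pos v : r <= v <= 2 * r -> Rpos v.
    by rewrite RposE => /andP[+ _]; exact: lt_le_trans.
  apply: (le_trans (lip _ _ (pos _ ht) (pos _ hu))).
  rewrite mulrC -ler_pdivlMr// (splitr (e / K)) lerD//.
  + apply: (h1 r) => //; case/orP: rd => rd; apply/orP; [left|right].
      by apply: (lt_le_trans rd); rewrite ge_min lexx.
    apply: le_lt_trans rd; rewrite lef_pV2 ?posrE ?lt_min ?d10//.
    by rewrite ge_min lexx.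
  + apply: (h2 r) => //; case/orP: rd => rd; apply/orP; [left|right].
      by apply: (lt_le_trans rd); rewrite ge_min lexx orbT.
    apply: le_lt_trans rd; rewrite lef_pV2 ?posrE ?lt_min ?d10//.
    by rewrite ge_min lexx orbT.
Unshelve. all: by end_near. Qed.

Lemma SO_cst (c : R[i]) : SO (fun=> c).
Proof.
apply/SOP; split.
- by move=> t _ e e0; near=> u; rewrite subrr normc0 ltW.
- by exists (normc c).
- by move=> e e0; exists 1 => // r _ _ t u _ _; rewrite subrr normc0 ltW.
Unshelve. all: by end_near. Qed.

Lemma SO_add f g : SO f -> SO g -> SO (fun t => f t + g t).
Proof.
move=> sf sg; apply: (SO_lipschitz2 ltr01 sf sg).
  have [M fM] := SO_bounded sf; have [N gN] := SO_bounded sg.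
  by exists (M + N) => t t0; rewrite (le_trans (le_normcD _ _))// lerD ?fM ?gN.
by move=> t u _ _; rewrite mul1r opprD addrACA; exact: le_normcD.
Qed.

Lemma SO_mul f g : SO f -> SO g -> SO (fun t => f t * g t).
Proof.
move=> sf sg; have [M fM] := SO_bounded sf; have [N gN] := SO_bounded sg.
have K0 : 0 < `|M| + `|N| + 1 by rewrite ltr_wpDl// addr_ge0.
apply: (SO_lipschitz2 K0 sf sg).
  by exists (M * N) => t t0; rewrite normcM ler_pM ?normc_ge0 ?fM ?gN.
move=> t u t0 u0.
have -> : f t * g t - f u * g u = f t * (g t - g u) + (f t - f u) * g u by ring.
apply: (le_trans (le_normcD _ _)); rewrite !normcM.
have h1 : normc (f t) <= `|M| + `|N| + 1.
  have := fM t t0; have := ler_norm M; have := normr_ge0 N; lra.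
have h2 : normc (g u) <= `|M| + `|N| + 1.
  have := gN u u0; have := ler_norm N; have := normr_ge0 M; lra.
rewrite mulrDr addrC lerD//.
- by rewrite mulrC ler_wpM2r ?normc_ge0.
- by rewrite ler_wpM2r ?normc_ge0.
Qed.

Lemma normc_conjc (z : R[i]) : normc (conjc z) = normc z.
Proof. by case: z => a b /=; rewrite sqrrN. Qed.

Lemma SO_conj f : SO f -> SO (fun t => conjc (f t)).
Proof.
move=> sf; apply: (SO_lipschitz2 ltr01 sf (SO_cst 0)).
  by have [M fM] := SO_bounded sf; exists M => t t0; rewrite normc_conjc fM.
move=> t u _ _; rewrite mul1r subrr normc0 addr0.
by rewrite -rmorphB/= normc_conjc.
Qed.

Lemma SO_uniform_limit f : (forall e, 0 < e -> exists2 g, SO g &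
  forall t, Rpos t -> normc (f t - g t) <= e) -> SO f.
Proof.
have tri (g : R -> R[i]) t u : normc (f t - f u) <=
    normc (f t - g t) + normc (f u - g u) + normc (g t - g u).
  have -> : f t - f u = (f t - g t) + (- (f u - g u)) + (g t - g u) by ring.
  apply: (le_trans (le_normcD _ _)); rewrite lerD2r.
  by apply: (le_trans (le_normcD _ _)); rewrite normcN.
move=> H; apply/SOP; split.
- move=> t t0 e e0; have e30 : 0 < e / 3 by rewrite divr_gt0.
  have [g /SOP[cg _ _] fg] := H _ e30.
  near=> u.
  have u0 : Rpos u by near: u; exact: nbhs_Rpos.
  have gu : normc (g u - g t) <= e / 3 by near: u; exact: cg.
  apply: (le_trans (tri g _ _)); have := fg u u0; have := fg t t0; move: gu; lra.
- have [g /SO_bounded[M gM] fg] := H _ ltr01.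
  exists (1 + M) => t t0; rewrite -(subrK (g t) (f t)).
  by apply: (le_trans (le_normcD _ _)); rewrite lerD ?fg ?gM.
- move=> e e0; have e30 : 0 < e / 3 by rewrite divr_gt0.
  have [g /SOP[_ _ og] fg] := H _ e30; have [d d0 hd] := og _ e30.
  exists d => // r r0 rd t u ht hu.
  have pos v : r <= v <= 2 * r -> Rpos v.
    by rewrite RposE => /andP[+ _]; exact: lt_le_trans.
  apply: (le_trans (tri g _ _)); have := fg t (pos _ ht); have := fg u (pos _ hu).
  have := hd r r0 rd t u ht hu; lra.
Unshelve. all: by end_near. Qed.

(** The interval [a, 2^n a] is covered by n consecutive intervals [r, 2r]. *)
Lemma osc_small_chain f (e a : R) n : 0 <= e -> 0 < a ->
  (forall j, (j < n)%N -> osc_small f e (2 ^+ j * a)) ->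
  forall v, a <= v <= 2 ^+ n * a -> normc (f v - f a) <= n%:R * e.
Proof.
move=> e0 a0; elim: n => [|n IHn] small v.
  by rewrite expr0 mul1r -eq_le => /eqP ->; rewrite subrr normc0 mul0r.
move=> /andP[av vb]; have [vn|vn] := leP v (2 ^+ n * a).
  apply: (@le_trans _ _ (n%:R * e)); last by rewrite ler_wpM2r// ler_nat.
  by apply: IHn => [j jn|]; [apply: small; exact: ltnW|rewrite av].
rewrite -(subrK (f (2 ^+ n * a)) (f v)) -addrA.
have -> : n.+1%:R * e = e + n%:R * e by rewrite -natr1; ring.
apply: (le_trans (le_normcD _ _)); apply: lerD.
  apply: (small n) => //.
  - by rewrite ltW//= mulrA -exprS.
  - by rewrite lexx/= mulr_natl mulr2n lerDl mulr_ge0 ?exprn_ge0// ltW.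
apply: IHn => [j jn|]; first by apply: small; exact: ltnW.
by rewrite lexx andbT ler_peMl ?exprn_ege1 ?ler1n// ltW.
Qed.

(** If m t is comparable with t, then m maps [r, 2r] into an interval covered by a
    fixed number of intervals of the form [r', 2r']. *)
Lemma SO_comp f (m : R -> R) (L : R) : SO f -> 0 < L ->
  (forall t, Rpos t -> Rpos (m t)) -> (forall t, Rpos t -> {for t, continuous m}) ->
  (forall t, Rpos t -> L^-1 * t <= m t /\ m t <= L * t) -> SO (f \o m).
Proof.
move=> /SOP[cf [M fM] of_] L0 m_pos m_cont mL; apply/SOP; split.
- by move=> t t0 e e0; have := cf _ (m_pos t t0) e e0; move/(m_cont t t0).
- by exists M => t t0; apply: fM; exact: m_pos.
move=> e e0.
have [n nP] : exists n, 2 * L * L <= 2 ^+ n :> R.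
  exists (Num.trunc (2 * L * L)).+1; apply/ltW/(lt_le_trans (truncnS_gt _)).
  by rewrite -natrX ler_nat ltnW// ltn_expl.
have n10 : 0 < n.*2.+1%:R :> R by rewrite ltr0n.
have e'0 : 0 < e / n.*2.+1%:R by rewrite divr_gt0.
have [d d0 hd] := of_ _ e'0.
have p20 : 0 < 2 ^+ n :> R by rewrite exprn_gt0.
exists (Num.min (d * L / 2 ^+ n) (d / L)); first by rewrite lt_min !divr_gt0// mulr_gt0.
move=> r r0 rd t u ht hu; pose a := L^-1 * r.
have a0 : 0 < a by rewrite mulr_gt0 ?invr_gt0.
have small j : (j < n)%N -> osc_small f (e / n.*2.+1%:R) (2 ^+ j * a).
  move=> jn; apply: hd; first by rewrite mulr_gt0 ?exprn_gt0.
  case/orP: rd => rd; apply/orP; [left|right].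
    apply: (@le_lt_trans _ _ (2 ^+ n * a)).
      by rewrite ler_pM2r// ler_weXn2l ?ler1n// ltnW.
    have : r < d * L / 2 ^+ n by apply: (lt_le_trans rd); rewrite ge_min lexx.
    by rewrite ltr_pdivlMr// /a mulrCA ltr_pdivrMl// mulrC (mulrC L).
  apply: (@lt_le_trans _ _ a); last by rewrite ler_peMl ?exprn_ege1 ?ler1n// ltW.
  rewrite /a ltr_pdivlMl//; apply: le_lt_trans rd.
  rewrite -[L * _]invrK lef_pV2 ?posrE ?invr_gt0 ?mulr_gt0 ?invr_gt0//.
    by rewrite invf_div ge_min lexx orbT.
  by rewrite lt_min !divr_gt0// mulr_gt0.
have chain v : r <= v <= 2 * r -> normc (f (m v) - f a) <= n%:R * (e / n.*2.+1%:R).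
  move=> /andP[rv vr]; apply: (osc_small_chain (ltW e'0) a0 small).
  have v0 : Rpos v by rewrite RposE; exact: lt_le_trans rv.
  have [h1 h2] := mL v v0; apply/andP; split.
    by apply: le_trans h1; rewrite ler_pM2l ?invr_gt0.
  apply: (le_trans h2); rewrite /a mulrA.
  apply: (@le_trans _ _ (L * (2 * r))); first by rewrite ler_pM2l.
  by rewrite mulrA ler_pM2r// mulrC ler_pdivlMr.
rewrite /= -(subrK (f a) (f (m t))) -addrA.
apply: (le_trans (le_normcD _ _)); rewrite -(normcN (_ - f (m u))) opprB.
apply: (le_trans (lerD (chain _ ht) (chain _ hu))).
rewrite -mulrDl -natrD addnn mulrCA ger_pMr// ler_pdivrMr// mul1r.
by rewrite ler_nat.
Qed.

End SlowOscillationClosure.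

(** * Coefficient families *)

Section CbNorm.
Context {R : realType}.
Implicit Types (f g : R -> R[i]).

Let Rpos1 : @Rpos R 1. Proof. by rewrite RposE. Qed.

Let nonempty f : [set normc (f t) | t in Rpos] !=set0.
Proof. by exists (normc (f 1)), 1. Qed.

Lemma cb_norm_le f (M : R) : (forall t, Rpos t -> normc (f t) <= M) -> cb_norm f <= M.
Proof. by move=> fM; apply: ge_sup; [exact: nonempty|move=> _ [t t0 <-]; exact: fM]. Qed.

Lemma le_cb_norm f t : bounded_on_Rpos f -> Rpos t -> normc (f t) <= cb_norm f.
Proof.
move=> [M fM] t0; apply: ub_le_sup; last by exists t.
by exists M => _ [u u0 <-]; exact: fM.
Qed.

Lemma cb_norm_ge0 f : 0 <= cb_norm f.
Proof.
have [bf|nbf] := pselect (bounded_on_Rpos f).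
  exact: le_trans (normc_ge0 (f 1)) (le_cb_norm bf Rpos1).
rewrite /cb_norm sup_out// => -[_ [M MP]]; apply: nbf; exists M => t t0.
by apply: MP; exists t.
Qed.

Lemma cb_normD f g : bounded_on_Rpos f -> bounded_on_Rpos g ->
  cb_norm (fun t => f t + g t) <= cb_norm f + cb_norm g.
Proof.
move=> bf bg; apply: cb_norm_le => t t0; apply: (le_trans (le_normcD _ _)).
by rewrite lerD ?le_cb_norm.
Qed.

Lemma cb_normB f g : bounded_on_Rpos f -> bounded_on_Rpos g ->
  cb_norm (fun t => f t - g t) <= cb_norm f + cb_norm g.
Proof.
move=> bf bg; apply: cb_norm_le => t t0; apply: (le_trans (le_normcD _ _)).
by rewrite normcN lerD ?le_cb_norm.
Qed.

Lemma cb_normM_comp f g (m : R -> R) : bounded_on_Rpos f -> bounded_on_Rpos g ->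
  (forall t, Rpos t -> Rpos (m t)) ->
  cb_norm (fun t => f t * g (m t)) <= cb_norm f * cb_norm g.
Proof.
move=> bf bg mP; apply: cb_norm_le => t t0; rewrite normcM.
by rewrite ler_pM ?normc_ge0//; apply: le_cb_norm => //; exact: mP.
Qed.

Lemma bounded_sub f g : bounded_on_Rpos f -> bounded_on_Rpos g ->
  bounded_on_Rpos (fun t => f t - g t).
Proof.
move=> [M fM] [N gN]; exists (M + N) => t t0; apply: (le_trans (le_normcD _ _)).
by rewrite normcN lerD ?fM ?gN.
Qed.

Lemma SO_sub f g : SO f -> SO g -> SO (fun t => f t - g t).
Proof.
move=> sf sg.
rewrite (_ : (fun t => f t - g t) = (fun t => f t + (-1) * g t)).
  exact: SO_add sf (SO_mul (SO_cst (-1)) sg).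
by apply/funext => t; rewrite mulN1r.
Qed.

Lemma SO_symbol f : SO f -> mult_symbol f.
Proof. by case=> cb _ _; exact: mult_symbol_cb. Qed.

End CbNorm.

Section Families.
Context {R : realType}.
Local Notation fam := (int -> R -> R[i]).
Implicit Types (a b : fam).

(** The elements of the algebra are handled as coefficient families: the norm is
    defined on families, and several families could a priori have the same sum. *)
Definition Wnorm b : \bar R := (\esum_(k in [set: int]) (cb_norm (b k))%:E)%E.

Definition inW b := (forall k, SO (b k)) /\ (Wnorm b < +oo)%E.

Definition fsub a b : fam := fun k t => a k t - b k t.
Definition fadd a b : fam := fun k t => a k t + b k t.

Lemma Wnorm_ge0 b : (0 <= Wnorm b)%E.
Proof. by apply: esum_ge0 => k _; rewrite lee_fin cb_norm_ge0. Qed.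

Lemma Wnorm_fin b : inW b -> Wnorm b \is a fin_num.
Proof. by case=> _ h; rewrite ge0_fin_numE ?Wnorm_ge0. Qed.

Lemma inW_bounded b k : inW b -> bounded_on_Rpos (b k).
Proof. by case=> sb _; exact: SO_bounded. Qed.

Lemma WnormD a b : inW a -> inW b -> (Wnorm (fadd a b) <= Wnorm a + Wnorm b)%E.
Proof.
move=> aW bW; rewrite /Wnorm -esumD; last 2 first.
- by move=> k _; rewrite lee_fin cb_norm_ge0.
- by move=> k _; rewrite lee_fin cb_norm_ge0.
by apply: le_esum => k _; rewrite -EFinD lee_fin cb_normD//; exact: inW_bounded.
Qed.

Lemma WnormB a b : inW a -> inW b -> (Wnorm (fsub a b) <= Wnorm a + Wnorm b)%E.
Proof.
move=> aW bW; rewrite /Wnorm -esumD; last 2 first.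
- by move=> k _; rewrite lee_fin cb_norm_ge0.
- by move=> k _; rewrite lee_fin cb_norm_ge0.
by apply: le_esum => k _; rewrite -EFinD lee_fin cb_normB//; exact: inW_bounded.
Qed.

Lemma inW_add a b : inW a -> inW b -> inW (fadd a b).
Proof.
move=> aW bW; split; first by move=> k; apply: SO_add; [case: aW|case: bW].
by apply: (le_lt_trans (WnormD aW bW)); rewrite lte_add_pinfty//; [case: aW|case: bW].
Qed.

Lemma inW_sub a b : inW a -> inW b -> inW (fsub a b).
Proof.
move=> aW bW; split; first by move=> k; apply: SO_sub; [case: aW|case: bW].
by apply: (le_lt_trans (WnormB aW bW)); rewrite lte_add_pinfty//; [case: aW|case: bW].
Qed.

Lemma le_Wnorm a (M : \bar R) : (forall s : seq int, uniq s -> ((\sum_(k <- s) cb_norm (a k))%:E <= M)%E) ->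
  (Wnorm a <= M)%E.
Proof.
move=> aM; apply: ge_ereal_sup => _ [A [finA _] <-].
by rewrite fsbig_finite//= sumEFin; exact/aM/fset_uniq.
Qed.

Lemma Wnorm_ge a (s : seq int) : inW a -> uniq s ->
  ((\sum_(k <- s) cb_norm (a k))%:E <= Wnorm a)%E.
Proof.
move=> [_ aW] us; have := sum_uniq_le (fun k => cb_norm_ge0 (a k)) aW us.
by rewrite -lee_fin (total_sumE (fun k => cb_norm_ge0 (a k)) aW).
Qed.

Lemma Wnorm_coord a k : inW a -> ((cb_norm (a k))%:E <= Wnorm a)%E.
Proof. by move=> aW; have := @Wnorm_ge a [:: k] aW isT; rewrite big_seq1. Qed.

(** The intervals [u n - eps n, u n + eps n] meet pairwise, so the supremum of their
    left ends belongs to all of them. *)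
Lemma nested_limit (u eps : nat -> R) :
  (forall n m, (n <= m)%N -> `|u m - u n| <= eps n) ->
  exists l, forall n, `|l - u n| <= eps n.
Proof.
move=> uP; have eps0 n : 0 <= eps n by have := uP n n (leqnn n); rewrite subrr normr0.
have cross n m : u n - eps n <= u m + eps m.
  have [nm|/ltnW mn] := leqP n m.
    have := uP _ _ nm; have := eps0 m; rewrite ler_norml; lra.
  have := uP _ _ mn; have := eps0 n; rewrite ler_norml; lra.
pose A := [set u n - eps n | n in [set: nat]].
have ubA m : ubound A (u m + eps m) by move=> _ [n _ <-]; exact: cross.
have A0 : A !=set0 by exists (u 0%N - eps 0%N), 0%N.
exists (sup A) => n; rewrite ler_norml.
have : sup A <= u n + eps n by apply: ge_sup.
have : u n - eps n <= sup A by apply: ub_le_sup; [exists (u 0%N + eps 0%N)|exists n].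
lra.
Qed.

(** The coefficients converge uniformly on Rpos, and the bounds on norms pass to the
    limit because they only involve finite sums. *)
Theorem W_complete (f : nat -> fam) (eps : nat -> R) :
  (forall n, inW (f n)) ->
  (forall n m, (n <= m)%N -> (Wnorm (fsub (f m) (f n)) <= (eps n)%:E)%E) ->
  (forall e, 0 < e -> exists n, forall m, (n <= m)%N -> eps m <= e) ->
  exists b, inW b /\ forall n, (Wnorm (fsub b (f n)) <= (eps n)%:E)%E.
Proof.
move=> fW fC eps_small.
have dW n m : inW (fsub (f m) (f n)) by exact: inW_sub.
have pw n m k t : (n <= m)%N -> Rpos t -> normc (f m k t - f n k t) <= eps n.
  move=> nm t0; apply: (le_trans (le_cb_norm (inW_bounded k (dW n m)) t0)).
  by rewrite -lee_fin; apply: le_trans (fC n m nm); exact: Wnorm_coord.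
have ex k t : exists z : R[i], Rpos t -> forall n, normc (z - f n k t) <= 2 * eps n.
  have [t0|nt0] := pselect (Rpos t); last by exists 0.
  have [x xP] : exists x, forall n, `|x - complex.Re (f n k t)| <= eps n.
    apply: nested_limit => n m nm; rewrite -raddfB.
    exact: le_trans (Re_le_normc _) (pw n m k t nm t0).
  have [y yP] : exists y, forall n, `|y - complex.Im (f n k t)| <= eps n.
    apply: nested_limit => n m nm; rewrite -raddfB.
    exact: le_trans (Im_le_normc _) (pw n m k t nm t0).
  exists (x +i* y) => _ n; apply: (le_trans (normc_le_ReIm _)).
  rewrite !raddfB/= mulr_natl mulr2n; exact: lerD.
pose b k t := xget 0 [set z : R[i] | Rpos t -> forall n, normc (z - f n k t) <= 2 * eps n].
have bP k t : Rpos t -> forall n, normc (b k t - f n k t) <= 2 * eps n.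
  by rewrite /b; have := xgetPex 0 (ex k t).
have bSO k : SO (b k).
  apply: SO_uniform_limit => e e0.
  have e20 : 0 < e / 2 by rewrite divr_gt0.
  have [n nP] := eps_small _ e20.
  exists (f n k); first by case: (fW n).
  by move=> t t0; apply: (le_trans (bP k t t0 n)); rewrite mulrC -ler_pdivlMr// nP.
have main n : (Wnorm (fsub b (f n)) <= (eps n)%:E)%E.
  apply: le_Wnorm => s us; rewrite lee_fin; apply/ler_addgt0Pl => e e0.
  have d0 : 0 < e / (2 * (size s).+1%:R) by rewrite divr_gt0 ?mulr_gt0 ?ltr0n.
  have [m1 /(_ (maxn m1 n) (leq_maxl _ _)) m0P] := eps_small _ d0.
  set m0 := maxn m1 n in m0P.
  have bd m k : bounded_on_Rpos (fsub b (f m) k).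
    by apply: bounded_sub; [exact: SO_bounded|exact: inW_bounded].
  have far k : cb_norm (fsub b (f m0) k) <= e / (size s).+1%:R.
    apply: cb_norm_le => t t0; apply: (le_trans (bP k t t0 m0)).
    rewrite mulrC -ler_pdivlMr//; apply: (le_trans m0P).
    by rewrite -[leRHS]mulrA -invfM [2 * _]mulrC.
  have near_ : \sum_(k <- s) cb_norm (fsub (f m0) (f n) k) <= eps n.
    by rewrite -lee_fin; apply: le_trans (fC n m0 (leq_maxr _ _)); exact: Wnorm_ge.
  apply: (@le_trans _ _ (\sum_(k <- s) (e / (size s).+1%:R + cb_norm (fsub (f m0) (f n) k)))).
    apply: ler_sum => k _.
    apply: (@le_trans _ _ (cb_norm (fsub b (f m0) k) + cb_norm (fsub (f m0) (f n) k))).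
      2: by rewrite lerD2r.
    rewrite (_ : fsub b (f n) k = fun t => fsub b (f m0) k t + fsub (f m0) (f n) k t); last first.
      by apply/funext => t; rewrite /fsub addrA subrK.
    by apply: cb_normD => //; exact/inW_bounded/dW.
  rewrite big_split/=; apply: lerD => //.
  rewrite big_const_seq count_predT iter_addr addr0 -[leLHS]mulr_natr.
  rewrite -mulrA; apply: ler_piMr; first exact: ltW.
  by rewrite mulrC ler_pdivrMr// mul1r ler_nat.
exists b; split => //; split => //.
have bE : b = fadd (fsub b (f 0%N)) (f 0%N).
  by apply/funext => k; apply/funext => t; rewrite /fadd /fsub subrK.
have sW : inW (fsub b (f 0%N)).
  split; first by move=> k; apply: SO_sub => //; case: (fW 0%N).
  exact: le_lt_trans (main 0%N) (ltry _).
by rewrite bE; case: (inW_add sW (fW 0%N)).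
Qed.

End Families.

(** * Operators with absolutely summable coefficients *)

Definition fterm {R : realType} {p : R} (p1 : 1 < p) (g : R -> R)
    (b : int -> R -> R[i]) (k : int) : Bop p1 := mul_op p1 (b k) * comp_op p1 g ^ k.

HB.lock Definition wop {R : realType} {p : R} (p1 : 1 < p) (g : R -> R)
    (b : int -> R -> R[i]) : Bop p1 := xget 0 [set A | is_opsum (fterm p1 g b) A].

Section Exhaustion.
Context {R : realType}.
Implicit Types a : int -> R -> R[i].

Definition ball_seq (n : nat) : seq int := [seq nat_to_int i | i <- iota 0 n].

Lemma ball_seqD n m : exists2 s, uniq s /\ (forall k, k \in s -> k \notin ball_seq n) &
  ball_seq (n + m) = ball_seq n ++ s.
Proof.
have inj_e : injective nat_to_int.
  by have [_ + _] := nat_to_int_bij; move=> H x y; apply: H; rewrite ?inE.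
exists [seq nat_to_int i | i <- iota n m]; last by rewrite /ball_seq iotaD map_cat.
split; first by rewrite map_inj_uniq ?iota_uniq.
move=> _ /mapP[i + ->]; rewrite mem_iota => /andP[ni _].
by apply/negP => /mapP[j + /inj_e ij]; rewrite mem_iota -ij; lia.
Qed.

Lemma ball_seq_uniq n : uniq (ball_seq n).
Proof.
have inj_e : injective nat_to_int.
  by have [_ + _] := nat_to_int_bij; move=> H x y; apply: H; rewrite ?inE.
by rewrite map_inj_uniq ?iota_uniq.
Qed.

Lemma ball_seq_cover (J : seq int) : exists n, forall m k, (n <= m)%N -> k \in J -> k \in ball_seq m.
Proof.
have [_ _ se] := nat_to_int_bij.
have /choice[f fP] : forall k, exists i, nat_to_int i = k.
  by move=> k; have [i _ <-] := se k I; exists i.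
exists (\max_(k <- J) f k).+1 => m k nm kJ; apply/mapP; exists (f k) => //.
rewrite mem_iota add0n/=; apply: leq_trans nm; rewrite ltnS.
exact: leq_bigmax_seq.
Qed.

(** The part of the norm carried by the indices outside of ball_seq n; it bounds the
    errors of all truncations. *)
Definition Wtail a (n : nat) : R := fine (Wnorm a) - \sum_(k <- ball_seq n) cb_norm (a k).

Lemma Wtail_ge0 a n : inW a -> 0 <= Wtail a n.
Proof.
move=> aW; rewrite subr_ge0 -lee_fin fineK ?Wnorm_fin//.
by apply: Wnorm_ge => //; exact: ball_seq_uniq.
Qed.

Lemma Wtail_le a n (s : seq int) : inW a -> uniq s -> (forall k, k \in s -> k \notin ball_seq n) ->
  \sum_(k <- s) cb_norm (a k) <= Wtail a n.
Proof.
move=> aW us sn; rewrite lerBrDl -big_cat -lee_fin fineK ?Wnorm_fin//.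
apply: Wnorm_ge => //; rewrite cat_uniq ball_seq_uniq us andbT/=.
exact/hasPn.
Qed.

Lemma Wtail_small a e : inW a -> 0 < e -> exists n, forall m, (n <= m)%N -> Wtail a m <= e.
Proof.
move=> aW e0; have c0 k := cb_norm_ge0 (a k).
have [J0 J0P] := sum_tail_small c0 aW.2 e0.
have [n nP] := ball_seq_cover J0.
exists n => m nm; rewrite /Wtail lerBlDr -lee_fin fineK ?Wnorm_fin//.
apply: le_Wnorm => s us; rewrite lee_fin.
rewrite (bigID [pred k | k \in ball_seq m])/= addrC; apply: lerD.
  rewrite -big_filter; apply: J0P; first exact: filter_uniq.
  by move=> k; rewrite mem_filter => /andP[+ _]; apply: contra; exact: nP.
apply: (@le_trans _ _ (\sum_(k <- ball_seq m | k \in s) cb_norm (a k))); last first.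
  by rewrite [leRHS](bigID [pred k | k \in s])/= lerDl sumr_ge0.
rewrite -[leLHS]big_filter -[leRHS]big_filter le_eqVlt; apply/orP; left; apply/eqP.
apply: perm_big; apply: uniq_perm; rewrite ?filter_uniq ?ball_seq_uniq//.
by move=> k; rewrite !mem_filter/= andbC.
Qed.

End Exhaustion.

Section FamilyOperators.
Context {R : realType} {p : R} (p1 : 1 < p).
Variables (g h : R -> R).
Hypotheses (gh : pos_diffeo g h) (hg : pos_diffeo h g).
Hypothesis ratio : forall k, exists2 L : R, 0 < L & forall t, Rpos t ->
  L^-1 * t <= orbit_map g h k t /\ orbit_map g h k t <= L * t.
Local Notation al := (orbit_map g h).
Local Notation U := (comp_op p1 g).
Local Notation fam := (int -> R -> R[i]).
Local Notation fterm := (fterm p1 g).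
Local Notation wop := (wop p1 g).
Implicit Types (a b : fam) (K : seq int).

Lemma SO_orbit (f : R -> R[i]) k : SO f -> SO (fun t => f (al k t)).
Proof.
move=> sf; have [L L0 LP] := ratio k.
apply: (SO_comp sf L0) => t t0; [exact: orbit_map_pos|exact: orbit_map_cont|exact: LP].
Qed.

Lemma mul_op_norm (f : R -> R[i]) : SO f -> `|mul_op p1 f| <= cb_norm f.
Proof.
move=> sf; apply: Bop_norm_le; first exact: cb_norm_ge0.
move=> x; apply: mul_op_norm_le => //; [exact: SO_symbol|exact: cb_norm_ge0|].
by move=> t t0; apply: le_cb_norm => //; exact: SO_bounded.
Qed.

Lemma comp_opXz_norm_le k : `|U ^ k| <= 1.
Proof. by apply: Bop_norm_le => // x; rewrite mul1r (comp_opXz_norm gh hg). Qed.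

Lemma fterm_norm b k : SO (b k) -> `|fterm b k| <= cb_norm (b k).
Proof.
move=> sb; apply: (le_trans (Bop_normM _ _)); rewrite -[leRHS]mulr1.
by apply: ler_pM => //; [exact: mul_op_norm|exact: comp_opXz_norm_le].
Qed.

Lemma wopP b : inW b -> is_opsum (fterm b) (wop b).
Proof.
move=> [sb Wb]; rewrite wop.unlock; apply: (xgetPex 0).
exact: (opsum_exists (beta := fun k => cb_norm (b k)) (fun k => fterm_norm (sb k)) Wb).
Qed.

Lemma wop_unique b A : is_opsum (fterm b) A -> wop b = A.
Proof.
move=> bA; have wA : is_opsum (fterm b) (wop b)
  by rewrite wop.unlock; exact: xgetPex (ex_intro _ A bA).
exact: is_opsum_unique wA bA.
Qed.

Lemma wop_norm b : inW b -> (`|wop b|%:E <= Wnorm b)%E.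
Proof.
move=> bW; rewrite -(fineK (Wnorm_fin bW)) lee_fin.
apply: (opsum_norm_le (wopP bW)) => J; apply: (le_trans (ler_norm_sum _ _ _)).
apply: (@le_trans _ _ (\sum_(k <- J) cb_norm (b k))).
  by apply: ler_sum => k _; apply: fterm_norm; case: bW.
by rewrite -lee_fin fineK ?Wnorm_fin//; apply: Wnorm_ge => //; exact: fset_uniq.
Qed.

Lemma fterm_sub a b k : SO (a k) -> SO (b k) -> fterm (fsub a b) k = fterm a k - fterm b k.
Proof.
move=> sa sb; rewrite /fterm -mulrBl; congr (_ * _).
have sab := SO_symbol (SO_sub sa sb).
apply/eqP; rewrite eq_sym subr_eq; apply/eqP; rewrite -mul_opD//; last exact: SO_symbol.
apply: eq_mul_op; first exact: SO_symbol.
  by apply: mult_symbolD => //; exact: SO_symbol.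
by move=> t _; rewrite /fsub subrK.
Qed.

Lemma wop_sub a b : inW a -> inW b -> wop (fsub a b) = wop a - wop b.
Proof.
move=> aW bW; apply: wop_unique; apply: eq_opsum (opsumB (wopP aW) (wopP bW)) => k.
by rewrite fterm_sub//; [case: aW|case: bW].
Qed.

Lemma wop_dist a b : inW a -> inW b -> (`|wop a - wop b|%:E <= Wnorm (fsub a b))%E.
Proof. by move=> aW bW; rewrite -wop_sub//; exact/wop_norm/inW_sub. Qed.

Lemma wop_ext a b : inW a -> inW b -> (forall k t, Rpos t -> a k t = b k t) ->
  wop a = wop b.
Proof.
move=> aW bW ab; apply: wop_unique; apply: eq_opsum (wopP bW) => k.
congr (_ * _); apply: eq_mul_op; [| |by move=> t t0; rewrite ab].
- by apply: SO_symbol; case: bW.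
- by apply: SO_symbol; case: aW.
Qed.

Lemma wop_add a b : inW a -> inW b -> wop (fadd a b) = wop a + wop b.
Proof.
move=> aW bW; apply/eqP; rewrite -subr_eq; apply/eqP.
rewrite -wop_sub//; last exact: inW_add.
apply: wop_ext => //; first exact/inW_sub/bW/inW_add.
by move=> k t _; rewrite /fsub /fadd addrK.
Qed.

Definition fzero : fam := fun _ _ => 0.
Definition fone : fam := fun k _ => if k == 0 then 1 else 0.

Lemma cb_norm0 : cb_norm (fun _ : R => 0 : R[i]) = 0.
Proof.
apply/eqP; rewrite eq_le cb_norm_ge0 andbT; apply: cb_norm_le => t _.
by rewrite normc0.
Qed.

Lemma inW_zero : inW fzero.
Proof.
split; first by move=> k; exact: SO_cst.
by rewrite /Wnorm esum1// => k _; rewrite cb_norm0.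
Qed.

Lemma wop_zero : wop fzero = 0.
Proof.
apply: wop_unique; have := @opsum_fin _ _ p1 (fterm fzero) fset0.
by rewrite big_seq_fset0; apply => k _; rewrite /fterm mul_op0 mul0r.
Qed.

Lemma inW_one : inW fone.
Proof.
split; first by move=> k; rewrite /fone; case: eqP => _; exact: SO_cst.
have -> : Wnorm fone = (\esum_(k in [set: int]) (if k == 0 then cb_norm (fone 0) else 0)%:E)%E.
  apply: eq_esum => k _; rewrite /fone; case: eqP => //= _.
  by rewrite cb_norm0.
have := @lqnorm_delta R 1 0 (cb_norm (fone 0)) ltr01.
rewrite lqnorm1 => e; apply: (@le_lt_trans _ _ (`|cb_norm (fone 0)|)%:E); last exact: ltry.
by rewrite -e; apply: le_esum => k _; rewrite lee_fin ler_norm.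
Qed.

Lemma wop_one : wop fone = 1.
Proof.
have e : fterm fone 0 = 1 by rewrite /fterm /fone /= mul_op1 mul1r expr0z.
apply: wop_unique; have := @opsum_fin _ _ p1 (fterm fone) [fset 0]%fset.
rewrite big_seq_fset1 e; apply => k.
by rewrite inE => /negbTE k0; rewrite /fterm /fone k0 mul_op0 mul0r.
Qed.

Definition shift_term (a : R -> R[i]) (k : int) b : fam :=
  fun n t => a t * b (n - k) (al k t).

(** Coefficients of the product of sum_(k in K) a_k U^k with the operator of b, as
    U^k f = (f o al_k) U^k for a multiplication operator f. *)
Definition conv a K b : fam := fun n t => \sum_(k <- K) a k t * b (n - k) (al k t).

Definition fin_op a K : Bop p1 := \sum_(k <- K) fterm a k.

Lemma SO_shift_term (f : R -> R[i]) k b n : SO f -> inW b -> SO (shift_term f k b n).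
Proof. by move=> sf [sb _]; apply: SO_mul => //; exact: SO_orbit. Qed.

Lemma Wnorm_shift_term (f : R -> R[i]) k b : SO f -> inW b ->
  (Wnorm (shift_term f k b) <= (cb_norm f)%:E * Wnorm b)%E.
Proof.
move=> sf bW; have -> : Wnorm b = (\esum_(n in [set: int]) (cb_norm (b (n - k)))%:E)%E.
  apply: (reindex_esum [set: int] [set: int] (fun i => i - k)).
  split => //; first by move=> i j _ _ /addIr.
  by move=> i _; exists (i + k) => //; rewrite addrK.
rewrite -(ge0_esumZl (cb_norm_ge0 f)); last by move=> i; exact: cb_norm_ge0.
apply: le_esum => n _; rewrite lee_fin.
apply: cb_normM_comp; [exact: SO_bounded|exact: inW_bounded|by move=> t; exact: orbit_map_pos].
Qed.

Lemma inW_shift_term (f : R -> R[i]) k b : SO f -> inW b -> inW (shift_term f k b).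
Proof.
move=> sf bW; split; first by move=> n; exact: SO_shift_term.
apply: (le_lt_trans (Wnorm_shift_term k sf bW)).
by rewrite -(fineK (Wnorm_fin bW)) -EFinM ltry.
Qed.

Lemma wop_shift_term (f : R -> R[i]) k b : SO f -> inW b ->
  wop (shift_term f k b) = mul_op p1 f * U ^ k * wop b.
Proof.
move=> sf bW; have uU := comp_op_unit p1 gh hg.
apply: wop_unique.
have := opsum_mull (mul_op p1 f * U ^ k) (wopP bW).
move/(@opsum_reindex _ _ _ _ _ (fun n => n - k) (fun n => n + k) (fun n => subrK k n)
  (fun n => addrK k n)).
apply: eq_opsum => n /=; rewrite /fterm /shift_term.
have sb : SO (b (n - k)) by case: bW.
have -> : mul_op p1 (fun t => f t * b (n - k) (al k t)) =
    mul_op p1 f * mul_op p1 (b (n - k) \o al k).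
  by apply: mul_opM; [exact: SO_symbol|exact/SO_symbol/SO_orbit].
rewrite -!mulrA; congr (_ * _); rewrite mulrA (comp_opXz_mul p1 gh hg)//; last exact: SO_symbol.
by rewrite -mulrA -exprzDr// (addrC k) subrK.
Qed.

Lemma conv_cons a k K b : conv a (k :: K) b = fadd (shift_term (a k) k b) (conv a K b).
Proof. by apply/funext => n; apply/funext => t; rewrite /conv big_cons. Qed.

Lemma conv_nil a b : conv a [::] b = fzero.
Proof. by apply/funext => n; apply/funext => t; rewrite /conv big_nil. Qed.

Lemma inW_conv a K b : (forall k, SO (a k)) -> inW b -> inW (conv a K b).
Proof.
move=> sa bW; elim: K => [|k K IHK]; first by rewrite conv_nil; exact: inW_zero.
by rewrite conv_cons; apply: inW_add => //; exact: inW_shift_term.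
Qed.

Lemma Wnorm_conv a K b : (forall k, SO (a k)) -> inW b ->
  (Wnorm (conv a K b) <= (\sum_(k <- K) cb_norm (a k))%:E * Wnorm b)%E.
Proof.
move=> sa bW; elim: K => [|k K IHK].
  by rewrite conv_nil big_nil mul0e /Wnorm esum1// => n _; rewrite cb_norm0.
rewrite conv_cons big_cons EFinD ge0_muleDl ?lee_fin ?cb_norm_ge0//; last first.
  by apply: sumr_ge0 => i _; exact: cb_norm_ge0.
apply: le_trans (WnormD _ _) _; [exact: inW_shift_term|exact: inW_conv|].
by apply: leeD => //; exact: Wnorm_shift_term.
Qed.

Lemma wop_conv a K b : (forall k, SO (a k)) -> inW b ->
  wop (conv a K b) = fin_op a K * wop b.
Proof.
move=> sa bW; rewrite /fin_op; elim: K => [|k K IHK].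
  by rewrite conv_nil big_nil mul0r wop_zero.
rewrite conv_cons big_cons mulrDl -IHK wop_add; last 2 first.
- exact: inW_shift_term.
- exact: inW_conv.
by rewrite wop_shift_term.
Qed.

Lemma convB a K b b' : conv a K (fsub b b') = fsub (conv a K b) (conv a K b').
Proof.
apply/funext => n; apply/funext => t; rewrite /conv /fsub -sumrB.
by apply: eq_bigr => k _; rewrite mulrBr.
Qed.

Lemma convD a K b b' : conv a K (fadd b b') = fadd (conv a K b) (conv a K b').
Proof.
apply/funext => n; apply/funext => t; rewrite /conv /fadd -big_split.
by apply: eq_bigr => k _; rewrite mulrDr.
Qed.

Lemma conv_cat a K K' b : conv a (K ++ K') b = fadd (conv a K b) (conv a K' b).
Proof. by apply/funext => n; apply/funext => t; rewrite /conv /fadd big_cat. Qed.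

(** Coefficients of the formal adjoint: conj(b_k o al_(-k)) is the coefficient of
    U^(-k). *)
Definition fadj b : fam := fun k t => conjc (b (- k) (al k t)).

Lemma SO_fadj b k : SO (b (- k)) -> SO (fadj b k).
Proof. by move=> sb; apply: SO_conj; exact: SO_orbit. Qed.

Lemma cb_norm_fadj b k : SO (b (- k)) -> cb_norm (fadj b k) <= cb_norm (b (- k)).
Proof.
move=> sb; apply: cb_norm_le => t t0; rewrite normc_conjc.
by apply: le_cb_norm; [exact: SO_bounded|exact: orbit_map_pos].
Qed.

Lemma Wnorm_opp b : Wnorm b = (\esum_(k in [set: int]) (cb_norm (b (- k)))%:E)%E.
Proof.
apply: (reindex_esum [set: int] [set: int] (fun i : int => - i)
  (fun k => (cb_norm (b k))%:E)).
split; first by [].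
  by move=> i j _ _; exact: oppr_inj.
by move=> i _; exists (- i) => //; rewrite opprK.
Qed.

Lemma Wnorm_fadj b : inW b -> (Wnorm (fadj b) <= Wnorm b)%E.
Proof.
move=> [sb _]; rewrite [leRHS]Wnorm_opp; apply: le_esum => k _.
by rewrite lee_fin cb_norm_fadj.
Qed.

Lemma inW_fadj b : inW b -> inW (fadj b).
Proof.
move=> bW; split; first by move=> k; apply: SO_fadj; case: bW.
by apply: (le_lt_trans (Wnorm_fadj bW)); case: bW.
Qed.

Lemma fadjK b k t : Rpos t -> fadj (fadj b) k t = b k t.
Proof. by move=> t0; rewrite /fadj conjcK opprK orbit_mapK. Qed.

Lemma fadj_sub a b : fadj (fsub a b) = fsub (fadj a) (fadj b).
Proof. by apply/funext => k; apply/funext => t; rewrite /fadj /fsub rmorphB. Qed.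

Definition negs K : seq int := [seq - k | k <- K].

Lemma wop_fadj_shift_term (f : R -> R[i]) k b : SO f -> inW b ->
  wop (fadj (shift_term f k b)) =
  wop (fadj b) * (mul_op p1 (fun t => conjc (f (al (- k) t))) * U ^ (- k)).
Proof.
move=> sf bW; have uU := comp_op_unit p1 gh hg; have adW := inW_fadj bW.
have sfc : SO (fun t => conjc (f t)) by exact: SO_conj.
apply: wop_unique.
have := opsum_mulr (mul_op p1 (fun t => conjc (f (al (- k) t))) * U ^ (- k)) (wopP adW).
move/(@opsum_reindex _ _ _ _ _ (fun n => n + k) (fun n => n - k) (fun n => addrK k n)
  (fun n => subrK k n)).
apply: eq_opsum => n /=; rewrite /fterm.
have -> : mul_op p1 (fun t => conjc (f (al (- k) t))) * U ^ (- k) =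
    U ^ (- k) * mul_op p1 (fun t => conjc (f t)).
  by rewrite (comp_opXz_mul p1 gh hg)//; exact: SO_symbol.
rewrite -!mulrA [U ^ _ * (U ^ _ * _)]mulrA -exprzDr// addrK.
rewrite (comp_opXz_mul p1 gh hg)//; last exact: SO_symbol.
rewrite mulrA; congr (_ * _); rewrite -mul_opM; last 2 first.
- by apply: SO_symbol; case: adW.
- exact/SO_symbol/SO_orbit.
apply: eq_mul_op.
- by apply: mult_symbolM; apply: SO_symbol; [case: adW|exact: SO_orbit].
- exact/SO_symbol/SO_fadj/SO_shift_term.
move=> t t0; rewrite /= /fadj /shift_term rmorphM/= mulrC opprD.
by rewrite [n + k]addrC orbit_mapD.
Qed.

Lemma fadj_conv_cons a k K b :
  fadj (conv a (k :: K) b) = fadd (fadj (shift_term (a k) k b)) (fadj (conv a K b)).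
Proof.
by rewrite conv_cons; apply/funext => n; apply/funext => t; rewrite /fadj /fadd rmorphD.
Qed.

(** The formal adjoint reverses products. *)
Lemma wop_fadj_conv a K b : (forall k, SO (a k)) -> inW b ->
  wop (fadj (conv a K b)) = wop (fadj b) * fin_op (fadj a) (negs K).
Proof.
move=> sa bW; rewrite /fin_op /negs; elim: K => [|k K IHK].
  rewrite conv_nil big_nil mulr0 (_ : fadj fzero = fzero) ?wop_zero//.
  by apply/funext => n; apply/funext => t; rewrite /fadj /fzero conjc0.
rewrite fadj_conv_cons/= big_cons mulrDr -IHK wop_add; last 2 first.
- exact/inW_fadj/inW_shift_term.
- exact/inW_fadj/inW_conv.
rewrite (wop_fadj_shift_term k (sa k) bW).
have -> : (fun t => conjc (a k (al (- k) t))) = fadj a (- k).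
  by apply/funext => t; rewrite /fadj opprK.
by [].
Qed.

Lemma fin_op_dist a n : inW a -> `|wop a - fin_op a (ball_seq n)| <= Wtail a n.
Proof.
move=> aW; have uU := aW.1.
apply/ler_addgt0Pl => e e0; have /is_opsumP/(_ e e0)[J0 J0P] := wopP aW.
have [m mP] := ball_seq_cover J0.
pose N := maxn m n; have nN : (n <= N)%N by exact: leq_maxr.
have [s [us sn] sE] := ball_seqD n (N - n); rewrite subnKC// in sE.
pose J := [fset k | k in ball_seq N]%fset.
have JE (f : int -> Bop p1) : \sum_(k <- J) f k = \sum_(k <- ball_seq N) f k.
  by apply: perm_big; apply: uniq_perm; rewrite ?fset_uniq ?ball_seq_uniq// => k; rewrite !inE.
have /J0P : (J0 `<=` J)%fset.
  by apply/fsubsetP => k kJ; rewrite !inE; apply: mP => //; exact: leq_maxl.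
rewrite JE sE big_cat/= => le.
rewrite (_ : wop a - fin_op a (ball_seq n) = (wop a -
  (\sum_(k <- ball_seq n) fterm a k + \sum_(k <- s) fterm a k)) + \sum_(k <- s) fterm a k).
  apply: (le_trans (ler_normD _ _)); apply: (lerD le).
  apply: (le_trans (ler_norm_sum _ _ _)).
  apply: (@le_trans _ _ (\sum_(k <- s) cb_norm (a k))); last exact: Wtail_le.
  by apply: ler_sum => k _; exact: fterm_norm.
by rewrite opprD addrA subrK.
Qed.

Lemma conv_tail a n m b : inW a -> inW b -> (n <= m)%N ->
  (Wnorm (fsub (conv a (ball_seq m) b) (conv a (ball_seq n) b)) <= (Wtail a n)%:E * Wnorm b)%E.
Proof.
move=> aW bW nm; have [s [us sn]] := ball_seqD n (m - n); rewrite subnKC// => ->.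
rewrite conv_cat (_ : fsub _ _ = conv a s b); last first.
  by apply/funext => k; apply/funext => t; rewrite /fsub /fadd addrC addKr.
apply: (le_trans (Wnorm_conv s aW.1 bW)); apply: lee_wpmul2r; first exact: Wnorm_ge0.
by rewrite lee_fin; exact: Wtail_le.
Qed.

(** The products of truncations of a with b form a Cauchy sequence of families. *)
Theorem wop_mul a b : inW a -> inW b -> exists2 c, inW c & wop c = wop a * wop b.
Proof.
move=> aW bW; pose B := fine (Wnorm b).
have B0 : 0 <= B by rewrite fine_ge0// Wnorm_ge0.
have [||e e0|c [cW cP]] := @W_complete _ (fun n => conv a (ball_seq n) b) (fun n => Wtail a n * B).
- by move=> n; apply: inW_conv => //; case: aW.
- move=> n m nm; rewrite EFinM fineK ?Wnorm_fin//; exact: conv_tail.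
- have B10 : 0 < B + 1 by rewrite ltr_wpDl.
  have [n nP] := Wtail_small aW (divr_gt0 e0 B10); exists n => m /nP le.
  apply: (@le_trans _ _ (Wtail a m * (B + 1))).
    by rewrite ler_wpM2l ?Wtail_ge0// lerDl.
  by rewrite -ler_pdivlMr.
exists c => //; apply/eqP; rewrite -subr_eq0 -normr_le0; apply/ler_addgt0Pl => e e0.
rewrite addr0; have B10 : 0 < B + `|wop b| + 1 by rewrite ltr_wpDl// addr_ge0.
have [n /(_ n (leqnn n)) nP] := Wtail_small aW (divr_gt0 e0 B10).
have fW : inW (conv a (ball_seq n) b) by apply: inW_conv => //; case: aW.
rewrite -(subrK (wop (conv a (ball_seq n) b)) (wop c)) -addrA.
apply: (le_trans (ler_normD _ _)).
apply: (@le_trans _ _ (Wtail a n * B + Wtail a n * `|wop b|)).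
  apply: lerD.
    by rewrite -lee_fin; apply: le_trans (cP n); exact: wop_dist.
  rewrite wop_conv//; last by case: aW.
  rewrite -mulrBl -normrN -mulNr opprB; apply: (le_trans (Bop_normM _ _)).
  by rewrite ler_wpM2r//; exact: fin_op_dist.
rewrite -mulrDr; apply: (@le_trans _ _ (Wtail a n * (B + `|wop b| + 1))).
  by rewrite ler_wpM2l ?Wtail_ge0// lerDl.
by rewrite -ler_pdivlMr.
Qed.

End FamilyOperators.

(** * The action on orbits *)

Section FiniteSums.
Context {R : realType}.

Lemma sum_mem_le (T : eqType) (s r : seq T) (f : T -> R) : uniq s -> uniq r ->
  (forall k, 0 <= f k) -> \sum_(k <- s | k \in r) f k <= \sum_(k <- r) f k.
Proof.
move=> us ur f0; apply: (@le_trans _ _ (\sum_(k <- r | k \in s) f k)); last first.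
  by rewrite [leRHS](bigID [pred k | k \in s])/= lerDl sumr_ge0.
rewrite -[leLHS]big_filter -[leRHS]big_filter le_eqVlt; apply/orP; left; apply/eqP.
apply: perm_big; apply: uniq_perm; rewrite ?filter_uniq//.
by move=> k; rewrite !mem_filter/= andbC.
Qed.

Lemma sum_supp (T : eqType) (V : nmodType) (s r : seq T) (F : T -> V) : uniq s -> uniq r ->
  {subset s <= r} -> (forall k, k \notin s -> F k = 0) ->
  \sum_(k <- r) F k = \sum_(k <- s) F k.
Proof.
move=> us ur sr F0; rewrite (bigID [pred k | k \in s])/= [X in _ + X]big1 ?addr0//.
rewrite -big_filter; apply: perm_big; apply: uniq_perm; rewrite ?filter_uniq//.
by move=> k; rewrite mem_filter/=; case ks : (k \in s) => //; rewrite (sr _ ks).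
Qed.

Lemma conjcM_normc (z : R[i]) : conjc z * z = (normc z ^+ 2)%:C.
Proof.
case: z => x y; rewrite /= sqr_sqrtr ?addr_ge0 ?sqr_ge0//.
by apply/eqP; rewrite eq_complex /= !expr2; apply/andP; split; apply/eqP; ring.
Qed.

Lemma cseq_norm2E (c : int -> R[i]) (J : seq int) : uniq J ->
  (forall k, k \notin J -> c k = 0) ->
  cseq_norm 2 c = (Num.sqrt (\sum_(k <- J) normc (c k) ^+ 2))%:E.
Proof.
move=> uJ cJ; rewrite /cseq_norm (@lqnorm_lnorm _ 2 J)// ?lnorm2E//.
by move=> k /cJ ->; rewrite normc0.
Qed.

Lemma le_cseq_norm2 (c : int -> R[i]) (J : seq int) : uniq J ->
  ((Num.sqrt (\sum_(k <- J) normc (c k) ^+ 2))%:E <= cseq_norm 2 c)%E.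
Proof. by move=> uJ; rewrite -lnorm2E; exact: le_lnorm_lqnorm. Qed.

End FiniteSums.

Section FiberOperators.
Context {R : realType}.
Variables (g h : R -> R).
Hypotheses (gh : pos_diffeo g h) (hg : pos_diffeo h g).
Local Notation al := (orbit_map g h).
Local Notation fam := (int -> R -> R[i]).
Implicit Types (a b : fam) (K : seq int) (c : int -> R[i]).

(** The matrix by which sum_(k in K) a_k U^k acts on the values of functions along
    the orbit of t. *)
Definition fiber a K (t : R) : (int -> R[i]) -> int -> R[i] :=
  shift_sum K id 0 (fun k m => a k (al m t)).

(** The matrix s + T^* T, where T is the fiber; it is again a sum of weighted
    translations, indexed by pairs. *)
Definition fiber_gram a K (s t : R) : (int -> R[i]) -> int -> R[i] :=
  shift_sum [seq (k, l) | k <- K, l <- K] (fun kl => kl.2 - kl.1) s%:C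
    (fun kl m => conjc (a kl.1 (al (m - kl.1) t)) * a kl.2 (al (m - kl.1) t)).

Lemma fiberE a K t c m : fiber a K t c m = \sum_(k <- K) a k (al m t) * c (m + k).
Proof. by rewrite /fiber /shift_sum mul0r add0r. Qed.

Lemma fiber_gramE a K s t c m : fiber_gram a K s t c m =
  s%:C * c m + \sum_(k <- K) conjc (a k (al (m - k) t)) * fiber a K t c (m - k).
Proof.
rewrite /fiber_gram /shift_sum big_allpairs/=; congr (_ + _).
apply: eq_bigr => k _; rewrite fiberE mulr_sumr; apply: eq_bigr => l _.
by rewrite mulrA addrA addrAC.
Qed.

(** The pairing of c with s c + T^* T c is s |c|^2 + |T c|^2, which is at least
    |T c|^2 because s >= 0. *)
Lemma fiber_gram_below a K s t (M : R) : 0 < M -> 0 <= s ->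
  bounded_below 2 M (fiber a K t) -> bounded_below 2 (M ^+ 2) (fiber_gram a K s t).
Proof.
move=> M0 s0 lb c cf; have [J0 cJ0] := cf.
pose J := undup J0; have uJ : uniq J by exact: undup_uniq.
have cJ k : k \notin J -> c k = 0 by rewrite mem_undup; exact: cJ0.
pose d := fiber a K t c; pose y := fiber_gram a K s t c.
pose J' := undup [seq m - k | m <- J, k <- K].
have uJ' : uniq J' by exact: undup_uniq.
have dJ' l : l \notin J' -> d l = 0.
  move=> lJ'; rewrite /d fiberE big_seq big1// => k kK.
  rewrite cJ ?mulr0//; apply: contra lJ' => lkJ.
  by rewrite mem_undup; apply/allpairsP; exists (l + k, k); split => //=; rewrite addrK.
pose X := \sum_(k <- J) normc (c k) ^+ 2.
pose D := \sum_(k <- J') normc (d k) ^+ 2.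
pose Y := \sum_(k <- J) normc (y k) ^+ 2.
have X0 : 0 <= X by apply: sumr_ge0 => k _; rewrite sqr_ge0.
have D0 : 0 <= D by apply: sumr_ge0 => k _; rewrite sqr_ge0.
have Y0 : 0 <= Y by apply: sumr_ge0 => k _; rewrite sqr_ge0.
have XD : X <= M ^+ 2 * D.
  have := lb c cf; rewrite (cseq_norm2E uJ cJ) (cseq_norm2E uJ' dJ') -EFinM lee_fin.
  rewrite -/X -/D => le; rewrite -(sqr_sqrtr X0) -(sqr_sqrtr D0) -exprMn.
  by rewrite lerXn2r ?nnegrE ?sqrtr_ge0 ?mulr_ge0 ?sqrtr_ge0// ltW.
have gram : \sum_(m <- J) conjc (c m) * y m = (s * X + D)%:C.
  rewrite rmorphD rmorphM /X /D !rmorph_sum /=.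
  under eq_bigr => m _ do rewrite /y fiber_gramE mulrDr.
  rewrite big_split/=; congr (_ + _).
    rewrite mulr_sumr; apply: eq_bigr => m _.
    by rewrite mulrCA conjcM_normc.
  transitivity (\sum_(l <- J') conjc (d l) * d l); last first.
    by apply: eq_bigr => l _; rewrite conjcM_normc.
  under eq_bigr do rewrite mulr_sumr.
  rewrite exchange_big/=.
  under [RHS]eq_bigr => l _.
    rewrite {1}/d fiberE rmorph_sum mulr_suml.
    over.
  rewrite [RHS]exchange_big/= big_seq [RHS]big_seq; apply: eq_bigr => k kK.
  pose G l := conjc (a k (al l t) * c (l + k)) * d l.
  transitivity (\sum_(l <- [seq m - k | m <- J]) G l).
    rewrite big_map; apply: eq_bigr => m _; rewrite /G subrK rmorphM/= -/d; ring.
  symmetry; apply: sum_supp.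
  - by rewrite map_inj_uniq// => i j /addIr.
  - exact: uJ'.
  - move=> _ /mapP[m mJ ->]; rewrite mem_undup; apply/allpairsP.
    by exists (m, k).
  - move=> l lJ; rewrite /G cJ ?mulr0 ?conjc0 ?mul0r//.
    by apply: contra lJ => lkJ; apply/mapP; exists (l + k) => //; rewrite addrK.
have cs : s * X + D <= \sum_(m <- J) normc (c m) * normc (y m).
  have sXD : 0 <= s * X + D by rewrite addr_ge0// mulr_ge0.
  rewrite -(ger0_norm sXD) -normc_realE -gram; apply: (le_trans (normc_sum _ _)).
  by apply: ler_sum => m _; rewrite normcM normc_conjc.
have M20 : 0 < M ^+ 2 by rewrite exprn_gt0.
have young : M ^+ 2 * (\sum_(m <- J) normc (c m) * normc (y m)) <=
    2^-1 * X + 2^-1 * (M ^+ 2) ^+ 2 * Y.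
  rewrite /X /Y !mulr_sumr -big_split; apply: ler_sum => m _ /=.
  have := sqr_ge0 (normc (c m) - M ^+ 2 * normc (y m)); rewrite sqrrB exprMn.
  set u := normc (c m); set v := normc (y m); set w := M ^+ 2; nra.
have XY : X <= (M ^+ 2) ^+ 2 * Y.
  have : M ^+ 2 * D <= M ^+ 2 * (\sum_(m <- J) normc (c m) * normc (y m)).
    rewrite ler_pM2l//; apply: le_trans cs; rewrite lerDr mulr_ge0//.
  move: XD young; set w := M ^+ 2; lra.
rewrite (cseq_norm2E uJ cJ); apply: (@le_trans _ _ ((M ^+ 2)%:E * (Num.sqrt Y)%:E)%E).
  rewrite -EFinM lee_fin -/X.
  have -> : M ^+ 2 * Num.sqrt Y = Num.sqrt ((M ^+ 2) ^+ 2 * Y).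
    by rewrite sqrtrM ?sqr_ge0// sqrtr_sqr ger0_norm// ltW.
  by rewrite ler_wsqrtr.
by apply: lee_wpmul2l; [rewrite lee_fin ltW|exact: le_cseq_norm2].
Qed.

Lemma cutoff_gap_sub N (k l : int) :
  cutoff_gap N (k - l) <= cutoff_gap N k + cutoff_gap N l :> R.
Proof.
rewrite /cutoff_gap; have [N0|N0] := posnP N.
  by rewrite N0 invr0 !mulr0 /Num.min; do ?case: ifP; lra.
have N0' : 0 < N%:R :> R by rewrite ltr0n.
have h1 : `|k - l|%:R / N%:R <= `|k|%:R / N%:R + `|l|%:R / N%:R :> R.
  by rewrite -mulrDl ler_pM2r ?invr_gt0// -natrD ler_nat; lia.
have k0 : 0 <= `|k|%:R / N%:R :> R by rewrite divr_ge0.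
have l0 : 0 <= `|l|%:R / N%:R :> R by rewrite divr_ge0.
by move: h1 k0 l0; rewrite /Num.min; do 3 (case: ltP => ?); lra.
Qed.

Lemma gram_gap_sum K (beta : int -> R) N : (forall k, 0 <= beta k) ->
  gap_sum [seq (k, l) | k <- K, l <- K] (fun kl => kl.2 - kl.1)
    (fun kl => beta kl.1 * beta kl.2) N <=
  2 * (\sum_(k <- K) beta k) * gap_sum K id beta N.
Proof.
move=> b0; rewrite /gap_sum big_allpairs/=.
apply: (@le_trans _ _ (\sum_(k <- K) \sum_(l <- K) (beta k * (beta l * cutoff_gap N l) +
   beta k * cutoff_gap N k * beta l))).
  apply: ler_sum => k _; apply: ler_sum => l _.
  apply: (@le_trans _ _ (beta k * beta l * (cutoff_gap N l + cutoff_gap N k))).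
    by rewrite ler_wpM2l ?mulr_ge0// cutoff_gap_sub.
  by rewrite le_eqVlt; apply/orP; left; apply/eqP; ring.
rewrite (eq_bigr (fun k => beta k * (\sum_(l <- K) beta l * cutoff_gap N l) +
   beta k * cutoff_gap N k * (\sum_(l <- K) beta l))); last first.
  by move=> k _; rewrite big_split/= -!mulr_sumr.
rewrite big_split/= -!mulr_suml.
by rewrite le_eqVlt; apply/orP; left; apply/eqP; ring.
Qed.

(** Up to a small remainder the sum runs over a finite set of indices, on which
    cutoff_gap tends to 0 as N grows. *)
Lemma gap_small a e : inW a -> 0 < e -> exists2 N, (0 < N)%N &
  forall n, gap_sum (ball_seq n) id (fun k => cb_norm (a k)) N <= e.
Proof.
move=> aW e0; have c0 k := cb_norm_ge0 (a k).
have e20 : 0 < e / 2 by rewrite divr_gt0.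
have [J0 J0P] := sum_tail_small c0 aW.2 e20.
pose S := \sum_(k <- J0) cb_norm (a k) * `|k|%:R.
have S0 : 0 <= S by apply: sumr_ge0 => k _; rewrite mulr_ge0.
exists (Num.trunc (S / (e / 2))).+1 => // n; set N := _.+1.
have N0 : 0 < N%:R :> R by rewrite ltr0n.
have NP : S / (e / 2) < N%:R by exact: truncnS_gt.
rewrite /gap_sum (bigID [pred k | k \in J0])/= (splitr e); apply: lerD.
  apply: (@le_trans _ _ (\sum_(k <- J0) cb_norm (a k) * (`|k|%:R / N%:R))).
    apply: le_trans; last first.
      apply: (@sum_mem_le _ _ (ball_seq n)); [exact: ball_seq_uniq|exact: fset_uniq|].
      by move=> k; rewrite mulr_ge0// divr_ge0.
    by apply: ler_sum => k _; rewrite ler_wpM2l// ge_min lexx orbT.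
  under eq_bigr do rewrite mulrA.
  by rewrite -mulr_suml ler_pdivrMr// -/S mulrC -ler_pdivrMr// ltW.
apply: (@le_trans _ _ (\sum_(k <- [seq k <- ball_seq n | k \notin J0]) cb_norm (a k))).
  rewrite -big_filter; apply: ler_sum => k _.
  by rewrite ler_piMr// ge_min lexx.
apply: J0P; first by rewrite filter_uniq// ball_seq_uniq.
by move=> k; rewrite mem_filter => /andP[].
Qed.

(** The constant is uniform in the orbit and in the truncation of the coefficients. *)
Definition fibers_below a (q M : R) (n0 : nat) := forall n t, (n0 <= n)%N -> Rpos t ->
  bounded_below q M (fiber a (ball_seq n) t).

Lemma le_coef a k m t : inW a -> Rpos t -> normc (a k (al m t)) <= cb_norm (a k).
Proof.
move=> aW t0; apply: le_cb_norm; first exact: inW_bounded.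
exact: orbit_map_pos.
Qed.

(** An instance of shift_sum_stability with r = 2. *)
Lemma fibers_below_l2 a q M n0 : inW a -> 1 <= q -> 0 <= M -> fibers_below a q M n0 ->
  exists2 M', 0 < M' & fibers_below a 2 M' n0.
Proof.
move=> aW q1 M0 lb; have K0 : 0 < 12 * M + 1 by rewrite ltr_wpDl// mulr_ge0.
have [N N0 NP] := gap_small aW (divr_gt0 ltr01 K0).
exists (6 * N%:R * M + 1); first by rewrite ltr_wpDl// !mulr_ge0.
move=> n t nn t0 c cf; have [J0 cJ0] := cf.
pose J := undup J0; have uJ : uniq J by exact: undup_uniq.
have cJ k : k \notin J -> c k = 0 by rewrite mem_undup; exact: cJ0.
have := @shift_sum_stability R int (ball_seq n) id (fun k => cb_norm (a k))
  (fun k => cb_norm_ge0 (a k)) q 2 M N unit tt (fun=> 0)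
  (fun _ k m => a k (al m t)) (fun=> c) (fun i => normc (c i))
  (fun i => normc (fiber a (ball_seq n) t c i)) q1.
case=> //.
- by rewrite ler1n.
- apply: (@le_trans _ _ (6 * M * (1 / (12 * M + 1)))).
    by rewrite ler_wpM2l ?mulr_ge0.
  by rewrite mulrA mulr1 ler_pdivrMr//; lra.
- by move=> _ k m; exact: le_coef.
- by move=> _; exact: lb.
- apply: le_lt_trans (lqnorm_le_l1 _ uJ _) (ltry _); first by rewrite ler1n.
  by move=> k /cJ ->; rewrite normc0.
move=> W [cW WT]; rewrite /cseq_norm.
apply: (@le_trans _ _ (lqnorm 2 W)).
  by apply: le_lqnorm => // i; rewrite ger0_norm ?normc_ge0// (le_trans (cW tt i))// ler_norm.
apply: (le_trans WT); apply: lee_wpmul2r; first exact: lqnorm_ge0.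
by rewrite lee_fin lerDl.
Qed.

End FiberOperators.

(** * Inversion by continuation *)

Section Continuation.
Context {R : realType}.
Local Notation fam := (int -> R -> R[i]).
Implicit Types (b e : fam).

Definition fscale (s : R) b : fam := fun k t => s%:C * b k t.

Lemma SO_scale (s : R) (f : R -> R[i]) : SO f -> SO (fun t => s%:C * f t).
Proof. by move=> sf; apply: SO_mul => //; exact: SO_cst. Qed.

Lemma Wnorm_scale s b : inW b -> (Wnorm (fscale s b) <= `|s|%:E * Wnorm b)%E.
Proof.
move=> bW; rewrite -(ge0_esumZl (normr_ge0 s)); last by move=> k; exact: cb_norm_ge0.
apply: le_esum => k _; rewrite lee_fin; apply: cb_norm_le => t t0.
by rewrite normcM normc_realE ler_wpM2l// le_cb_norm//; exact: inW_bounded.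
Qed.

Lemma inW_scale s b : inW b -> inW (fscale s b).
Proof.
move=> bW; split; first by move=> k; apply: SO_scale; case: bW.
by apply: (le_lt_trans (Wnorm_scale s bW)); rewrite -(fineK (Wnorm_fin bW)) -EFinM ltry.
Qed.

Definition wnorm b : R := fine (Wnorm b).

Lemma wnormE b : inW b -> (wnorm b)%:E = Wnorm b.
Proof. by move=> bW; rewrite /wnorm fineK// Wnorm_fin. Qed.

Lemma wnorm_ge0 b : 0 <= wnorm b. Proof. by rewrite fine_ge0// Wnorm_ge0. Qed.

Lemma wnormD b e : inW b -> inW e -> wnorm (fadd b e) <= wnorm b + wnorm e.
Proof.
move=> bW eW; rewrite -lee_fin EFinD !wnormE//; last exact: inW_add.
exact: WnormD.
Qed.

Lemma wnormB b e : inW b -> inW e -> wnorm (fsub b e) <= wnorm b + wnorm e.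
Proof.
move=> bW eW; rewrite -lee_fin EFinD !wnormE//; last exact: inW_sub.
exact: WnormB.
Qed.

Lemma wnorm_scale s b : inW b -> wnorm (fscale s b) <= `|s| * wnorm b.
Proof.
move=> bW; rewrite -lee_fin EFinM !wnormE//; last exact: inW_scale.
exact: Wnorm_scale.
Qed.

Lemma wnorm_sub_le b e : inW b -> inW e -> wnorm b <= wnorm (fsub b e) + wnorm e.
Proof.
move=> bW eW; have {1}-> : b = fadd (fsub b e) e.
  by apply/funext => k; apply/funext => t; rewrite /fadd /fsub subrK.
by apply: wnormD => //; exact: inW_sub.
Qed.

Lemma wnorm_subC b e : wnorm (fsub b e) = wnorm (fsub e b).
Proof.
rewrite /wnorm /Wnorm; congr fine; apply: eq_esum => k _; congr EFin.
rewrite /cb_norm; congr sup; apply/seteqP.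
by split=> _ [t t0 <-]; exists t => //; rewrite /fsub -normcN opprB.
Qed.

Variables (H : fam -> fam) (M C : R).
Hypothesis HW : forall b, inW b -> inW (H b).
Hypothesis HD : forall b e, H (fadd b e) = fadd (H b) (H e).
Hypothesis HZ : forall s b, H (fscale s b) = fscale s (H b).
Hypothesis H_le : forall b, inW b -> wnorm (H b) <= M * wnorm b.
Hypothesis C0 : 0 <= C.

Definition shifted (s : R) b : fam := fadd (fscale s b) (H b).

Hypothesis lb : forall s b, 0 <= s -> inW b -> wnorm b <= C * wnorm (shifted s b).

Lemma inW_shifted s b : inW b -> inW (shifted s b).
Proof. by move=> bW; apply: inW_add; [exact: inW_scale|exact: HW]. Qed.

Lemma shiftedD s b e : shifted s (fadd b e) = fadd (shifted s b) (shifted s e).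
Proof.
rewrite /shifted HD; apply/funext => k; apply/funext => t.
by rewrite /fadd /fscale mulrDr addrACA.
Qed.

Definition dense_range s := forall e d, inW e -> 0 < d ->
  exists2 b, inW b & wnorm (fsub (shifted s b) e) <= d * wnorm e.

(** Successive approximation: solving for the residual again and again multiplies it
    by powers of eta. *)
Lemma dense_range_iter s (eta : R) : 0 <= eta -> eta < 1 ->
  (forall e, inW e -> exists2 b, inW b & wnorm (fsub (shifted s b) e) <= eta * wnorm e) ->
  dense_range s.
Proof.
move=> eta0 eta1 step.
have iter n e : inW e -> exists2 b, inW b & wnorm (fsub (shifted s b) e) <= eta ^+ n.+1 * wnorm e.
  elim: n e => [|n IHn] e eW; first by rewrite expr1; exact: step.
  have [b bW bP] := step e eW.
  have rW : inW (fsub e (shifted s b)) by apply: inW_sub => //; exact: inW_shifted.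
  have [b' b'W b'P] := IHn _ rW.
  exists (fadd b b'); first exact: inW_add.
  have -> : fsub (shifted s (fadd b b')) e = fsub (shifted s b') (fsub e (shifted s b)).
    rewrite shiftedD; apply/funext => k; apply/funext => t; rewrite /fsub /fadd.
    by ring.
  apply: (le_trans b'P); rewrite [in leRHS]exprSr -mulrA ler_wpM2l ?exprn_ge0//.
  by rewrite wnorm_subC.
move=> e d eW d0.
have [n nP] : exists n, eta ^+ n.+1 <= d.
  have c := @cvg_expr _ eta; rewrite ger0_norm// in c.
  have /cvgrPdist_le/(_ d d0)[n _ nP] := c eta1.
  exists n; have := nP n.+1 (leqnSn n).
  by rewrite sub0r normrN ger0_norm// exprn_ge0.
have [b bW bP] := iter n e eW; exists b => //; apply: (le_trans bP).
by rewrite ler_wpM2r// wnorm_ge0.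
Qed.

(** The difference of the two operators, applied to an approximate solution, is
    bounded by the lower bound at s; it leaves at most 3/4 of
    the right side as a residual. *)
Lemma dense_range_step s s' : 0 <= s -> `|s - s'| * C <= 4^-1 ->
  dense_range s -> dense_range s'.
Proof.
move=> s0 ss ds; apply: (@dense_range_iter s' (3 / 4)); [lra|lra|move=> e eW].
have e40 : 0 < 4^-1 :> R by lra.
have [b bW bP] := ds e _ eW e40; exists b => //.
have LW := inW_shifted s bW.
have -> : fsub (shifted s' b) e = fsub (fsub (shifted s b) e) (fscale (s - s') b).
  apply/funext => k; apply/funext => t; rewrite /fsub /shifted /fadd /fscale.
  by rewrite rmorphB/=; ring.
apply: (le_trans (wnormB _ _)); [exact: inW_sub|exact: inW_scale|].
have h1 := wnorm_scale (s - s') bW.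
have h2 := lb s0 bW.
have h3 := wnorm_sub_le LW eW.
have h4 : `|s - s'| * wnorm b <= 4^-1 * wnorm (shifted s b).
  apply: (@le_trans _ _ (`|s - s'| * (C * wnorm (shifted s b)))).
    by rewrite ler_wpM2l.
  by rewrite mulrA ler_wpM2r ?wnorm_ge0.
have := wnorm_ge0 e; lra.
Qed.

(** The method of continuity: the bounded below operators s + H have dense
    range for large s, by smallness of H / s, and the range stays dense while s
    decreases to 0 in small steps. *)
Theorem dense_range0 : dense_range 0.
Proof.
(* a step length for which dense_range_step applies to all s *)
pose d := (4 * (C + 1))^-1.
have d0 : 0 < d by rewrite invr_gt0 mulr_gt0// ltr_wpDl.
have dC : d * C <= 4^-1.
  by rewrite /d invfM -mulrA ler_piMr// mulrC ler_pdivrMr ?ltr_wpDl// mul1r lerDl.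
pose n := (Num.trunc ((2 * `|M| + 1) / d)).+1.
have nP : 2 * `|M| + 1 <= n%:R * d.
  by rewrite -ler_pdivrMr// ltW// truncnS_gt.
have start : dense_range (n%:R * d).
  set s := n%:R * d in nP *.
  have s0 : 0 < s by apply: lt_le_trans nP; rewrite ltr_wpDl// mulr_ge0.
  apply: (@dense_range_iter _ 2^-1); [lra|lra|move=> e eW].
  exists (fscale s^-1 e); first exact: inW_scale.
  have -> : fsub (shifted s (fscale s^-1 e)) e = fscale s^-1 (H e).
    rewrite /shifted HZ; apply/funext => k; apply/funext => t.
    rewrite /fsub /fadd /fscale mulrA -rmorphM/= mulfV ?gt_eqF// mul1r.
    by rewrite addrC addrA addNr add0r.
  apply: (le_trans (wnorm_scale _ (HW eW))).
  rewrite gtr0_norm ?invr_gt0// mulrC ler_pdivrMr//.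
  apply: (le_trans (H_le eW)); rewrite mulrAC ler_wpM2r ?wnorm_ge0//.
  have := ler_norm M; move: nP; lra.
elim: n {nP} start => [|n IHn]; first by rewrite mul0r.
move=> start; apply: IHn; apply: dense_range_step start.
  by rewrite mulr_ge0// ltW.
by rewrite -natr1 mulrDl mul1r addrAC subrr add0r gtr0_norm.
Qed.

End Continuation.

Section Core.
Context {R : realType} {p : R} (p1 : 1 < p).
Variables (g h : R -> R).
Hypotheses (gh : pos_diffeo g h) (hg : pos_diffeo h g).
Hypothesis ratio : forall k, exists2 L : R, 0 < L & forall t, Rpos t ->
  L^-1 * t <= orbit_map g h k t /\ orbit_map g h k t <= L * t.
Local Notation al := (orbit_map g h).
Local Notation fam := (int -> R -> R[i]).
Local Notation wop := (wop p1 g).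
Local Notation conv := (conv g h).
Local Notation fadj := (fadj g h).
Implicit Types (a b : fam) (K : seq int).

(** Coefficients of the product of A^diamond A and the operator of b, for the
    truncation of A to K. *)
Definition gram_conv a K b : fam := conv (fadj a) (negs K) (conv a K b).

(** The values of a family along an orbit are read with the index reversed, so that
    products of families become products of matrices. *)
Lemma gram_conv_fiber a K s b m t : Rpos t ->
  shifted (gram_conv a K) s b (- m) (al m t) =
  fiber_gram g h a K s t (fun m => b (- m) (al m t)) m.
Proof.
move=> t0; rewrite fiber_gramE /shifted /fadd /fscale; congr (_ + _).
rewrite /gram_conv {1}/conv /negs big_map; apply: eq_bigr => k _.
have e : al (- k) (al m t) = al (m - k) t by rewrite -(orbit_mapD gh hg)// addrC.
rewrite /fadj opprK e fiberE /conv; congr (_ * _); apply: eq_bigr => l _.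
rewrite -(orbit_mapD gh hg)// (addrC l); congr (_ * b _ _).
by rewrite !opprD opprK.
Qed.

Lemma sum_fadj_negs a K : inW a ->
  \sum_(k <- negs K) cb_norm (fadj a k) <= \sum_(k <- K) cb_norm (a k).
Proof.
move=> aW; rewrite /negs big_map; apply: ler_sum => k _.
rewrite -[in leRHS](opprK k); apply: (cb_norm_fadj gh hg).
by rewrite opprK; case: aW.
Qed.

Lemma inW_gram_conv a K b : inW a -> inW b -> inW (gram_conv a K b).
Proof.
move=> aW bW; apply: (inW_conv gh hg ratio); last by apply: (inW_conv gh hg ratio) => //; case: aW.
by case: (inW_fadj gh hg ratio aW).
Qed.

Lemma wnorm_conv a K b : inW a -> inW b ->
  wnorm (conv a K b) <= (\sum_(k <- K) cb_norm (a k)) * wnorm b.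
Proof.
move=> aW bW; rewrite -lee_fin EFinM !wnormE//; last first.
  by apply: (inW_conv gh hg ratio) => //; case: aW.
by apply: (Wnorm_conv gh hg ratio) => //; case: aW.
Qed.

Lemma sum_ball_le a n : inW a -> \sum_(k <- ball_seq n) cb_norm (a k) <= wnorm a.
Proof.
by move=> aW; rewrite -lee_fin wnormE//; apply: Wnorm_ge => //; exact: ball_seq_uniq.
Qed.

Lemma wnorm_gram_conv a n b : inW a -> inW b ->
  wnorm (gram_conv a (ball_seq n) b) <= wnorm a ^+ 2 * wnorm b.
Proof.
move=> aW bW; have adW := inW_fadj gh hg ratio aW.
have cW : inW (conv a (ball_seq n) b) by apply: (inW_conv gh hg ratio) => //; case: aW.
have T0 := wnorm_ge0 a; have aT := sum_ball_le n aW.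
apply: (le_trans (wnorm_conv _ adW cW)); rewrite expr2 -mulrA.
apply: ler_pM; rewrite ?wnorm_ge0//.
- by apply: sumr_ge0 => k _; exact: cb_norm_ge0.
- exact: le_trans (sum_fadj_negs _ aW) aT.
- by apply: (le_trans (wnorm_conv _ aW bW)); rewrite ler_wpM2r ?wnorm_ge0.
Qed.

(** An instance of shift_sum_stability with q = 2 and r = 1 in which the parameter x
    runs over all the orbits. The l^1 norm of suprema over t is the norm of the
    algebra. *)
Lemma gram_conv_below a M n0 : inW a -> 0 < M -> fibers_below g h a 2 M n0 ->
  exists2 C, 0 <= C & forall n s b, (n0 <= n)%N -> 0 <= s -> inW b ->
    wnorm b <= C * wnorm (shifted (gram_conv a (ball_seq n)) s b).
Proof.
move=> aW M0 lb; pose beta k := cb_norm (a k).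
have b0 k : 0 <= beta k by exact: cb_norm_ge0.
pose T := wnorm a; have T0 : 0 <= T := wnorm_ge0 a.
have w0 : 0 <= M ^+ 2 := sqr_ge0 M.
have K0 : 0 < 24 * M ^+ 2 * T + 1 by rewrite ltr_wpDl// mulr_ge0// mulr_ge0.
have [N N0 NP] := gap_small aW (divr_gt0 ltr01 K0).
exists (6 * N%:R * M ^+ 2); first by rewrite mulr_ge0// mulr_ge0.
move=> n s b nn s0 bW; set K := ball_seq n; pose y := shifted (gram_conv a K) s b.
have yW : inW y.
  by apply: inW_shifted bW => e eW; exact: inW_gram_conv.
pose X := {t : R | Rpos t}.
have Rpos1 : Rpos (1 : R) by rewrite RposE.
have := @shift_sum_stability R (int * int) [seq (k, l) | k <- K, l <- K]
  (fun kl => kl.2 - kl.1) (fun kl => beta kl.1 * beta kl.2)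
  (fun kl => mulr_ge0 (b0 kl.1) (b0 kl.2)) 2 1 (M ^+ 2) N X (exist _ 1 Rpos1) (fun=> s%:C)
  (fun (x : X) kl m => conjc (a kl.1 (al (m - kl.1) (sval x))) * a kl.2 (al (m - kl.1) (sval x)))
  (fun (x : X) m => b (- m) (al m (sval x)))
  (fun m => cb_norm (b (- m))) (fun m => cb_norm (y (- m))).
case=> //.
- by rewrite ler1n.
- apply: (@le_trans _ _ (6 * M ^+ 2 * (2 * T * (1 / (24 * M ^+ 2 * T + 1))))).
    apply: ler_wpM2l; first by rewrite mulr_ge0.
    apply: (le_trans (gram_gap_sum K N b0)); apply: ler_pM => //.
    + by rewrite mulr_ge0// sumr_ge0.
    + by apply: gap_sum_ge0.
    + by rewrite ler_wpM2l//; exact: sum_ball_le.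
    + exact: NP.
  have -> : 6 * M ^+ 2 * (2 * T * (1 / (24 * M ^+ 2 * T + 1))) =
      12 * (M ^+ 2 * T) / (24 * M ^+ 2 * T + 1) by rewrite div1r; ring.
  by rewrite ler_pdivrMr// -[24 * _ * _]mulrA; lra.
- move=> [t t0] [k l] m /=; rewrite normcM normc_conjc.
  by apply: ler_pM; rewrite ?normc_ge0//; exact: (le_coef gh hg).
- move=> [t t0]; apply: (fiber_gram_below (a := a)) => //.
  exact: lb.
- move=> [t t0] m /=; apply: le_cb_norm; first exact: inW_bounded.
  exact: (orbit_map_pos gh hg).
- rewrite lqnorm1; have := bW.2; rewrite Wnorm_opp; congr (_ < _)%E.
  by apply: eq_esum => k _; rewrite ger0_norm ?cb_norm_ge0.
- move=> [t t0] m.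
  have -> : shift_sum [seq (k, l) | k <- K, l <- K] (fun kl => kl.2 - kl.1) s%:C
     (fun kl m => conjc (a kl.1 (al (m - kl.1) t)) * a kl.2 (al (m - kl.1) t))
     (fun m => b (- m) (al m t)) m = y (- m) (al m t) by rewrite /y gram_conv_fiber.
  apply: le_cb_norm; first exact: inW_bounded.
  exact: (orbit_map_pos gh hg).
move=> W [bWle WT]; rewrite -lee_fin EFinM !wnormE//.
have -> : Wnorm y = lqnorm 1 (fun m => cb_norm (y (- m))).
  by rewrite lqnorm1 Wnorm_opp; apply: eq_esum => k _; rewrite ger0_norm ?cb_norm_ge0.
apply: le_trans WT; rewrite Wnorm_opp lqnorm1; apply: le_esum => m _; rewrite lee_fin.
apply: cb_norm_le => t t0; have u0 := orbit_map_pos gh hg (- m) t0.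
have := bWle (exist _ _ u0) m; rewrite /= (orbit_mapNK gh hg)// => /le_trans; apply.
exact: ler_norm.
Qed.

End Core.

(** * Inversion of the Gram operator *)

Section OperatorLimits.
Context {R : realType} {p : R} (p1 : 1 < p).
Implicit Types (u v : nat -> Bop p1) (d : nat -> R).

Definition vanishing d := forall e : R, 0 < e -> exists n, forall m, (n <= m)%N -> d m <= e.

Definition tends u (x : Bop p1) := vanishing (fun n => `|u n - x|).

Lemma vanishingD d d' : vanishing d -> vanishing d' -> vanishing (fun n => d n + d' n).
Proof.
move=> dP d'P e e0; have e20 : 0 < e / 2 by rewrite divr_gt0.
have [n nP] := dP _ e20; have [n' n'P] := d'P _ e20.
exists (maxn n n') => m; rewrite geq_max => /andP[nm n'm].
by rewrite (splitr e) lerD// ?nP// n'P.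
Qed.

Lemma vanishingZ (c : R) d : 0 <= c -> vanishing d -> vanishing (fun n => c * d n).
Proof.
move=> c0 dP e e0; have c10 : 0 < c + 1 by rewrite ltr_wpDl.
have [n nP] := dP _ (divr_gt0 e0 c10); exists n => m /nP le.
apply: (@le_trans _ _ (c * (e / (c + 1)))); first by rewrite ler_wpM2l.
by rewrite mulrCA ler_piMr ?(ltW e0)// ler_pdivrMr// mul1r lerDl.
Qed.

Lemma vanishing_le d d' : (forall n, d n <= d' n) -> vanishing d' -> vanishing d.
Proof.
by move=> dd d'P e /d'P[n nP]; exists n => m /nP; exact: le_trans.
Qed.

Lemma vanishing_shift d k : vanishing d -> vanishing (fun n => d (k + n)%N).
Proof.
by move=> dP e /dP[n nP]; exists n => m nm; apply: nP; exact: leq_trans (leq_addl _ _).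
Qed.

Lemma vanishing_harmonic : vanishing (fun n => n.+1%:R^-1).
Proof.
move=> e e0; exists (Num.trunc e^-1) => m nm.
rewrite -[leRHS]invrK lef_pV2 ?posrE ?invr_gt0// ltW//.
by apply: (lt_le_trans (truncnS_gt _)); rewrite ler_nat.
Qed.

Lemma vanishing_cst0 (x : R) : vanishing (fun=> x) -> x <= 0.
Proof. by move=> xP; apply/ler_addgt0Pl => e /xP[n /(_ n (leqnn n))]; rewrite addr0. Qed.

Lemma tends_le d u x : (forall n, `|u n - x| <= d n) -> vanishing d -> tends u x.
Proof. exact: vanishing_le. Qed.

Lemma tends_unique u x y : tends u x -> tends u y -> x = y.
Proof.
move=> ux uy; apply/eqP; rewrite -subr_eq0 -normr_le0; apply: vanishing_cst0.
apply: vanishing_le (vanishingD ux uy) => n.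
by rewrite -[in leLHS](subrK (u n) x) -addrA -(normrN (u n - x)) opprB ler_normD.
Qed.

Lemma tends_mul u v x y : tends u x -> tends v y -> tends (fun n => u n * v n) (x * y).
Proof.
move=> ux vy.
suff : vanishing (fun n => `|u n - x| * `|v n - y| + (`|y| * `|u n - x| + `|x| * `|v n - y|)).
  apply: vanishing_le => n.
  have -> : u n * v n - x * y = (u n - x) * (v n - y) + ((u n - x) * y + x * (v n - y)).
    by rewrite addrA -mulrDr subrK mulrBl mulrBr addrA subrK.
  apply: (le_trans (ler_normD _ _)); apply: lerD; first exact: Bop_normM.
  apply: (le_trans (ler_normD _ _)); apply: lerD; last exact: Bop_normM.
  by rewrite mulrC; exact: Bop_normM.
apply: vanishingD; last by apply: vanishingD; exact: vanishingZ.
move=> e e0; have [n nP] := ux 1 ltr01; have [n' n'P] := vy e e0.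
exists (maxn n n') => m; rewrite geq_max => /andP[nm n'm].
by rewrite -[e]mul1r ler_pM// ?nP// n'P.
Qed.

Lemma vanishing_Wtail (a : int -> R -> R[i]) : inW a -> vanishing (Wtail a).
Proof. by move=> aW e; exact: Wtail_small. Qed.

End OperatorLimits.

Section GramInverse.
Context {R : realType} {p : R} (p1 : 1 < p).
Variables (g h : R -> R).
Hypotheses (gh : pos_diffeo g h) (hg : pos_diffeo h g).
Hypothesis ratio : forall k, exists2 L : R, 0 < L & forall t, Rpos t ->
  L^-1 * t <= orbit_map g h k t /\ orbit_map g h k t <= L * t.
Local Notation fam := (int -> R -> R[i]).
Local Notation wop := (wop p1 g).
Local Notation conv := (conv g h).
Local Notation fadj := (fadj g h).
Local Notation gram_conv := (gram_conv g h).
Local Notation fin_op := (fin_op p1 g).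
Implicit Types (a b : fam) (K : seq int).

Lemma wnorm_conv_tail a n m b : inW a -> inW b -> (n <= m)%N ->
  wnorm (fsub (conv a (ball_seq m) b) (conv a (ball_seq n) b)) <= Wtail a n * wnorm b.
Proof.
move=> aW bW nm; rewrite -lee_fin EFinM !wnormE//; first exact: (conv_tail gh hg ratio).
by apply: inW_sub; apply: (inW_conv gh hg ratio) => //; case: aW.
Qed.

(** Both factors of the Gram operator contribute a tail. *)
Lemma gram_conv_tail a n m b : inW a -> inW b -> (n <= m)%N ->
  wnorm (fsub (gram_conv a (ball_seq m) b) (gram_conv a (ball_seq n) b)) <=
  2 * wnorm a * Wtail a n * wnorm b.
Proof.
move=> aW bW nm; have adW := inW_fadj gh hg ratio aW.
have T0 := wnorm_ge0 a; have t0 := Wtail_ge0 n aW.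
have cW K : inW (conv a K b) by apply: (inW_conv gh hg ratio) => //; case: aW.
have dW K y : inW y -> inW (conv (fadj a) K y).
  by move=> yW; apply: (inW_conv gh hg ratio) => //; case: adW.
have [s [us sn] sE] := ball_seqD n (m - n); rewrite subnKC// in sE.
set y := conv a (ball_seq n) b.
pose z := fsub (conv a (ball_seq m) b) y.
have zW : inW z by apply: inW_sub; exact: cW.
have -> : fsub (gram_conv a (ball_seq m) b) (gram_conv a (ball_seq n) b) =
    fadd (conv (fadj a) (negs (ball_seq m)) z) (conv (fadj a) (negs s) y).
  have e : conv (fadj a) (negs (ball_seq m)) y =
      fadd (conv (fadj a) (negs (ball_seq n)) y) (conv (fadj a) (negs s) y).
    by rewrite sE /negs map_cat conv_cat.
  rewrite /z convB e; apply/funext => k; apply/funext => t; rewrite /fsub /fadd.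
  by rewrite /gram_conv -/y; ring.
apply: (le_trans (wnormD (dW _ _ zW) (dW _ _ (cW _)))).
have h1 : wnorm (conv (fadj a) (negs (ball_seq m)) z) <= wnorm a * (Wtail a n * wnorm b).
  apply: (le_trans (wnorm_conv gh hg ratio _ adW zW)); apply: ler_pM; rewrite ?wnorm_ge0//.
  - by apply: sumr_ge0 => k _; exact: cb_norm_ge0.
  - by apply: (le_trans (sum_fadj_negs gh hg _ aW)); exact: sum_ball_le.
  - exact: wnorm_conv_tail.
have h2 : wnorm (conv (fadj a) (negs s) y) <= Wtail a n * (wnorm a * wnorm b).
  apply: (le_trans (wnorm_conv gh hg ratio _ adW (cW _))); apply: ler_pM; rewrite ?wnorm_ge0//.
  - by apply: sumr_ge0 => k _; exact: cb_norm_ge0.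
  - by apply: (le_trans (sum_fadj_negs gh hg _ aW)); exact: Wtail_le.
  - apply: (le_trans (wnorm_conv gh hg ratio _ aW bW)).
    by rewrite ler_wpM2r ?wnorm_ge0// sum_ball_le.
move: h1 h2; rewrite mulrCA; nra.
Qed.

Lemma tends_fin_op a : inW a -> tends (fun n => fin_op a (ball_seq n)) (wop a).
Proof.
move=> aW; apply: tends_le (vanishing_Wtail aW) => n.
by rewrite distrC; exact: (fin_op_dist p1 gh hg).
Qed.

Lemma fadj_one : fadj fone = fone.
Proof.
apply/funext => k; apply/funext => t; rewrite /fadj /fone oppr_eq0.
by case: eqP => _; rewrite ?conjc1 ?conjc0.
Qed.

(** The formal adjoint is a contraction for the norm of the algebra, so that it
    preserves the convergence of truncations. *)
Lemma tends_fin_op_fadj a : inW a ->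
  tends (fun n => fin_op (fadj a) (negs (ball_seq n))) (wop (fadj a)).
Proof.
move=> aW; apply: tends_le (vanishing_Wtail aW) => n; set K := ball_seq n.
have oW := @inW_one R.
have cW : inW (conv a K fone) by apply: (inW_conv gh hg ratio) => //; case: aW.
have -> : fin_op (fadj a) (negs K) = wop (fadj (conv a K fone)).
  by rewrite (wop_fadj_conv p1 gh hg ratio)// ?fadj_one ?wop_one ?mul1r//; case: aW.
rewrite distrC -lee_fin; apply: (le_trans (wop_dist p1 gh hg _ _)).
- exact: (inW_fadj gh hg ratio).
- exact: (inW_fadj gh hg ratio).
rewrite -fadj_sub; apply: (le_trans (Wnorm_fadj gh hg (inW_sub aW cW))).
apply: le_Wnorm => s us; rewrite lee_fin.
have E k t : fsub a (conv a K fone) k t = if k \in K then 0 else a k t.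
  rewrite /fsub /conv; case: ifPn => kK.
    rewrite (bigD1_seq k) ?ball_seq_uniq//= subrr /fone eqxx mulr1 big1 ?addr0 ?subrr//.
    by move=> i ik; rewrite subr_eq0 eq_sym (negbTE ik) mulr0.
  rewrite big_seq big1 ?subr0// => i iK; rewrite /fone subr_eq0.
  by case: eqP => [ki|_]; rewrite ?mulr0//; rewrite ki iK in kK.
rewrite (bigID [pred k | k \in K])/= big1 ?add0r; last first.
  move=> k kK; rewrite (_ : fsub _ _ _ = fun=> 0) ?cb_norm0//.
  by apply/funext => t; rewrite E kK.
rewrite -big_filter (eq_big_seq (fun k => cb_norm (a k))); last first.
  move=> k; rewrite mem_filter => /andP[kK _]; congr cb_norm.
  by apply/funext => t; rewrite E (negbTE kK).
by apply: Wtail_le => //; rewrite ?filter_uniq// => k; rewrite mem_filter => /andP[].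
Qed.

(** For each truncation A_n of A, dense_range0 gives an approximate solution b_n of
    (A_n^diamond A_n) b = 1. The lower bound at s = 0 makes these a Cauchy sequence
    of families, and the equation passes to the limit in operator norm. Taking
    formal adjoints, b_n^diamond is an approximate left inverse of the same
    operator. *)
Theorem gram_inverse a q M n0 : inW a -> 1 <= q -> 0 <= M -> fibers_below g h a q M n0 ->
  exists b, [/\ inW b, wop (fadj a) * wop a * wop b = 1 &
    wop (fadj b) * (wop (fadj a) * wop a) = 1].
Proof.
move=> aW q1 M0 /(fibers_below_l2 gh hg aW q1 M0)[M' M'0 lb].
have [C C0 CP] := gram_conv_below gh hg ratio aW M'0 lb.
have adW := inW_fadj gh hg ratio aW; have oW := @inW_one R.
pose T := wnorm a; have T0 : 0 <= T := wnorm_ge0 a.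
pose w1 := wnorm (@fone R); have w10 : 0 <= w1 := wnorm_ge0 _.
pose K n := ball_seq (n0 + n); pose H n := gram_conv a (K n).
have HW n b : inW b -> inW (H n b) by exact: (inW_gram_conv gh hg ratio).
have aF b : inW b -> inW (fadj b) by exact: (inW_fadj gh hg ratio).
have s0 n b : shifted (H n) 0 b = H n b.
  by apply/funext => k; apply/funext => t; rewrite /shifted /fadd /fscale mul0r add0r.
have HC n b : inW b -> wnorm b <= C * wnorm (H n b).
  by move=> bW; rewrite -s0; apply: CP => //; exact: leq_addr.
have dense n : exists b, inW b /\ wnorm (fsub (H n b) fone) <= n.+1%:R^-1.
  have d0 : 0 < n.+1%:R^-1 / (w1 + 1) by rewrite divr_gt0// ltr_wpDl.
  have [||||b bW] := @dense_range0 _ (H n) (T ^+ 2) C (HW n) _ _ _ C0 _ _ _ oW d0.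
  - move=> b e; rewrite /H /gram_conv !convD//.
  - move=> s b; rewrite /H /gram_conv; apply/funext => k; apply/funext => t.
    rewrite /fscale /conv mulr_sumr; apply: eq_bigr => i _.
    rewrite mulrCA; congr (_ * _); rewrite mulr_sumr; apply: eq_bigr => j _.
    by rewrite mulrCA.
  - by move=> b bW; exact: (wnorm_gram_conv gh hg ratio).
  - by move=> s b s00 bW; apply: CP => //; exact: leq_addr.
  rewrite s0 => le; exists b; split => //; apply: (le_trans le).
  rewrite -mulrA ler_piMr// mulrC ler_pdivrMr ?ltr_wpDl// mul1r lerDl.
  by [].
have /choice[b bP] := dense.
have bW n : inW (b n) by case: (bP n).
have b1 n : wnorm (fsub (H n (b n)) fone) <= n.+1%:R^-1 by case: (bP n).
pose B := C * (1 + w1); have B0 : 0 <= B by rewrite mulr_ge0// addr_ge0.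
have bB n : wnorm (b n) <= B.
  apply: (le_trans (HC n _ (bW n))); rewrite ler_wpM2l//.
  apply: (le_trans (wnorm_sub_le (HW n _ (bW n)) oW)); rewrite lerD2r.
  by apply: (le_trans (b1 n)); rewrite invf_le1 ?ler1n.
pose eps n : R := C * (2 * n.+1%:R^-1 + 2 * T * B * Wtail a (n0 + n)).
have epsV : vanishing eps.
  apply: vanishingZ => //; apply: vanishingD.
    by apply: vanishingZ => //; exact: vanishing_harmonic.
  apply: vanishingZ; first by apply: mulr_ge0 => //; apply: mulr_ge0.
  by apply: vanishing_shift; exact: vanishing_Wtail.
have bC n m : (n <= m)%N -> wnorm (fsub (b n) (b m)) <= eps n.
  move=> nm; apply: (le_trans (HC n _ (inW_sub (bW n) (bW m)))).
  rewrite ler_wpM2l//.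
  have -> : H n (fsub (b n) (b m)) = fadd (fsub (fsub (H n (b n)) fone) (fsub (H m (b m)) fone))
      (fsub (H m (b m)) (H n (b m))).
    rewrite /H /gram_conv !convB; apply/funext => k; apply/funext => t.
    by rewrite /fadd /fsub; ring.
  have W1 k : inW (fsub (H k (b k)) fone) by apply: inW_sub => //; exact: HW.
  apply: (le_trans (wnormD (inW_sub (W1 n) (W1 m)) (inW_sub (HW m _ (bW m)) (HW n _ (bW m))))).
  apply: lerD.
    apply: (le_trans (wnormB (W1 n) (W1 m))); rewrite mulr_natl mulr2n; apply: lerD => //.
    by apply: (le_trans (b1 m)); rewrite lef_pV2 ?posrE// ler_nat ltnS.
  apply: (le_trans (gram_conv_tail aW (bW m) _)); first by rewrite leq_add2l.
  have t0 := Wtail_ge0 (n0 + n) aW.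
  by rewrite [leRHS]mulrAC; apply: ler_wpM2l => //; do 2 apply: mulr_ge0 => //.
have [||x [xW xP]] := @W_complete _ b eps bW.
- by move=> n m nm; rewrite -wnormE ?lee_fin; [rewrite wnorm_subC bC|exact: inW_sub].
- exact: epsV.
have Xt : tends (fun n => wop (b n)) (wop x).
  apply: tends_le epsV => n; rewrite -lee_fin distrC.
  by apply: le_trans (xP n); exact: (wop_dist p1 gh hg).
have Yt : tends (fun n => wop (fadj (b n))) (wop (fadj x)).
  apply: tends_le epsV => n; rewrite -lee_fin distrC.
  apply: (le_trans (wop_dist p1 gh hg (aF _ xW) (aF _ (bW n)))).
  by rewrite -fadj_sub; apply: le_trans (xP n); exact: (Wnorm_fadj gh hg (inW_sub xW (bW n))).
pose Q n := fin_op a (K n); pose P n := fin_op (fadj a) (negs (K n)).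
have Qt : tends Q (wop a).
  by have := tends_fin_op aW => /(vanishing_shift n0).
have Pt : tends P (wop (fadj a)).
  by have := tends_fin_op_fadj aW => /(vanishing_shift n0).
have cW n : inW (conv a (K n) (b n)) by apply: (inW_conv gh hg ratio) => //; case: aW.
exists x; split => //.
  apply: (tends_unique (tends_mul (tends_mul Pt Qt) Xt)).
  apply: tends_le (@vanishing_harmonic R) => n.
  have -> : P n * Q n * wop (b n) = wop (H n (b n)).
    rewrite /H /gram_conv !(wop_conv p1 gh hg ratio)//; [|by case: aW|by case: adW].
    by rewrite mulrA.
  rewrite -(wop_one p1 g) -lee_fin; apply: (le_trans (wop_dist p1 gh hg (HW n _ (bW n)) oW)).
  by rewrite -wnormE ?lee_fin//; apply: inW_sub => //; exact: HW.
apply: (tends_unique (tends_mul Yt (tends_mul Pt Qt))).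
apply: tends_le (@vanishing_harmonic R) => n.
have -> : wop (fadj (b n)) * (P n * Q n) = wop (fadj (H n (b n))).
  rewrite /H /gram_conv !(wop_fadj_conv p1 gh hg ratio)//; [|by case: aW|by case: adW].
  rewrite mulrA; congr (_ * _); rewrite /Q /fin_op /negs !big_map; apply: eq_bigr => k _.
  rewrite opprK /fterm; congr (_ * _); apply: eq_mul_op.
  - by apply: SO_symbol; case: aW.
  - by apply: SO_symbol; case: (inW_fadj gh hg ratio adW).
  - by move=> t t0; rewrite (fadjK gh hg).
rewrite -(wop_one p1 g) -fadj_one -lee_fin.
apply: (le_trans (wop_dist p1 gh hg (aF _ (HW n _ (bW n))) (aF _ oW))).
rewrite -fadj_sub; apply: (le_trans (Wnorm_fadj gh hg (inW_sub (HW n _ (bW n)) oW))).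
by rewrite -wnormE ?lee_fin//; apply: inW_sub => //; exact: HW.
Qed.

End GramInverse.

(** * Functions with disjoint supports *)

Section Localization.
Context {R : realType} {p : R} (p1 : 1 < p).
Local Notation mu := (@lebesgue_measure R).
Implicit Types (x y : Lp p1) (b : R -> R[i]).

Let p0 : 0 < p. Proof. exact: lt_trans p1. Qed.

Lemma toLp_powR (f : R -> R[i]) : f \in Lp_fun p1 ->
  ((`|toLp p1 f| `^ p)%:E = \int[mu]_(t in Rpos) (cabs f t `^ p)%:E)%E.
Proof.
move=> fL; rewrite -poweR_EFin toLp_norm// LpNE// -poweRrM mulVf ?gt_eqF// poweRe1//.
by apply: integral_ge0 => t _; rewrite lee_fin powR_ge0.
Qed.

(** At each point at most one of the functions is different from 0, so that the p-th
    powers of the moduli add up. *)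
Lemma disjoint_sum_norm (J : seq int) (chi : int -> R -> R[i]) (x : int -> Lp p1) :
  uniq J -> (forall m, mult_symbol (chi m)) ->
  (forall m n t, m \in J -> n \in J -> Rpos t -> chi m t != 0 -> chi n t != 0 -> m = n) ->
  `|\sum_(m <- J) mul_op p1 (chi m) (x m)| = lnorm p J (fun m => `|mul_op p1 (chi m) (x m)|).
Proof.
move=> uJ sc dis; pose F m t := chi m t * ofLp (x m) t.
have FL m : F m \in Lp_fun p1 by apply: mul_Lp => //; exact: ofLpP.
have FE m : mul_op p1 (chi m) (x m) = toLp p1 (F m).
  by rewrite -{1}[x m]toLpK mul_op_toLp//; exact: ofLpP.
under eq_bigr do rewrite FE.
have [SL SE] := toLp_sum J FL; rewrite -SE.
suff e : `|toLp p1 (\sum_(m <- J) F m)| `^ p = \sum_(m <- J) `|toLp p1 (F m)| `^ p.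
  have -> : lnorm p J (fun m => `|mul_op p1 (chi m) (x m)|) =
      (\sum_(m <- J) `|toLp p1 (F m)| `^ p) `^ p^-1.
    by rewrite lnorm.unlock; congr (_ `^ _); apply: eq_bigr => m _; rewrite FE ger0_norm.
  by rewrite -e -powRrM mulfV ?gt_eqF// powRr1.
apply: EFin_inj; rewrite toLp_powR// -sumEFin.
under [RHS]eq_bigr do rewrite toLp_powR//.
rewrite -ge0_integral_sum//; last 3 first.
- exact: measurable_Rpos.
- by move=> m; apply: measurable_cabs_powR; have /Lp_funP[] := FL m.
- by move=> m t _; rewrite lee_fin powR_ge0.
apply: eq_integral => t /[!inE] t0; rewrite sumEFin; congr EFin.
have sE : (\sum_(m <- J) F m) t = \sum_(m <- J) F m t.
  by elim/big_ind2 : _ => // u v w z <- <-.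
rewrite /cabs sE.
have [/hasP[m mJ m0]|/hasPn n0] := boolP (has (fun m => chi m t != 0) J).
  have z n : n \in J -> n != m -> F n t = 0.
    move=> nJ nm; rewrite /F; have [->|n0] := eqVneq (chi n t) 0; first by rewrite mul0r.
    by rewrite (dis m n t mJ nJ t0 m0 n0) eqxx in nm.
  have -> : \sum_(n <- J) F n t = F m t.
    rewrite (bigD1_seq m)//= big_seq_cond big1 ?addr0// => n /andP[nJ nm].
    exact: z.
  rewrite (bigD1_seq m)//= [X in _ + X]big_seq_cond [X in _ + X]big1 ?addr0// => n /andP[nJ nm].
  by rewrite z// normc0 powR0// gt_eqF.
have z n : n \in J -> F n t = 0 by move=> /n0; rewrite negbK /F => /eqP ->; rewrite mul0r.
have -> : \sum_(n <- J) F n t = 0 by rewrite big_seq big1.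
rewrite normc0 powR0 ?gt_eqF// big_seq big1// => n nJ.
by rewrite z// normc0 powR0// gt_eqF.
Qed.

Lemma mult_symbol_sum (I : Type) (r : seq I) (b : I -> R -> R[i]) :
  (forall i, mult_symbol (b i)) -> mult_symbol (fun t => \sum_(i <- r) b i t).
Proof.
move=> sb; elim: r => [|i r IHr].
  rewrite (_ : (fun _ => _) = fun=> 0); first exact: mult_symbol_cst.
  by apply/funext => t; rewrite big_nil.
rewrite (_ : (fun _ => _) = fun t => b i t + \sum_(i <- r) b i t).
  exact: mult_symbolD.
by apply/funext => t; rewrite big_cons.
Qed.

Lemma mul_op_sum (I : Type) (r : seq I) (b : I -> R -> R[i]) :
  (forall i, mult_symbol (b i)) ->
  mul_op p1 (fun t => \sum_(i <- r) b i t) = \sum_(i <- r) mul_op p1 (b i).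
Proof.
move=> sb; elim: r => [|i r IHr].
  rewrite big_nil -(mul_op0 p1); congr mul_op.
  by apply/funext => t; rewrite big_nil.
rewrite big_cons -IHr -mul_opD//; last exact: mult_symbol_sum.
by congr mul_op; apply/funext => t; rewrite big_cons.
Qed.

(** Freezing a coefficient: on a function supported where b is close to the constant
    c, multiplication by b is close to multiplication by c. *)
Lemma mul_op_local (chi b : R -> R[i]) (c : R[i]) (d : R) x : mult_symbol chi -> mult_symbol b ->
  0 <= d -> (forall t, Rpos t -> normc (chi t) <= 1) ->
  (forall t, Rpos t -> chi t != 0 -> normc (b t - c) <= d) ->
  `|mul_op p1 b (mul_op p1 chi x) - c *: mul_op p1 chi x| <= d * `|x|.
Proof.
move=> sc sb d0 c1 bc.
have sbc : mult_symbol (fun t => b t + - c).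
  by apply: mult_symbolD => //; exact: mult_symbol_cst.
have -> : mul_op p1 b (mul_op p1 chi x) - c *: mul_op p1 chi x =
    mul_op p1 (fun t => (b t + - c) * chi t) x.
  rewrite mul_opM// BopME mul_opD//; last exact: mult_symbol_cst.
  by rewrite BopDE mul_op_cst scaleNr.
apply: mul_op_norm_le => //; first exact: mult_symbolM.
move=> t t0; rewrite normcM.
have [->|h] := eqVneq (chi t) 0; first by rewrite normc0 mulr0.
by rewrite -[d]mulr1 ler_pM ?normc_ge0// ?bc// c1.
Qed.

End Localization.

(** * Functions concentrated along an orbit *)

Section OrbitPieces.
Context {R : realType} {p : R} (p1 : 1 < p).
Variables (g h : R -> R).
Hypotheses (gh : pos_diffeo g h) (hg : pos_diffeo h g).
Local Notation mu := (@lebesgue_measure R).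
Local Notation al := (orbit_map g h).
Local Notation U := (comp_op p1 g).
Implicit Types (J : seq int) (chi : R -> R[i]).

Let p0 : 0 < p. Proof. exact: lt_trans p1. Qed.

(** For the indicator chi of a set I, the images of I under al_m, for m in J, are
    pairwise disjoint. *)
Definition orbit_disjoint J chi := forall m n t, m \in J -> n \in J -> Rpos t ->
  chi (al (- m) t) != 0 -> chi (al (- n) t) != 0 -> m = n.

Lemma orbit_sum_norm J chi (x : int -> Lp p1) : uniq J -> mult_symbol chi ->
  orbit_disjoint J chi -> (forall m, mul_op p1 chi (x m) = x m) ->
  `|\sum_(m <- J) (U ^ (- m)) (x m)| = lnorm p J (fun m => `|x m|).
Proof.
move=> uJ sc dis cx.
have E m : (U ^ (- m)) (x m) = mul_op p1 (chi \o al (- m)) ((U ^ (- m)) (x m)).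
  by rewrite -{1}cx -BopME (comp_opXz_mul p1 gh hg).
have -> : \sum_(m <- J) (U ^ (- m)) (x m) =
    \sum_(m <- J) mul_op p1 (chi \o al (- m)) ((U ^ (- m)) (x m)).
  by apply: eq_bigr => m _; exact: E.
have sm m : mult_symbol (chi \o al (- m)) by exact: (mult_symbol_orbit gh hg).
have e := @disjoint_sum_norm _ _ p1 J (fun m => chi \o al (- m))
  (fun m => (U ^ (- m)) (x m)) uJ sm dis.
rewrite e; apply: eq_lnorm => m _; congr `|_|.
have e' := E m; rewrite -[in LHS]e'; have e'' := comp_opXz_norm (p1 := p1) gh hg (- m) (x m).
by rewrite e''.
Qed.

(** Moving the windows back by U^(-m) turns them into multiplications by functions with
    disjoint supports, the sum of which is bounded by 1. *)
Lemma orbit_window_norm J chi x : uniq J -> mult_symbol chi ->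
  (forall t, Rpos t -> normc (chi t) <= 1) -> orbit_disjoint J chi ->
  lnorm p J (fun m => `|mul_op p1 chi ((U ^ m) x)|) <= `|x|.
Proof.
move=> uJ sc c1 dis.
have sm m : mult_symbol (chi \o al (- m)) by exact: (mult_symbol_orbit gh hg).
have uU := comp_op_unit p1 gh hg.
have E m : `|mul_op p1 chi ((U ^ m) x)| = `|mul_op p1 (chi \o al (- m)) x|.
  have e := comp_opXz_norm (p1 := p1) gh hg (- m) (mul_op p1 chi ((U ^ m) x)).
  rewrite -[LHS]e -BopME (comp_opXz_mul p1 gh hg)// BopME.
  have -> : (U ^ (- m)) ((U ^ m) x) = x by rewrite -BopME -exprzDr// addNr expr0z.
  by [].
have -> : lnorm p J (fun m => `|mul_op p1 chi ((U ^ m) x)|) =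
    lnorm p J (fun m => `|mul_op p1 (chi \o al (- m)) x|).
  by apply: eq_lnorm => m _; rewrite E.
have e := @disjoint_sum_norm _ _ p1 J (fun m => chi \o al (- m)) (fun=> x) uJ sm dis.
rewrite -[leLHS]e; clear e.
rewrite -Bop_sumE -mul_op_sum// -[leRHS]mul1r.
apply: mul_op_norm_le => //; first exact: mult_symbol_sum.
move=> t t0.
have [/hasP[m mJ m0]|/hasPn n0] := boolP (has (fun m => chi (al (- m) t) != 0) J).
  rewrite (bigD1_seq m)//= big_seq_cond big1 ?addr0 ?c1//; first exact: (orbit_map_pos gh hg).
  move=> n /andP[nJ nm]; apply/eqP; apply: contraNT nm => n0.
  by rewrite (dis m n t).
rewrite big_seq big1 ?normc0// => n nJ.
by have := n0 n nJ; rewrite negbK => /eqP.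
Qed.

Hypothesis free : forall t, Rpos t -> g t != t.

Lemma near_seq (T : eqType) (s : seq T) (P : T -> R -> Prop) (t : R) :
  (forall i, i \in s -> \forall u \near t, P i u) ->
  \forall u \near t, forall i, i \in s -> P i u.
Proof.
elim: s => [|i s IHs] H; first by near=> u.
have Hi := H i (mem_head i s).
have Hs : \forall u \near t, forall j, j \in s -> P j u.
  by apply: IHs => j js; apply: H; rewrite inE js orbT.
near=> u => j; rewrite inE => /orP[/eqP ->|]; first by near: u.
by move: j; near: u.
Unshelve. all: by end_near. Qed.

Lemma SO_near (f : R -> R[i]) (t d : R) : SO f -> Rpos t -> 0 < d ->
  \forall u \near t, normc (f u - f t) <= d.
Proof.
by move=> [/continuous_boundedP[cf _] _ _] t0; exact: cf.
Qed.

(** The points al_m t, for m in L, are distinct, so that a small interval around t has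
    disjoint images; phi is its normalized indicator. *)
Lemma bump (a : int -> R -> R[i]) (K L : seq int) (d t : R) : (forall k, SO (a k)) ->
  Rpos t -> 0 < d -> exists chi (phi : Lp p1),
  [/\ mult_symbol chi, forall u, Rpos u -> normc (chi u) <= 1, orbit_disjoint L chi,
      forall u k m, Rpos u -> chi u != 0 -> k \in K -> m \in L ->
        normc (a k (al m u) - a k (al m t)) <= d &
      mul_op p1 chi phi = phi /\ `|phi| = 1].
Proof.
move=> sa t0 d0.
have Hc : \forall u \near t, forall m, m \in L -> forall k, k \in K ->
    normc (a k (al m u) - a k (al m t)) <= d.
  apply: near_seq => m _; apply: near_seq => k _.
  have mt := orbit_map_pos gh hg m t0.
  exact: (orbit_map_cont gh hg t0 (SO_near (sa k) mt d0)).
have Hd : \forall u \near t, forall m, m \in L -> forall n, n \in L -> m != n ->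
    `|al m t - al m u| < `|al m t - al n t| / 2.
  apply: near_seq => m _; apply: near_seq => n _.
  have [->|mn] := eqVneq m n; first by near=> u.
  have e0 : 0 < `|al m t - al n t| / 2.
    rewrite divr_gt0// normr_gt0 subr_eq0; apply: contra mn => /eqP mn.
    rewrite -subr_eq0; apply/eqP; apply: (orbit_map_free gh hg free t0).
    by rewrite addrC (orbit_mapD gh hg)// mn (orbit_mapK gh hg).
  have /cvgrPdist_lt/(_ _ e0) h1 := orbit_map_cont (k := m) gh hg t0.
  by near=> u => _; near: u.
have [r r0 rP] : exists2 r, 0 < r & forall u, `|t - u| < r ->
    [/\ Rpos u, forall m, m \in L -> forall k, k \in K ->
    normc (a k (al m u) - a k (al m t)) <= d &
    forall m, m \in L -> forall n, n \in L -> m != n ->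
    `|al m t - al m u| < `|al m t - al n t| / 2].
  have : \forall u \near t, [/\ Rpos u, forall m, m \in L -> forall k, k \in K ->
      normc (a k (al m u) - a k (al m t)) <= d &
      forall m, m \in L -> forall n, n \in L -> m != n ->
      `|al m t - al m u| < `|al m t - al n t| / 2].
    have H0 := nbhs_Rpos t0; near=> u; split; [near: u; exact: H0|near: u; exact: Hc|].
    by near: u; exact: Hd.
  by move=> /nbhs_ballP[r r0 rP]; exists r => // u ur; exact: rP.
pose I : set R := `]t - r, t + r[%classic; have mI : measurable I by exact: measurable_itv.
have IE u : I u <-> `|t - u| < r.
  rewrite /I /= in_itv/= ltr_norml; split => /andP[? ?]; apply/andP; split; lra.
pose chi u : R[i] := (\1_I u)%:C.
have chiI u : chi u != 0 -> I u.
  by rewrite /chi indicE; have [/[!inE]//|_] := boolP (u \in I); rewrite eqxx.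
have chi1 u : normc (chi u) <= 1.
  by rewrite /chi indicE normc_realE normr_nat lern1 leq_b1.
have mchi : cmeasurable chi.
  split; last exact: measurable_cst.
  rewrite (_ : (fun _ => _) = (\1_I : R -> R))//; exact: measurable_indic.
have schi : mult_symbol chi by split => //; exists 1 => u _; exact: chi1.
have NI : (\int[mu]_(u in Rpos) (cabs chi u `^ p)%:E = (2 * r)%:E)%E.
  under eq_integral => u _.
    rewrite (_ : _ `^ _ = \1_I u); last first.
      rewrite /cabs /chi normc_realE normr_nat indicE.
      by case: (_ \in _) => /=; rewrite ?powR1// powR0// gt_eqF.
    over.
  rewrite integral_indic//; last exact: measurable_Rpos.
  rewrite setIidl; last by move=> u /IE/rP[].
  rewrite /I /= lebesgue_measure_itv/= lte_fin ifT; last by lra.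
  by rewrite -EFinB; congr EFin; ring.
have N : LpN p chi = ((2 * r) `^ p^-1)%:E by rewrite LpNE// NI poweR_EFin.
have cL : chi \in Lp_fun p1 by apply/Lp_funP; rewrite N ltry.
have N0 : 0 < (2 * r) `^ p^-1 by rewrite powR_gt0// mulr_gt0.
have nN : `|toLp p1 chi| = (2 * r) `^ p^-1 by apply: EFin_inj; rewrite toLp_norm.
exists chi, ((((2 * r) `^ p^-1)^-1)%:C *: toLp p1 chi); split => //.
- move=> m n u mL nL u0 /chiI/IE mu_ /chiI/IE nu; apply/eqP; apply/negPn/negP => mn.
  have [_ _ /(_ m mL n nL mn) h1] := rP _ mu_.
  have [_ _ /(_ n nL m mL)] := rP _ nu; rewrite eq_sym => /(_ mn) h2.
  move: h1 h2; rewrite !(orbit_mapNK gh hg)// (distrC (al n t) (al m t)) => h1 h2.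
  have := ler_distD u (al m t) (al n t); rewrite (distrC u); lra.
- by move=> u k m u0 /chiI/IE/rP[_ H _] kK mL; exact: H.
- split.
    rewrite Bop_mapZ mul_op_toLp//; congr (_ *: toLp p1 _); apply/funext => u.
    by rewrite /chi indicE; case: (_ \in _); rewrite /= ?mulr1 ?mulr0.
  rewrite Lp_normrZ nN normc_realE ger0_norm ?invr_ge0 ?powR_ge0//.
  by rewrite mulVf// gt_eqF.
Unshelve. all: by end_near. Qed.

End OrbitPieces.

(** * From operators to their fibers *)

Section FiberBounds.
Context {R : realType} {p : R} (p1 : 1 < p).
Variables (g h : R -> R).
Hypotheses (gh : pos_diffeo g h) (hg : pos_diffeo h g).
Hypothesis free : forall t, Rpos t -> g t != t.
Local Notation al := (orbit_map g h).
Local Notation fam := (int -> R -> R[i]).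
Local Notation U := (comp_op p1 g).
Local Notation fin_op := (fin_op p1 g).
Local Notation fadj := (fadj g h).
Local Notation fiber := (fiber g h).
Implicit Types (a : fam) (K J : seq int).

Let p0 : 0 < p. Proof. exact: lt_trans p1. Qed.

Lemma Bop_map_sum (T : Bop p1) (I : Type) (r : seq I) (x : I -> Lp p1) :
  T (\sum_(i <- r) x i) = \sum_(i <- r) T (x i).
Proof. exact: (big_morph _ (Bop_mapD T) (Bop_map0 T)). Qed.

Lemma comp_opXzD k l (x : Lp p1) : (U ^ k) ((U ^ l) x) = (U ^ (k + l)) x.
Proof. by rewrite -BopME -exprzDr// (comp_op_unit p1 gh hg). Qed.

Lemma mul_op_swap (b b' : R -> R[i]) (x : Lp p1) : mult_symbol b -> mult_symbol b' ->
  mul_op p1 b (mul_op p1 b' x) = mul_op p1 b' (mul_op p1 b x).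
Proof.
move=> sb sb'; rewrite -!BopME -!mul_opM//; congr (mul_op p1 _ x).
by apply/funext => t; rewrite mulrC.
Qed.

Lemma SO_orbit_symbol (f : R -> R[i]) m : SO f -> mult_symbol (f \o al m).
Proof. by move=> sf; apply: (mult_symbol_orbit gh hg); exact: SO_symbol. Qed.

Lemma fiber_symbol a K c m : (forall k, SO (a k)) ->
  mult_symbol (fun u => fiber a K u c m).
Proof.
move=> sa; rewrite (_ : (fun _ => _) = fun u => \sum_(k <- K) (a k \o al m) u * c (m + k)).
  apply: mult_symbol_sum => k; apply: mult_symbolM; last exact: mult_symbol_cst.
  exact: SO_orbit_symbol.
by apply/funext => u; rewrite fiberE.
Qed.

(** Applying the operator to the images U^(-m) (c_m phi) amounts to applying the fibers
    to c, with the point of the orbit still variable in the support of phi. *)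
Lemma orbit_fiber a K c m (phi : Lp p1) : (forall k, SO (a k)) ->
  (U ^ (- m)) (mul_op p1 (fun u => fiber a K u c m) phi) =
  \sum_(k <- K) mul_op p1 (a k) ((U ^ (- m)) (c (m + k) *: phi)).
Proof.
move=> sa.
have -> : mul_op p1 (fun u => fiber a K u c m) =
    \sum_(k <- K) mul_op p1 (fun u => (a k \o al m) u * c (m + k)).
  rewrite -mul_op_sum; last first.
    by move=> k; apply: mult_symbolM; [exact: SO_orbit_symbol|exact: mult_symbol_cst].
  by congr mul_op; apply/funext => u; rewrite fiberE.
rewrite Bop_sumE Bop_map_sum; apply: eq_bigr => k _.
rewrite mul_opM; last 2 first.
- exact: SO_orbit_symbol.
- exact: mult_symbol_cst.
rewrite BopME mul_op_cst -BopME (comp_opXz_mul p1 gh hg); last exact: SO_orbit_symbol.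
rewrite BopME; congr (Bop_fun _ _); apply: eq_mul_op.
- by apply: (mult_symbol_orbit gh hg); exact: SO_orbit_symbol.
- exact: SO_symbol.
- by move=> u u0; rewrite /= (orbit_mapNK gh hg).
Qed.

(** The operator is tested on the sum of the images U^(-n) (c_n phi), where phi is
    concentrated near t. The images have disjoint supports, so the norm of the sum is
    that of c, and the norm of its image is that of the fiber applied to c, up to an
    error that vanishes as the support of phi shrinks. *)
Lemma fiber_below a K (lam t : R) : (forall k, SO (a k)) -> 0 <= lam ->
  (forall x, `|x| <= lam * `|fin_op a K x|) -> Rpos t ->
  bounded_below p lam (fiber a K t).
Proof.
move=> sa l0 lb t0 c [J0 cJ0].
pose J := undup J0; have uJ : uniq J by exact: undup_uniq.
have cJ k : k \notin J -> c k = 0 by rewrite mem_undup; exact: cJ0.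
pose J' := undup [seq n - k | n <- J, k <- K].
have uJ' : uniq J' by exact: undup_uniq.
have fJ' m : m \notin J' -> fiber a K t c m = 0.
  move=> mJ'; rewrite fiberE big_seq big1// => k kK.
  rewrite cJ ?mulr0//; apply: contra mJ' => mkJ.
  by rewrite mem_undup; apply/allpairsP; exists (m + k, k); split => //=; rewrite addrK.
pose S := \sum_(m <- J') \sum_(k <- K) normc (c (m + k)).
have S0 : 0 <= S by apply: sumr_ge0 => m _; apply: sumr_ge0 => k _; exact: normc_ge0.
pose fib m := normc (fiber a K t c m).
suff H d : 0 < d -> lnorm p J (fun k => normc (c k)) <= lam * (lnorm p J' fib + d * S).
  rewrite /cseq_norm (lqnorm_lnorm p0 uJ); last by move=> k /cJ ->; rewrite normc0.
  rewrite (lqnorm_lnorm p0 uJ'); last by move=> k /fJ' ->; rewrite normc0.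
  rewrite -EFinM lee_fin; apply/ler_addgt0Pl => e e0.
  have D0 : 0 < lam * S + 1 by rewrite ltr_wpDl// mulr_ge0.
  apply: (le_trans (H (e / (lam * S + 1)) (divr_gt0 e0 D0))).
  rewrite mulrDr addrC lerD2r mulrCA -mulrA ler_piMr ?(ltW e0)//.
  by rewrite mulrC ler_pdivrMr// mul1r lerDl.
move=> d0.
have [chi [phi [sc c1 dis loc [cphi phi1]]]] := bump p1 gh hg free K (J ++ J') sa t0 d0.
pose b m u := fiber a K u c m.
have sb m : mult_symbol (b m) by exact: fiber_symbol.
pose f := \sum_(n <- J) (U ^ (- n)) (c n *: phi).
have disJ : orbit_disjoint g h J chi.
  by move=> m n u mJ nJ; apply: dis; rewrite mem_cat ?mJ ?nJ.
have disJ' : orbit_disjoint g h J' chi.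
  by move=> m n u mJ nJ; apply: dis; rewrite mem_cat ?mJ ?nJ orbT.
have Nf : `|f| = lnorm p J (fun k => normc (c k)).
  rewrite /f (orbit_sum_norm gh hg uJ sc disJ); last first.
    by move=> m; rewrite Bop_mapZ cphi.
  by apply: eq_lnorm => m _; rewrite Lp_normrZ phi1 mulr1.
have Af : fin_op a K f = \sum_(m <- J') (U ^ (- m)) (mul_op p1 (b m) phi).
  pose G k m := mul_op p1 (a k) ((U ^ (- m)) (c (m + k) *: phi)).
  have -> : \sum_(m <- J') (U ^ (- m)) (mul_op p1 (b m) phi) =
      \sum_(k <- K) \sum_(m <- J') G k m.
    rewrite exchange_big; apply: eq_bigr => m _; exact: orbit_fiber.
  rewrite Bop_sumE big_seq [RHS]big_seq; apply: eq_bigr => k kK.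
  transitivity (\sum_(m <- [seq n - k | n <- J]) G k m).
    rewrite big_map /fterm BopME /f !Bop_map_sum; apply: eq_bigr => n _.
    by rewrite /G comp_opXzD subrK opprB.
  symmetry; apply: sum_supp.
  - by rewrite map_inj_uniq// => i j /addIr.
  - exact: uJ'.
  - move=> _ /mapP[n nJ ->]; rewrite mem_undup; apply/allpairsP.
    by exists (n, k).
  - move=> m mJ; rewrite /G cJ ?scale0r ?Bop_map0//.
    by apply: contra mJ => mkJ; apply/mapP; exists (m + k) => //; rewrite addrK.
have NA : `|fin_op a K f| <= lnorm p J' fib + d * S.
  rewrite Af (orbit_sum_norm gh hg uJ' sc disJ'); last first.
    by move=> m; rewrite mul_op_swap// cphi.
  pose v m := d * \sum_(k <- K) normc (c (m + k)).
  have v0 m : 0 <= v m.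
    by rewrite mulr_ge0 ?(ltW d0)//; apply: sumr_ge0 => k _; exact: normc_ge0.
  apply: (@le_trans _ _ (lnorm p J' (fun m => fib m + v m))).
    apply: le_lnorm => // m mJ'; rewrite normr_id ger0_norm ?addr_ge0 ?normc_ge0//.
    rewrite -(subrK (fiber a K t c m *: phi) (mul_op p1 (b m) phi)) addrC.
    apply: (le_trans (ler_normD _ _)); apply: lerD.
      by rewrite Lp_normrZ phi1 mulr1.
    have := @mul_op_local _ _ p1 chi (b m) (fiber a K t c m) (v m) phi sc (sb m) (v0 m) c1.
    rewrite cphi phi1 mulr1; apply => u u0 cu.
    rewrite /b !fiberE -sumrB; apply: (le_trans (normc_sum _ _)).
    rewrite /v mulr_sumr big_seq [leRHS]big_seq; apply: ler_sum => k kK.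
    rewrite -mulrBl normcM ler_wpM2r ?normc_ge0//; apply: loc => //.
    by rewrite mem_cat mJ' orbT.
  apply: (le_trans (lnormD _ _ (ltW p1) uJ')); rewrite lerD2l.
  apply: (le_trans (lnorm_le_l1 _ (ltW p1) uJ')).
  rewrite /S mulr_sumr; apply: ler_sum => m _.
  by rewrite ger0_norm.
by rewrite -Nf; apply: (le_trans (lb f)); rewrite ler_wpM2l.
Qed.

Lemma fiber_fadjE a K c n t : Rpos t ->
  fiber (fadj a) (negs K) t c n = \sum_(k <- K) conjc (a k (al (n - k) t)) * c (n - k).
Proof.
move=> t0; rewrite fiberE /negs big_map; apply: eq_bigr => k _.
by rewrite /fadj opprK -(orbit_mapD gh hg)// (addrC (- k)).
Qed.

Lemma conjugate_power (q r : R) : 0 < q -> p^-1 + q^-1 = 1 -> 0 <= r ->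
  r `^ (q - 2) * r ^+ 2 = r `^ q /\ (r `^ (q - 2) * r) `^ p = r `^ q.
Proof.
move=> q0 pq; rewrite le_eqVlt => /predU1P[<-|r0].
  by rewrite expr0n/= !mulr0 !powR0 ?gt_eqF.
have e1 : r `^ (q - 2) * r = r `^ (q - 1).
  rewrite -[X in _ * X](powRr1 (ltW r0)) -powRD ?(gt_eqF r0) ?implybT//.
  by congr (_ `^ _); ring.
split.
  rewrite expr2 mulrA e1 -[X in _ * X](powRr1 (ltW r0)) -powRD ?(gt_eqF r0) ?implybT//.
  by rewrite subrK.
rewrite e1 -powRrM; congr (_ `^ _).
have q1 : q * p^-1 = q - 1.
  have := congr1 (fun s => q * s) pq; rewrite mulrDr mulfV ?(gt_eqF q0)// mulr1 => e.
  by apply/eqP; rewrite eq_sym subr_eq e.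
by rewrite -q1 mulfVK// gt_eqF.
Qed.

(** Let x be the sequence dual to y, so that the pairing of x and y is |y|_q |x|_p. Put
    f = sum_n U^(-n) (x_n phi) and v = B f. Up to errors f = A v; applying U^m and
    multiplying by chi gives x_m phi = sum_k a_k (al_m t) w_(m + k), where w_n is
    chi times U^n v. Pairing with y moves the matrix to y: |y|_q |x|_p is at most the
    pairing of w with the image z of y, which Hoelder's inequality bounds by
    |z|_q |v|. At most half of the left side is lost to the error of B as a right
    inverse, whence the factor 2. *)
Lemma fiber_adjoint_below a K (B : Bop p1) (lam q t : R) : (forall k, SO (a k)) ->
  0 < q -> p^-1 + q^-1 = 1 -> 0 <= lam -> `|B| <= lam -> `|fin_op a K * B - 1| <= 2^-1 ->
  Rpos t -> bounded_below q (2 * lam) (fiber (fadj a) (negs K) t).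
Proof.
move=> sa q0 pq l0 Bl AB t0 y [J0 yJ0].
pose J := undup J0; have uJ : uniq J by exact: undup_uniq.
have yJ k : k \notin J -> y k = 0 by rewrite mem_undup; exact: yJ0.
pose Jz := undup [seq m + k | m <- J, k <- K].
have uJz : uniq Jz by exact: undup_uniq.
pose z := fiber (fadj a) (negs K) t y.
pose Y := \sum_(m <- J) normc (y m) `^ q.
have Y0 : 0 <= Y by apply: sumr_ge0 => m _; exact: powR_ge0.
pose N := lnorm q J (fun m => normc (y m)).
pose Z := lnorm q Jz (fun m => normc (z m)).
have NE : N = Y `^ q^-1.
  rewrite /N lnorm.unlock; congr (_ `^ _); apply: eq_bigr => m _.
  by rewrite ger0_norm ?normc_ge0.
pose S := \sum_(m <- J) \sum_(k <- K) normc (y m).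
have S0 : 0 <= S by apply: sumr_ge0 => m _; apply: sumr_ge0 => k _; exact: normc_ge0.
suff H d : 0 < d -> N <= 2 * lam * (Z + d * S).
  rewrite /cseq_norm (lqnorm_lnorm q0 uJ); last by move=> k /yJ ->; rewrite normc0.
  apply: (@le_trans _ _ ((2 * lam)%:E * Z%:E)%E); last first.
    by apply: lee_wpmul2l; [rewrite lee_fin mulr_ge0|exact: le_lnorm_lqnorm].
  rewrite -EFinM lee_fin; apply/ler_addgt0Pl => e e0.
  have l20 : 0 <= 2 * lam by rewrite mulr_ge0.
  move: (2 * lam) l20 H => c l20 H.
  have D0 : 0 < c * S + 1 by rewrite ltr_wpDl// mulr_ge0.
  apply: (le_trans (H (e / (c * S + 1)) (divr_gt0 e0 D0))).
  rewrite mulrDr addrC lerD2r mulrCA -mulrA ler_piMr ?(ltW e0)//.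
  by rewrite mulrC ler_pdivrMr// mul1r lerDl.
move=> d0.
have Z0 : 0 <= Z by exact: lnorm_ge0.
have dS0 : 0 <= d * S by rewrite mulr_ge0// ltW.
have [Yz|Yn] := eqVneq Y 0.
  by rewrite NE Yz powR0 ?invr_neq0 ?gt_eqF// mulr_ge0 ?addr_ge0// mulr_ge0.
have Yp : 0 < Y by rewrite lt_neqAle eq_sym Yn.
have [chi [phi [sc c1 dis loc [cphi phi1]]]] := bump p1 gh hg free K (J ++ Jz) sa t0 d0.
have disJ : orbit_disjoint g h J chi.
  by move=> m n u mJ nJ; apply: dis; rewrite mem_cat ?mJ ?nJ.
have disJz : orbit_disjoint g h Jz chi.
  by move=> m n u mJ nJ; apply: dis; rewrite mem_cat ?mJ ?nJ orbT.
(* the dual sequence: conj(y_m) x_m = |y_m|^q and |x_m|^p = |y_m|^q *)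
pose x m := ((normc (y m)) `^ (q - 2))%:C * y m.
have xn m : normc (x m) = (normc (y m)) `^ (q - 2) * normc (y m).
  by rewrite /x normcM normc_realE ger0_norm// powR_ge0.
have yx m : conjc (y m) * x m = (normc (y m) `^ q)%:C.
  have [<- _] := conjugate_power q0 pq (normc_ge0 (y m)).
  by rewrite rmorphM/= -conjcM_normc /x mulrCA.
pose M := lnorm p J (fun m => normc (x m)).
have ME : M = Y `^ p^-1.
  rewrite /M lnorm.unlock; congr (_ `^ _); apply: eq_bigr => m _.
  rewrite ger0_norm ?normc_ge0// xn.
  by have [_ ->] := conjugate_power q0 pq (normc_ge0 (y m)).
have M0 : 0 < M by rewrite ME powR_gt0.
have NM : N * M = Y.
  by rewrite NE ME -powRD ?(gt_eqF Yp) ?implybT// addrC pq powRr1.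
pose f := \sum_(n <- J) (U ^ (- n)) (x n *: phi).
have Nf : `|f| = M.
  rewrite /f (orbit_sum_norm gh hg uJ sc disJ); last first.
    by move=> m; rewrite Bop_mapZ cphi.
  by apply: eq_lnorm => m _; rewrite Lp_normrZ phi1 mulr1.
pose v := B f; pose e := f - fin_op a K v.
have Nv : `|v| <= lam * M.
  by apply: (le_trans (Bop_normP _ _)); rewrite Nf ler_wpM2r// ltW.
have Ne : `|e| <= 2^-1 * M.
  have -> : e = - ((fin_op a K * B - 1) f) by rewrite BopDE BopNE BopME Bop1E opprB.
  by rewrite normrN; apply: (le_trans (Bop_normP _ _)); rewrite Nf ler_wpM2r// ltW.
pose w n := mul_op p1 chi ((U ^ n) v); pose u n := mul_op p1 chi ((U ^ n) e).
have wn n : `|w n| <= `|v|.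
  rewrite -[leRHS]mul1r -(comp_opXz_norm (p1 := p1) gh hg n v).
  exact: mul_op_norm_le.
have chif m : m \in J -> mul_op p1 chi ((U ^ m) f) = x m *: phi.
  move=> mJ; rewrite /f !Bop_map_sum (bigD1_seq m)//= big_seq_cond big1 ?addr0.
    by rewrite comp_opXzD addrN expr0z Bop1E Bop_mapZ cphi.
  move=> n /andP[nJ nm]; rewrite comp_opXzD !Bop_mapZ -cphi.
  rewrite -[(U ^ _) _]BopME (comp_opXz_mul p1 gh hg)// BopME -BopME -mul_opM//; last first.
    exact: (mult_symbol_orbit gh hg).
  have -> : mul_op p1 (fun s => chi s * (chi \o al (m - n)) s) = 0.
    rewrite -(mul_op0 p1); apply: eq_mul_op.
    - by apply: mult_symbolM => //; exact: (mult_symbol_orbit gh hg).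
    - exact: mult_symbol_cst.
    move=> s s0; apply/eqP; rewrite mulf_eq0 /=; apply/norP => -[h1 h2].
    have ms := orbit_map_pos gh hg m s0.
    suff mn : m = n by rewrite mn eqxx in nm.
    apply: (disJ m n (al m s)) => //; first by rewrite (orbit_mapK gh hg).
    by rewrite -(orbit_mapD gh hg)// addrC.
  by rewrite Bop0E scaler0.
have chiA m : mul_op p1 chi ((U ^ m) (fin_op a K v)) =
    \sum_(k <- K) mul_op p1 (a k \o al m) (w (m + k)).
  rewrite Bop_sumE !Bop_map_sum; apply: eq_bigr => k _.
  rewrite /fterm BopME -[(U ^ m) _]BopME (comp_opXz_mul p1 gh hg); last exact: SO_symbol.
  by rewrite BopME comp_opXzD mul_op_swap//; exact: SO_orbit_symbol.
have xE m : m \in J -> x m *: phi = \sum_(k <- K) mul_op p1 (a k \o al m) (w (m + k)) + u m.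
  by move=> mJ; rewrite -chif// -chiA /u -!Bop_mapD /e addrC subrK.
have pairE : \sum_(m <- J) conjc (y m) *: (\sum_(k <- K) a k (al m t) *: w (m + k)) =
    \sum_(n <- Jz) conjc (z n) *: w n.
  have -> : \sum_(n <- Jz) conjc (z n) *: w n =
      \sum_(n <- Jz) \sum_(k <- K) (a k (al (n - k) t) * conjc (y (n - k))) *: w n.
    apply: eq_bigr => n _; rewrite /z fiber_fadjE// rmorph_sum scaler_suml.
    by apply: eq_bigr => k _; rewrite rmorphM/= conjcK.
  under eq_bigr do rewrite scaler_sumr.
  rewrite exchange_big [RHS]exchange_big big_seq [RHS]big_seq; apply: eq_bigr => k kK.
  pose G n := (a k (al (n - k) t) * conjc (y (n - k))) *: w n.
  transitivity (\sum_(n <- [seq m + k | m <- J]) G n).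
    by rewrite big_map; apply: eq_bigr => m _; rewrite /G addrK scalerA mulrC.
  symmetry; apply: sum_supp.
  - by rewrite map_inj_uniq// => i j /addIr.
  - exact: uJz.
  - move=> _ /mapP[n nJ ->]; rewrite mem_undup; apply/allpairsP.
    by exists (n, k).
  - move=> n nJ; rewrite /G yJ ?conjc0 ?mulr0 ?scale0r//.
    by apply: contra nJ => nkJ; apply/mapP; exists (n - k) => //; rewrite subrK.
pose r m := \sum_(k <- K) (mul_op p1 (a k \o al m) (w (m + k)) - a k (al m t) *: w (m + k)).
have rn m : m \in J -> `|r m| <= \sum_(k <- K) d * `|v|.
  move=> mJ; apply: (le_trans (ler_norm_sum _ _ _)).
  rewrite big_seq [leRHS]big_seq; apply: ler_sum => k kK.
  have := @mul_op_local _ _ p1 chi (a k \o al m) (a k (al m t)) d ((U ^ (m + k)) v) sc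
    (SO_orbit_symbol m (sa k)) (ltW d0) c1.
  have e' := comp_opXz_norm (p1 := p1) gh hg (m + k) v; rewrite e'; apply => s s0 cs.
  by apply: loc => //; rewrite mem_cat mJ.
have split3 : Y%:C *: phi = \sum_(m <- J) conjc (y m) *: r m +
    \sum_(n <- Jz) conjc (z n) *: w n + \sum_(m <- J) conjc (y m) *: u m.
  rewrite -pairE -!big_split/= /Y rmorph_sum/= scaler_suml big_seq [RHS]big_seq.
  apply: eq_bigr => m mJ; rewrite -yx -scalerA xE// -!scalerDr; congr (_ *: (_ + _)).
  by rewrite /r -big_split/=; apply: eq_bigr => k _; rewrite subrK.
have nsum (I : eqType) (s : seq I) (c : I -> R[i]) (X : I -> Lp p1) :
    `|\sum_(i <- s) c i *: X i| <= \sum_(i <- s) normc (c i) * `|X i|.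
  apply: (le_trans (ler_norm_sum _ _ _)); apply: ler_sum => i _.
  by rewrite Lp_normrZ.
have b1 : `|\sum_(m <- J) conjc (y m) *: r m| <= d * S * `|v|.
  apply: (le_trans (nsum _ _ _ _)); rewrite /S mulrAC mulr_sumr big_seq [leRHS]big_seq.
  apply: ler_sum => m mJ; rewrite normc_conjc mulr_sumr.
  apply: (@le_trans _ _ (normc (y m) * \sum_(k <- K) d * `|v|)).
    by rewrite ler_wpM2l ?normc_ge0// rn.
  by rewrite mulr_sumr; apply: ler_sum => k _; rewrite mulrC.
have b2 : `|\sum_(n <- Jz) conjc (z n) *: w n| <= Z * `|v|.
  apply: (le_trans (nsum _ _ _ _)).
  apply: (@le_trans _ _ (lnorm p Jz (fun n => `|w n|) * Z)).
    apply: le_trans (lnorm_hoelder _ _ _ p0 q0 pq); apply: ler_sum => n _.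
    by rewrite normc_conjc mulrC ger0_norm// ger0_norm// normc_ge0.
  by rewrite mulrC ler_wpM2l//; exact: (orbit_window_norm gh hg).
have b3 : `|\sum_(m <- J) conjc (y m) *: u m| <= N * `|e|.
  apply: (le_trans (nsum _ _ _ _)).
  apply: (@le_trans _ _ (lnorm p J (fun n => `|u n|) * N)).
    apply: le_trans (lnorm_hoelder _ _ _ p0 q0 pq); apply: ler_sum => n _.
    by rewrite normc_conjc mulrC ger0_norm// ger0_norm// normc_ge0.
  by rewrite mulrC ler_wpM2l ?lnorm_ge0//; exact: (orbit_window_norm gh hg).
have N0 : 0 <= N by exact: lnorm_ge0.
have main : N * M <= (Z + d * S) * (lam * M) + N * (2^-1 * M).
  have -> : N * M = `|Y%:C *: phi| by rewrite Lp_normrZ phi1 mulr1 normc_realE ger0_norm// NM.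
  rewrite split3; apply: (le_trans (ler_normD _ _)); apply: lerD; last first.
    by apply: (le_trans b3); rewrite ler_wpM2l.
  apply: (le_trans (ler_normD _ _)); rewrite mulrDl addrC; apply: lerD.
    by apply: (le_trans b2); rewrite ler_wpM2l.
  by apply: (le_trans b1); rewrite ler_wpM2l.
have : N <= (Z + d * S) * lam + N * 2^-1 by rewrite -(ler_pM2r M0) mulrDl -!mulrA.
lra.
Qed.

End FiberBounds.

(** * The Wiener algebra *)

Section Stability.
Context {R : realType} {p : R} (p1 : 1 < p).
Variables (g h : R -> R).
Hypotheses (gh : pos_diffeo g h) (hg : pos_diffeo h g).
Hypothesis free : forall t, Rpos t -> g t != t.
Hypothesis ratio : forall k, exists2 L : R, 0 < L & forall t, Rpos t ->
  L^-1 * t <= orbit_map g h k t /\ orbit_map g h k t <= L * t.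
Local Notation fam := (int -> R -> R[i]).
Local Notation wop := (wop p1 g).
Local Notation fin_op := (fin_op p1 g).
Local Notation fadj := (fadj g h).
Implicit Types (a b : fam).

Let p0 : 0 < p. Proof. exact: lt_trans p1. Qed.

(** A left inverse gives a lower bound, which survives the small perturbation from the
    operator to its truncations. *)
Lemma left_invertible_fibers a : inW a -> left_invertible (wop a) ->
  exists M n0, 0 <= M /\ fibers_below g h a p M n0.
Proof.
move=> aW [S SA]; have s0 : 0 < 2 * (`|S| + 1) by rewrite mulr_gt0// ltr_wpDl.
have s00 : 0 < (2 * (`|S| + 1))^-1 by rewrite invr_gt0.
have [n0 n0P] := tends_fin_op p1 gh hg aW s00.
exists (2 * `|S|), n0; split => [|n t /n0P near t0]; first by rewrite mulr_ge0.
apply: (fiber_below (p1 := p1) gh hg free) => //; [by case: aW|move=> x].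
have h1 : `|x| <= `|S| * `|wop a x|.
  by rewrite -{1}[x]Bop1E -SA BopME; exact: Bop_normP.
have h2 : `|wop a x| <= `|fin_op a (ball_seq n) x| + (2 * (`|S| + 1))^-1 * `|x|.
  rewrite -[in leLHS](subrK (fin_op a (ball_seq n)) (wop a)) BopDE addrC.
  apply: (le_trans (ler_normD _ _)); rewrite lerD2l.
  by apply: (le_trans (Bop_normP _ _)); rewrite ler_wpM2r// distrC.
have h3 : `|S| * (2 * (`|S| + 1))^-1 <= 2^-1.
  by rewrite ler_pdivrMr// mulrA mulVf// mul1r lerDl.
have h4 : `|S| * `|wop a x| <= `|S| * `|fin_op a (ball_seq n) x| + 2^-1 * `|x|.
  apply: (le_trans (ler_wpM2l (normr_ge0 S) h2)); rewrite mulrDr lerD2l mulrA.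
  by rewrite ler_wpM2r.
by rewrite -mulrA; lra.
Qed.

Lemma fin_op_fadjK a (K : seq int) : inW a -> fin_op (fadj (fadj a)) K = fin_op a K.
Proof.
move=> aW; apply: eq_bigr => k _; congr (_ * _); apply: eq_mul_op.
- by apply: SO_symbol; case: (inW_fadj gh hg ratio (inW_fadj gh hg ratio aW)).
- by apply: SO_symbol; case: aW.
- by move=> t t0; rewrite (fadjK gh hg).
Qed.

Lemma wop_fadjK a : inW a -> wop (fadj (fadj a)) = wop a.
Proof.
move=> aW; apply: (wop_ext p1 gh hg) => //.
- by do 2 apply: (inW_fadj gh hg ratio).
- by move=> k t t0; rewrite (fadjK gh hg).
Qed.

(** A right inverse of the operator is an approximate right inverse of its
    truncations. *)
Lemma right_invertible_fibers a (q : R) : inW a -> 0 < q -> p^-1 + q^-1 = 1 ->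
  right_invertible (wop a) -> exists M n0, 0 <= M /\ fibers_below g h (fadj a) q M n0.
Proof.
move=> aW q0 pq [S AS]; have s0 : 0 < 2 * (`|S| + 1) by rewrite mulr_gt0// ltr_wpDl.
have s00 : 0 < (2 * (`|S| + 1))^-1 by rewrite invr_gt0.
have [n0 n0P] := tends_fin_op_fadj p1 gh hg ratio (inW_fadj gh hg ratio aW) s00.
exists (2 * `|S|), n0; split => [|n t /n0P near t0]; first by rewrite mulr_ge0.
have negsK (K : seq int) : negs (negs K) = K by rewrite /negs mapK//; exact: opprK.
rewrite -[ball_seq n]negsK.
apply: (fiber_adjoint_below gh hg free (B := S)) => //; first by case: aW.
rewrite -AS -mulrBl; apply: (le_trans (Bop_normM _ _)).
move: near; rewrite fin_op_fadjK// wop_fadjK// => near.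
apply: (@le_trans _ _ ((2 * (`|S| + 1))^-1 * `|S|)); first by rewrite ler_wpM2r.
by rewrite mulrC ler_pdivrMr// mulrA mulVf// mul1r lerDl.
Qed.

(** A left inverse and a right inverse of the same operator coincide. *)
Lemma gram_unit a q M n0 : inW a -> 1 <= q -> 0 <= M -> fibers_below g h a q M n0 ->
  wop (fadj a) * wop a \is a GRing.unit /\
  exists2 b, inW b & (wop (fadj a) * wop a)^-1 = wop b.
Proof.
move=> aW q1 M0 /(gram_inverse p1 gh hg ratio aW q1 M0)[b [bW rb lb]].
set G := wop (fadj a) * wop a in rb lb *.
have e : wop (fadj b) = wop b by rewrite -[LHS]mulr1 -rb mulrA lb mul1r.
have uG : G \is a GRing.unit by apply/Bop_unitP; exists (wop b); rewrite -{1}e.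
by split => //; exists b => //; apply: (mulrI uG); rewrite divrr// rb.
Qed.

End Stability.

Lemma mult_symbol_eq {R : realType} (b b' : R -> R[i]) : mult_symbol b ->
  (forall t, Rpos t -> b t = b' t) -> mult_symbol b'.
Proof.
move=> [[mr mi] [M bM]] bb; split; last first.
  by exists M => t t0; rewrite -bb//; exact: bM.
by split; [move: mr|move: mi]; apply: eq_measurable_fun => t /[!inE] t0; rewrite bb.
Qed.

Section WienerAlgebra.
Context {R : realType} {p : R} (p1 : 1 < p).
Variables (alpha : \bar R -> \bar R) (alphaP : SOS alpha).
Local Notation g := (fin_shift alpha).
Local Notation h := (fin_shift (shift_inv alpha)).
Let gh : pos_diffeo g h := SOS_diffeo alphaP.
Let hg : pos_diffeo h g := SOS_inv_diffeo alphaP.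

Lemma summable_inW (a : int -> R -> R[i]) : (forall k, SO (a k)) ->
  summable [set: int] (fun k => (cb_norm (a k))%:E) <-> inW a.
Proof.
have e : (\esum_(k in [set: int]) `|(cb_norm (a k))%:E| = Wnorm a)%E.
  by apply: eq_esum => k _; rewrite gee0_abs// lee_fin cb_norm_ge0.
by rewrite /summable e => sa; split => [|[]].
Qed.

Lemma W_series_wop (a : int -> R -> R[i]) (A : Bop p1) :
  W_series alpha a A <-> inW a /\ A = wop p1 g a.
Proof.
split=> [[sa /(summable_inW sa) aW]|[aW ->]].
  by rewrite shift_opE => /wop_unique ->.
split; [by case: aW|by apply/summable_inW => //; case: aW|rewrite shift_opE].
exact: (wopP p1 gh hg).
Qed.

Lemma W_SO_wop (a : int -> R -> R[i]) : inW a -> W_SO alpha (wop p1 g a).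
Proof. by move=> aW; exists a; apply/W_series_wop. Qed.

Lemma adjoint_series (a : int -> R -> R[i]) : inW a ->
  is_opsum (fun k =>
    mul_op p1 (fun t => conjc (a k (fine (shift_iter alpha (- k) t%:E))))
    * shift_op p1 alpha ^ (- k)) (wop p1 g (fadj g h a)).
Proof.
move=> aW; have adW := inW_fadj gh hg (orbit_ratio alphaP) aW.
have := opsum_reindex (@opprK int) (@opprK int) (wopP p1 gh hg adW).
apply: eq_opsum => k; rewrite /= /fterm shift_opE; congr (_ * _).
have sk : mult_symbol (fadj g h a (- k)) by apply: SO_symbol; case: adW.
have E t : Rpos t -> fadj g h a (- k) t =
    conjc (a k (fine (shift_iter alpha (- k) t%:E))).
  by move=> t0; rewrite /fadj opprK (shift_iterE alphaP)//.
by apply: eq_mul_op => //; exact: mult_symbol_eq E.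
Qed.

End WienerAlgebra.

Theorem theorem3p3 (R : realType) (p : R) (p1 : 1 < p)
    (alpha : \bar R -> \bar R) (alphaP : SOS alpha)
    (a : int -> R -> R[i]) (A : Bop p1) (AP : W_series alpha a A) :
  exists Ad : Bop p1,
    [/\ is_opsum (fun k =>
          mul_op p1 (fun t => conjc (a k (fine (shift_iter alpha (- k) t%:E))))
          * shift_op p1 alpha ^ (- k)) Ad,
        W_SO alpha Ad,
        left_invertible A ->
        [/\ (Ad * A) \is a GRing.unit,
            ((Ad * A)^-1 * Ad) * A = 1 &
            W_SO alpha ((Ad * A)^-1 * Ad)] &
        right_invertible A ->
        [/\ (A * Ad) \is a GRing.unit,
            A * (Ad * (A * Ad)^-1) = 1 &
            W_SO alpha (Ad * (A * Ad)^-1)]].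
Proof.
have gh := SOS_diffeo alphaP; have hg := SOS_inv_diffeo alphaP.
have free t : Rpos t -> fin_shift alpha t != t by exact: SOS_free.
have ratio := orbit_ratio alphaP.
have [aW ->] := (W_series_wop (p1 := p1) alphaP a A).1 AP.
set g := fin_shift alpha in gh hg free ratio *.
set h := fin_shift (shift_inv alpha) in gh hg ratio.
have adW := inW_fadj gh hg ratio aW.
exists (wop p1 g (fadj g h a)); split.
- exact: adjoint_series.
- exact: W_SO_wop.
- move=> /(left_invertible_fibers gh hg free aW)[M [n0 [M0 lb]]].
  have [uG [b bW bE]] := gram_unit p1 gh hg ratio aW (ltW p1) M0 lb.
  split => //; first by rewrite -mulrA mulVr.
  rewrite bE; have [c cW <-] := wop_mul p1 gh hg ratio bW adW.
  exact: W_SO_wop.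
have p0 : 0 < p := lt_trans ltr01 p1.
pose q := (1 - p^-1)^-1.
have pi1 : p^-1 < 1 by rewrite invf_lt1.
have pi0 : 0 < p^-1 by rewrite invr_gt0.
have q0 : 0 < q by rewrite invr_gt0 subr_gt0.
have q1 : 1 <= q by rewrite invf_ge1 ?subr_gt0// gerBl ltW.
have pq : p^-1 + q^-1 = 1 by rewrite /q invrK addrC subrK.
move=> /(right_invertible_fibers gh hg free ratio aW q0 pq)[M [n0 [M0 lb]]].
have [uG [b bW bE]] := gram_unit p1 gh hg ratio adW q1 M0 lb.
rewrite (wop_fadjK p1 gh hg ratio aW) in uG bE.
split => //; first by rewrite mulrA divrr.
rewrite bE; have [c cW <-] := wop_mul p1 gh hg ratio adW bW.
exact: W_SO_wop.
Qed.
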